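(* If $\eta=(\eta_n)_{n\in\mathbb{Z}}$ is given by one of the following three examples, then the transformation $\eta\mapsto T\eta$ is ergodic (with respect to the law of $\eta$): (a) i.i.d. Bernoulli random variables with parameter $p\in[0,\frac12)$; (b) the two-sided stationary Markov chain on $\{0,1\}$ with $\mathbf{P}(\eta_{n+1}=1\mid\eta_n=j)=p_j$, $j\in\{0,1\}$, where $p_0\in(0,1)$, $p_1\in[0,1)$ satisfy $p_0+p_1<1$; (c) the configuration obtained by conditioning i.i.d. Bernoulli($p$) random variables, $p\in(0,1)$, on $\sup_{n\in\mathbb{Z}}W_n\le K$, $K\in\mathbb{Z}_+$ (in the sense specified in the context).
   Context: $\mathbb{Z}_+=\{0,1,2,\dots\}$. A particle configuration is $\eta=(\eta_n)_{n\in\mathbb{Z}}\in\{0,1\}^{\mathbb{Z}}$. Its path encoding is $S$ with $S_0=0$, $S_n-S_{n-1}=1-2\eta_n$. Let $M_n=\sup_{m\le n}S_m$. When $M_0<\infty$, $(TS)_n=2M_n-S_n-2M_0$, $T\eta$ is the configuration with path encoding $TS$, and the carrier process is $W=M-S$. For the three examples $T\eta$ is a.s. well-defined. Conditioned configuration in (c): let $P(x,x+1)=p$ for $x\ge0$, $P(x,x-1)=1-p$ for $x\ge1$, $P(0,0)=1-p$, and $P(x,y)=0$ otherwise. Let $P^{(K)}$ be the restriction of $P$ to $\{0,\dots,K\}$, $\lambda_K\in(0,1)$ its eigenvalue of largest magnitude, and $h_K$ the strictly positive right eigenvector, $P^{(K)}h_K=\lambda_Kh_K$. Let $\tilde{P}^{(K)}(x,y)=P^{(K)}(x,y)h_K(y)/(\lambda_Kh_K(x))$,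 and let $\tilde W^{(K)}$ be the two-sided stationary Markov chain on $\{0,\dots,K\}$ with transition matrix $\tilde P^{(K)}$. The conditioned configuration is $\eta_n=\mathbf{1}_{\{\tilde W^{(K)}_n=\tilde W^{(K)}_{n-1}+1\}}$. *)

(* Defs.v *)
From mathcomp Require Import all_boot all_order all_algebra.
From mathcomp Require Import finmap.
From mathcomp Require Import complex.
From mathcomp Require Import all_classical all_reals all_analysis.
From mathcomp Require Import zify ring lra.

Set Implicit Arguments.
Unset Strict Implicit.
Unset Printing Implicit Defensive.

Import Order.TTheory GRing.Theory Num.Theory.

Local Open Scope classical_set_scope.
Local Open Scope ring_scope.

(* {0,1}^Z with the product sigma-algebra; [true] is a particle. *)
Definition config :=
  g_sigma_algebraType (\bigcup_(n : int)
    preimage_set_system [set: int -> bool] (fun x : int -> bool => x n)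
      measurable).

Section PathEncoding.
Implicit Type eta : config.

Definition path_encoding eta (n : int) : int :=
  match n with
  | Posz k => \sum_(i < k) (1 - 2 * (eta (i%:Z + 1))%:Z)
  | Negz k => - \sum_(i < k.+1) (1 - 2 * (eta (- i%:Z))%:Z)
  end.

Lemma path_encoding0 eta : path_encoding eta 0 = 0.
Proof. by rewrite /= big_ord0. Qed.

Lemma path_encoding_step eta n :
  path_encoding eta n - path_encoding eta (n - 1) = 1 - 2 * (eta n)%:Z.
Proof.
case: n => [[|k]|k].
- rewrite (_ : (0%:Z - 1) = Negz 0) //= big_ord0 big_ord1 /= oppr0.
  by rewrite sub0r opprK.
- have -> : k.+1%:Z - 1 = k by lia.
  rewrite /= big_ord_recr /=; have -> : k%:Z + 1 = k.+1 by lia.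
  by rewrite addrAC subrr add0r.
- have -> : Negz k - 1 = Negz k.+1 by lia.
  rewrite /= [in X in _ - X]big_ord_recr /=.
  have -> : - k.+1%:Z = Negz k by lia.
  by rewrite opprK addKr.
Qed.

End PathEncoding.

Section Pitman.
Variable R : realType.
Implicit Type eta : config.

(* The values S_m for m <= n. *)
Definition past eta (n : int) : set R :=
  [set (path_encoding eta m)%:~R | m in [set m : int | m <= n]].

(* M_n; meaningful only under [pitman_defined], since [sup] of a set which is
   not bounded above is 0. *)
Definition past_max eta (n : int) : R := sup (past eta n).

Definition pitman_path eta (n : int) : R :=
  2 * past_max eta n - (path_encoding eta n)%:~R - 2 * past_max eta 0.

(* M_0 < oo *)
Definition pitman_defined eta : Prop := has_ubound (past eta 0).

Definition pitman eta : config :=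
  fun n => pitman_path eta n - pitman_path eta (n - 1) == -1.

Lemma past_has_sup eta n : pitman_defined eta -> has_sup (past eta n).
Proof.
move=> [B HB]; split; first by exists (path_encoding eta n)%:~R, n => /=.
have step m : has_ubound (past eta m) -> has_ubound (past eta (m + 1)).
  move=> [C HC]; exists (Num.max C (path_encoding eta (m + 1))%:~R) => _ [k /= km <-].
  rewrite le_max; have [->|kn] := eqVneq k (m + 1); first by rewrite lexx orbT.
  by rewrite HC //; exists k => //=; lia.
have pos (k : nat) : has_ubound (past eta k).
  elim: k => [|k IH]; first by exists B.
  by rewrite (_ : k.+1%:Z = k%:Z + 1); [exact: step|lia].
case: n => k; first exact: pos.
by exists B => _ [m /= mk <-]; apply: HB; exists m => //=; lia.
Qed.

Lemma pitman_path_step eta n : pitman_defined eta ->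
  pitman_path eta n - pitman_path eta (n - 1) = 1 \/
  pitman_path eta n - pitman_path eta (n - 1) = -1.
Proof.
move=> D.
have [_ ub] := past_has_sup n D; have [_ ub1] := past_has_sup (n - 1) D.
have ne m : past eta m !=set0 by exists (path_encoding eta m)%:~R, m => /=.
have le1 : past_max eta (n - 1) <= past_max eta n.
  apply: ge_sup => // _ [m /= mn <-]; apply: ub_le_sup => //.
  by exists m => //=; lia.
have leS m k : m <= k -> (path_encoding eta m)%:~R <= past_max eta k.
  by move=> mk; apply: ub_le_sup; [have [] := past_has_sup k D|exists m].
have leM x : past_max eta (n - 1) <= x -> (path_encoding eta n)%:~R <= x ->
    past_max eta n <= x.
  move=> h1 h2; apply: ge_sup => // _ [m /= mn <-].
  have [->//|mn'] := eqVneq m n.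
  by apply: le_trans h1; apply: leS; lia.
have st : (path_encoding eta n)%:~R - (path_encoding eta (n - 1))%:~R = 1 - 2 * (eta n)%:R :> R.
  have := congr1 (fun z : int => z%:~R : R) (path_encoding_step eta n).
  by rewrite !rmorphB rmorphM /= => ->; rewrite -pmulrn.
have := leS (n - 1) (n - 1) (lexx _).
rewrite /pitman_path; case E: (eta n) st => /= st l0.
  left; suff -> : past_max eta n = past_max eta (n - 1) by lra.
  by apply/eqP; rewrite eq_le le1 leM //; lra.
have [h|h] := lerP (path_encoding eta n)%:~R (past_max eta (n - 1)).
  right; suff -> : past_max eta n = past_max eta (n - 1) by lra.
  by apply/eqP; rewrite eq_le le1 leM.
left.
have -> : past_max eta n = (path_encoding eta n)%:~R.
  by apply/eqP; rewrite eq_le leS // leM // ltW.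
suff -> : past_max eta (n - 1) = (path_encoding eta (n - 1))%:~R by lra.
apply/eqP; rewrite eq_le l0 andbT; apply: ge_sup => // _ [m /= mn <-].
have : (path_encoding eta m)%:~R < (path_encoding eta n)%:~R :> R.
  by apply: le_lt_trans h; exact: leS.
rewrite ltr_int => mp.
by have := path_encoding_step eta n; rewrite E ler_int; lia.
Qed.

Lemma path_encoding_pitman eta n : pitman_defined eta ->
  (path_encoding (pitman eta) n)%:~R = pitman_path eta n.
Proof.
move=> D.
have step m : (path_encoding (pitman eta) m)%:~R - (path_encoding (pitman eta) (m - 1))%:~R
    = pitman_path eta m - pitman_path eta (m - 1).
  have := congr1 (fun z : int => z%:~R : R) (path_encoding_step (pitman eta) m).
  rewrite !rmorphB rmorphM /= => ->; rewrite -pmulrn /pitman.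
  by case: (pitman_path_step m D) => ->; case: eqP => //=; lra.
have z : (path_encoding (pitman eta) 0)%:~R = pitman_path eta 0.
  by rewrite path_encoding0 /pitman_path path_encoding0; lra.
elim/int_ind: n => [//|k IH|k IH].
- have := step k.+1%:Z; rewrite (_ : k.+1%:Z - 1 = k); last lia.
  by rewrite IH; lra.
- have := step (- k%:Z); rewrite (_ : - k%:Z - 1 = - k.+1%:Z); last lia.
  by rewrite IH; lra.
Qed.

End Pitman.

Section Ergodicity.
Context d (T : measurableType d) (R : realType).

Definition measure_preserving (mu : probability T R) (f : T -> T) : Prop :=
  measurable_fun setT f /\
  forall A : set T, measurable A -> mu (f @^-1` A) = mu A.

(* Sets are invariant up to null sets, so that a modification of [f] on a null
   set does not matter. *)
Definition ergodic (mu : probability T R) (f : T -> T) : Prop :=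
  measure_preserving mu f /\
  forall A : set T, measurable A -> {ae mu, forall x, A (f x) <-> A x} ->
    mu A = 0%E \/ mu A = 1%E.

End Ergodicity.

Section Processes.
Context d (Omega : measurableType d) (R : realType).
Variable Prob : probability Omega R.

Definition mutually_independent d' (T : measurableType d') (I : choiceType)
    (X : I -> Omega -> T) : Prop :=
  forall (J : {fset I}) (B : I -> set T), (forall i, measurable (B i)) ->
    Prob (\bigcap_(i in [set` J]) X i @^-1` B i)
    = (\prod_(i <- J) Prob (X i @^-1` B i))%E.

Definition iid_bernoulli (p : R) (X : int -> Omega -> bool) : Prop :=
  mutually_independent X /\
  forall n B, Prob (X n @^-1` B) = bernoulli_prob p B.

Definition trajectory (S : Type) (X : int -> Omega -> S) (m : int) (n : nat)
    (s : nat -> S) : set Omega :=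
  [set w | forall i : nat, (i <= n)%N -> X (m + i%:Z) w = s i].

(* The Markov property is in product form, which avoids conditioning on
   trajectories of probability 0. *)
Definition stationary_markov_chain (S : Type) (Q : S -> S -> R)
    (X : int -> Omega -> S) : Prop :=
  [/\ forall n s, measurable (X n @^-1` [set s]),
      forall m n s, Prob (trajectory X m n.+1 s)
        = (Prob (trajectory X m n s) * (Q (s n) (s n.+1))%:E)%E &
      forall m k n s, Prob (trajectory X m n s) = Prob (trajectory X k n s)].

End Processes.

Section Conditioned.
Variables (R : realType) (p : R).

Definition walk (x y : nat) : R :=
  if y == x.+1 then p
  else if (x == y.+1) || ((x == 0%N) && (y == 0%N)) then 1 - p
  else 0.

Variable K : nat.

Definition walk_mx : 'M[R]_K.+1 := \matrix_(x, y) walk x y.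

(* Eigenvalues range over the complex numbers. *)
Definition dominant_eigenvalue (lam : R) : Prop :=
  eigenvalue walk_mx lam /\
  forall z : R[i], eigenvalue (map_mx (real_complex R) walk_mx) z ->
    `|z| <= (`|lam|)%:C%C.

Definition doob_transform (lam : R) (h : 'cV[R]_K.+1) (x y : 'I_K.+1) : R :=
  walk_mx x y * h y ord0 / (lam * h x ord0).

Definition conditioned_bernoulli d (Omega : measurableType d)
    (Prob : probability Omega R) (X : int -> Omega -> bool) : Prop :=
  exists (lam : R) (h : 'cV[R]_K.+1) (W : int -> Omega -> 'I_K.+1),
    [/\ 0 < lam < 1 /\ dominant_eigenvalue lam,
        forall x, 0 < h x ord0,
        walk_mx *m h = lam *: h,
        stationary_markov_chain Prob (doob_transform lam h) W &
        forall n w, X n w = (W n w == (W (n - 1) w).+1 :> nat)].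

End Conditioned.

(* Main.v *)
(* Let W be the carrier of the box-ball system, so that eta_n is recovered from
   (T eta)_n and W_n: the local rule (eta_n, W_(n-1)) -> ((T eta)_n, W_n) is a
   bijection.  Reading a window from right to left, (eta_m)_(N-L < m <= N) is
   therefore a function of the same window of T eta and of the load W_N.  In
   each example the law of W_N given the past (T eta)_(m <= N) depends only on
   a state s of T eta at N with finitely many values: (T eta)_N for the Markov
   chains (which contain the i.i.d. case), the carrier of T eta at N for the
   conditioned configuration.  Summing over W_N gives invariance, and the
   process of windows and states of T^k eta is a finite Markov chain in reversed
   time k.  An empty load W_N = 0 has probability bounded below and, repeated
   L + 1 times, empties a window of length L, so Doeblin's condition holds and
   T is mixing. *)

Require Import Defs.
From HB Require Import structures.
From mathcomp Require Import finmap.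
From mathcomp Require Import all_boot all_order all_algebra.
From mathcomp Require Import all_classical all_reals all_analysis.
From mathcomp Require Import zify ring lra.

Set Implicit Arguments.
Unset Strict Implicit.
Unset Printing Implicit Defensive.

Import Order.TTheory GRing.Theory Num.Theory.
Import numFieldNormedType.Exports.

Local Open Scope classical_set_scope.
Local Open Scope ring_scope.

(** * The carrier and the box-ball dynamics *)

(** Forward in time a window is not autonomous: the load entering it from the left depends on the
    whole past. Backwards only the load at the right end matters, and only up to the window length,
    which makes the chain of windows finite. It is Markov because the load law is taken given the
    whole past of T eta: the identity E(C o T, f) = E(C, Q f) holds for past events C of infinite
    range, hence also for C o T, and can be iterated.

    The load laws come from a Burke type induction along the word of T eta. For the Markov chains
    the site of eta is read off from the site of T eta and the positivity of the load, and the tails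
    are geometric with ratio p_1 / (1 - p_0). For the conditioned configuration the carrier of T eta
    is no function of a finite word, except when the word reaches K consecutive vacancies, which
    empty every carrier bounded by K; the induction starts from such blocks. Given the value u of
    that carrier, the load v has weight c^v h(v) on v <= K - u, with c = p / (1 - p). The
    normalisation rests on partial sums of these weights, which solve the recursion of h read
    backwards. *)

Section Carrier.
Implicit Types (x y : int -> bool) (n m : int) (L v : nat).

(* The load at [n] of a carrier which is empty [L] sites further left. *)
Fixpoint window_load (L : nat) (n : int) (x : int -> bool) : nat :=
  if L is L'.+1 then
    let w := window_load L' (n - 1) x in if x n then w.+1 else w.-1
  else 0.

Definition load_ge (n : int) (v : nat) (x : int -> bool) : Prop :=
  exists L, (v <= window_load L n x)%N.

Definition finite_carrier (n : int) (x : int -> bool) : Prop :=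
  exists v, ~ load_ge n v x.

(* [0] when the loads of the finite carriers are unbounded. *)
Definition carrier (n : int) (x : int -> bool) : nat :=
  xget 0 [set v | load_ge n v x /\ ~ load_ge n v.+1 x].

(** The load enters through [load_ge] and not through [carrier], whose default value 0 would make an
    infinite load look empty. The inverse rule [bbs_coord] then holds for every configuration, with
    no exceptional event. *)
Definition bbs (x : config) : config :=
  fun n => ~~ x n && `[< load_ge (n - 1) 1 x >].

Lemma window_loadS L n x : (window_load L n x <= window_load L.+1 n x)%N.
Proof.
elim: L n => [//|L IH] n.
rewrite [window_load L.+1 n x]/= [window_load L.+2 n x]/= -/(window_load L.+1 (n - 1) x).
by move: (IH (n - 1)); case: (x n) => /=; lia.
Qed.

Lemma window_load_mono L L' n x : (L <= L')%N -> (window_load L n x <= window_load L' n x)%N.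
Proof.
move=> /subnK <-; elim: (L' - L)%N => [//|k IH].
by apply: leq_trans IH _; exact: window_loadS.
Qed.

Lemma load_ge0 n x : load_ge n 0 x.
Proof. by exists 0. Qed.

Lemma load_geW n v v' x : (v <= v')%N -> load_ge n v' x -> load_ge n v x.
Proof. by move=> vv' [L h]; exists L; exact: leq_trans h. Qed.

Lemma load_ge_up n v x : x n -> load_ge n v.+1 x <-> load_ge (n - 1) v x.
Proof.
move=> xn; split=> -[L].
  by case: L => [//|L] /=; rewrite xn => h; exists L.
by move=> h; exists L.+1; rewrite /= xn.
Qed.

Lemma load_ge_down n v x : ~~ x n -> load_ge n v.+1 x <-> load_ge (n - 1) v.+2 x.
Proof.
move=> /negbTE xn; split=> -[L].
  by case: L => [//|L] /=; rewrite xn => h; exists L; lia.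
by move=> h; exists L.+1; rewrite /= xn; lia.
Qed.

Lemma finite_carrierB1 n x : finite_carrier n x <-> finite_carrier (n - 1) x.
Proof.
have [xn|xn] := boolP (x n); split=> -[[|v] h].
- by case: h; exact: load_ge0.
- by exists v; rewrite -(load_ge_up _ xn).
- by case: h; exact: load_ge0.
- by exists v.+2; rewrite load_ge_up.
- by case: h; exact: load_ge0.
- by exists v.+2; rewrite -load_ge_down.
- by case: h; exact: load_ge0.
- exists v.+1; rewrite load_ge_down// => h'; apply: h; exact: load_geW h'.
Qed.

Lemma finite_carrierE n m x : finite_carrier n x <-> finite_carrier m x.
Proof.
suff H k : finite_carrier k x <-> finite_carrier 0 x by rewrite !H.
elim/int_ind: k => [//|k IH|k IH].
  by rewrite finite_carrierB1 (_ : k.+1%:Z - 1 = k)//; lia.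
by rewrite -IH (finite_carrierB1 (- k%:Z)) (_ : - k.+1%:Z = - k%:Z - 1)//; lia.
Qed.

Lemma carrierP n x v : finite_carrier n x -> load_ge n v x <-> (v <= carrier n x)%N.
Proof.
move=> [B hB].
have [v0 h0] : exists v0, load_ge n v0 x /\ ~ load_ge n v0.+1 x.
  elim: B hB => [|B IH] hB; first by case: hB; exact: load_ge0.
  by have [h|h] := pselect (load_ge n B x); [exists B|exact: IH].
have := @xgetPex _ 0%N [set v | load_ge n v x /\ ~ load_ge n v.+1 x] (ex_intro _ v0 h0).
rewrite -/(carrier n x) /= => -[h1 h2]; split=> [h|/load_geW]; last exact.
by rewrite leqNgt; apply/negP => hlt; apply: h2; exact: load_geW h.
Qed.

Lemma carrier_unique n x w :
  (forall v, load_ge n v x <-> (v <= w)%N) -> carrier n x = w.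
Proof.
move=> h; have f : finite_carrier n x by exists w.+1; rewrite h ltnn.
apply/eqP; rewrite eqn_leq; apply/andP; split.
  by apply/h/(carrierP _ f).
by apply/(carrierP _ f)/h.
Qed.

Lemma carrierE n x : finite_carrier n x ->
  carrier n x = if x n then (carrier (n - 1) x).+1 else (carrier (n - 1) x).-1.
Proof.
move=> f; have f1 := (finite_carrierB1 n x).1 f.
apply: carrier_unique => -[|v]; first by split=> // _; exact: load_ge0.
have [xn|xn] := boolP (x n); first by rewrite load_ge_up// carrierP.
by rewrite load_ge_down// carrierP//; lia.
Qed.

Lemma bbsE n x : finite_carrier n x -> bbs x n = ~~ x n && (0 < carrier (n - 1) x)%N.
Proof.
move=> f; have f1 := (finite_carrierB1 n x).1 f.
by rewrite /bbs; congr (_ && _); apply/asboolP/idP; rewrite carrierP.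
Qed.

(** The local rule is symmetric: [bbsE] and [carrierE] turn into this lemma and the next one when
    [x] and [bbs x], and also [n - 1] and [n], exchange their roles. *)
Lemma bbs_inv n x : finite_carrier n x -> x n = ~~ bbs x n && (0 < carrier n x)%N.
Proof.
by move=> f; rewrite bbsE// (carrierE f); case: (x n) => //=; case: (carrier _ _).
Qed.

Lemma carrier_inv n x : finite_carrier n x ->
  carrier (n - 1) x = if bbs x n then (carrier n x).+1 else (carrier n x).-1.
Proof.
by move=> f; rewrite bbsE// (carrierE f); case: (x n) => //=; case: (carrier _ _).
Qed.

(* Words are read leftwards from [n]: the head is the rightmost site. *)
Fixpoint word (L : nat) (n : int) (x : int -> bool) : seq bool :=
  if L is L'.+1 then x n :: word L' (n - 1) x else [::].

Lemma size_word L n x : size (word L n x) = L.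
Proof. by elim: L n => //= L IH n; rewrite IH. Qed.

Lemma nth_word L n x i : (i < L)%N -> nth false (word L n x) i = x (n - i%:Z).
Proof.
elim: L n i => //= L IH n [|i] hi /=; first by rewrite subr0.
by rewrite IH//; congr x; lia.
Qed.

Definition past_eq n (x y : int -> bool) := forall m, m <= n -> x m = y m.

Lemma past_eqS n x y : past_eq n x y -> past_eq (n - 1) x y.
Proof. by move=> h m hm; apply: h; lia. Qed.

Lemma past_eqW n m x y : m <= n -> past_eq n x y -> past_eq m x y.
Proof. by move=> mn h k hk; apply: h; lia. Qed.

Lemma past_eq_window_load L n x y : past_eq n x y -> window_load L n x = window_load L n y.
Proof.
elim: L n => //= L IH n h.
by rewrite h// (IH (n - 1))//; exact: past_eqS.
Qed.

Lemma past_eq_word L n x y : past_eq n x y -> word L n x = word L n y.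
Proof.
elim: L n => //= L IH n h.
by rewrite h// (IH (n - 1))//; exact: past_eqS.
Qed.

Lemma past_eq_load_ge v n x y : past_eq n x y -> load_ge n v x = load_ge n v y.
Proof.
move=> h; rewrite /load_ge; apply/propext; split=> -[L hL]; exists L.
  by rewrite -(past_eq_window_load L h).
by rewrite (past_eq_window_load L h).
Qed.

Lemma past_eq_carrier n x y : past_eq n x y -> carrier n x = carrier n y.
Proof.
move=> h; rewrite /carrier; congr (xget _ _); apply/funext => v /=.
by rewrite !(past_eq_load_ge _ h).
Qed.

Lemma past_eq_bbs n x y : past_eq n x y -> past_eq n (bbs x) (bbs y).
Proof.
move=> h m hm; rewrite /bbs h//; congr (_ && _); congr asbool.
by apply: past_eq_load_ge; apply: past_eqW h; lia.
Qed.

(* The inverse dynamics on a window, [v] being the load at its right end. *)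
Fixpoint unbbs (v : nat) (s : seq bool) : seq bool :=
  if s is b :: s' then
    if b then false :: unbbs v.+1 s' else (0 < v)%N :: unbbs v.-1 s'
  else [::].

Lemma unbbsP L n x : finite_carrier n x ->
  word L n x = unbbs (carrier n x) (word L n (bbs x)).
Proof.
elim: L n => //= L IH n f.
have f1 := (finite_carrierB1 n x).1 f.
rewrite (IH _ f1) (carrier_inv f) (bbs_inv f).
by case: (bbs x n).
Qed.

Lemma size_unbbs v s : size (unbbs v s) = size s.
Proof. by elim: s v => //= -[] s IH v /=; rewrite IH. Qed.

(* A window of length [L] cannot absorb more than [L] particles. *)
Lemma unbbs_trunc v V s : (size s <= V)%N -> unbbs (minn v V) s = unbbs v s.
Proof.
elim: s v V => //= b s IH v V hV; case: b.
  by rewrite -(IH v.+1 V.+1) ?minnSS//; lia.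
have -> : (0 < minn v V)%N = (0 < v)%N by lia.
by rewrite -(IH v.-1 V.-1); [congr (_ :: unbbs _ _); lia|lia].
Qed.

Lemma unbbs0_nseq j b s : exists s',
  unbbs 0 (nseq j false ++ b :: s) = nseq j.+1 false ++ s'.
Proof.
elim: j => [|j [s' IH]] /=; last by exists s'; rewrite IH.
by case: b; eexists.
Qed.

Lemma iter_unbbs0 s : iter (size s) (unbbs 0) s = nseq (size s) false.
Proof.
suff H j : (j <= size s)%N ->
    exists s', iter j (unbbs 0) s = nseq j false ++ s' /\ size s' = (size s - j)%N.
  have [s' [-> /size0nil ->]] : exists s',
    iter (size s) (unbbs 0) s = nseq (size s) false ++ s' /\ size s' = 0%N.
    by have := H _ (leqnn _); rewrite subnn.
  by rewrite cats0.
elim: j => [_|j IH hj]; first by exists s; rewrite subn0.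
have [[|b s'] [E sz]] := IH (ltnW hj); first by move: sz => /=; lia.
have [s'' E'] := unbbs0_nseq j b s'.
exists s''; rewrite iterS E E'; split=> //.
have := congr1 size E'; rewrite size_unbbs !size_cat !size_nseq /=.
by move: sz => /=; lia.
Qed.

End Carrier.

(** * Pitman's transformation in terms of the carrier *)

Section PitmanCarrier.
Variable R : realType.
Implicit Types (x : config) (n : int) (L : nat).

(** [window_load L n x] is the maximum of S_(n-j) - S_n over 0 <= j <= L, a finite version of W = M
    - S; [window_load_attained] gives the maximiser. The truncation of the load at 0 is the term j =
    0. *)
Lemma window_load_ge L n x j : (j <= L)%N ->
  path_encoding x (n - j%:Z) - path_encoding x n <= (window_load L n x)%:Z.
Proof.
elim: L n j => [|L IH] n [|j] //; rewrite ?subr0 ?subrr//.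
move=> jL; have := IH (n - 1) j jL; have := path_encoding_step x n.
rewrite (_ : n - 1 - j%:Z = n - j.+1%:Z) /=; last lia.
by case: (x n) => /=; lia.
Qed.

Lemma window_load_attained L n x : exists j, (j <= L)%N /\
  (window_load L n x)%:Z = path_encoding x (n - j%:Z) - path_encoding x n.
Proof.
elim: L n => [|L IH] n; first by exists 0; rewrite subr0 subrr.
have [j [jL E]] := IH (n - 1); have := path_encoding_step x n.
rewrite /=; case: (x n) => /= st.
  exists j.+1; split=> //.
  by rewrite (_ : n - j.+1%:Z = n - 1 - j%:Z); lia.
case W : (window_load L (n - 1) x) E => [|w] E.
  by exists 0; rewrite subr0 subrr.
exists j.+1; split=> //.
by rewrite (_ : n - j.+1%:Z = n - 1 - j%:Z) /=; lia.
Qed.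

Lemma past_has_ubound n x :
  has_ubound (past x n : set R) <-> finite_carrier n x.
Proof.
split=> [[B hB]|[v hv]].
  pose b := Num.bound `|B - (path_encoding x n)%:~R|.
  exists b => -[L].
  have [j [jL E]] := window_load_attained L n x; rewrite -lez_nat E => h.
  have : (path_encoding x (n - j%:Z))%:~R <= B.
    by apply: hB; exists (n - j%:Z) => //=; lia.
  have : b%:Z%:~R <= (path_encoding x (n - j%:Z) - path_encoding x n)%:~R :> R.
    by rewrite ler_int.
  have : B - (path_encoding x n)%:~R < b%:R.
    exact: le_lt_trans (ler_norm _) (archi_boundP (normr_ge0 _)).
  by rewrite rmorphB /= -pmulrn; lra.
exists (path_encoding x n + v%:Z)%:~R => _ [m /= mn <-].
rewrite ler_int leNgt; apply/negP => h; apply: hv.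
exists `|n - m|%N; rewrite -lez_nat.
have := @window_load_ge `|n - m|%N n x _ (leqnn _).
by rewrite (_ : n - `|n - m|%N%:Z = m); lia.
Qed.

Lemma pitman_definedE x : pitman_defined R x <-> finite_carrier 0 x.
Proof. exact: past_has_ubound. Qed.

Lemma past_maxE n x : finite_carrier n x ->
  past_max R x n = (path_encoding x n + (carrier n x)%:Z)%:~R.
Proof.
move=> f; have ub := (past_has_ubound n x).2 f.
apply/eqP; rewrite eq_le; apply/andP; split.
  apply: ge_sup; first by exists (path_encoding x n)%:~R, n => /=.
  move=> _ [m /= mn <-]; rewrite ler_int.
  have := @window_load_ge `|n - m|%N n x _ (leqnn _).
  rewrite (_ : n - `|n - m|%N%:Z = m); last lia.
  have : (window_load `|n - m|%N n x <= carrier n x)%N.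
    by apply/(carrierP _ f); exists `|n - m|%N.
  by lia.
have [L hL] := (carrierP _ f).2 (leqnn (carrier n x)).
have [j [jL E]] := window_load_attained L n x.
apply: (@le_trans _ _ (path_encoding x (n - j%:Z))%:~R).
  by rewrite ler_int; lia.
by apply: ub_le_sup => //; exists (n - j%:Z) => //=; lia.
Qed.

(** Without a finite carrier [sup] takes its default value 0, so the path becomes -S and every site
    is flipped. This branch enters the measurability of [pitman], which concerns all
    configurations. *)
Lemma pitmanE x n :
  pitman R x n = if `[< finite_carrier 0 x >] then bbs x n else ~~ x n.
Proof.
rewrite /pitman /pitman_path.
have := path_encoding_step x n.
case: asboolP => f st; last first.
  have z m : past_max R x m = 0.
    apply: sup_out => -[_ /past_has_ubound]; by rewrite (finite_carrierE m 0).
  rewrite !z mulr0 !sub0r !subr0.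
  have -> : - (path_encoding x n)%:~R - - (path_encoding x (n - 1))%:~R
      = (2 * (x n)%:Z - 1)%:~R :> R.
    by rewrite -rmorphN -rmorphN -rmorphB /=; congr _%:~R; lia.
  rewrite (_ : -1 = (-1)%:~R :> R) ?eqr_int; last by rewrite mulrN1z.
  by case: (x n).
have fn := (finite_carrierE n 0 x).2 f.
have fn1 := (finite_carrierE (n - 1) 0 x).2 f.
rewrite !past_maxE// bbsE// (carrierE fn).
set A := path_encoding x n; set B := path_encoding x (n - 1).
set M := 2 * (path_encoding x 0 + _)%:~R.
set w := carrier (n - 1) x; set w' := if x n then _ else _.
have -> : 2 * (A + w')%:~R - A%:~R - M - (2 * (B + w)%:~R - B%:~R - M)
   = (2 * (A + w') - A - (2 * (B + w) - B))%:~R :> R.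
  by rewrite !(rmorphB, rmorphM, rmorphD) /=; ring.
rewrite (_ : -1 = (-1)%:~R :> R) ?eqr_int; last by rewrite mulrN1z.
rewrite {}/w'; move: st; rewrite -/A -/B.
by case: (x n) => /=; case: w => [|w] /=; lia.
Qed.

End PitmanCarrier.

(** * Measurability of loads and of the dynamics *)

Section Measurability.
Implicit Types (n : int) (L v : nat).

Lemma measurable_coord n : measurable [set x : config | x n].
Proof.
apply: sub_sigma_algebra; exists n => //; exists [set true] => //.
by rewrite setTI; apply/seteqP; split => x /=; case: (x n).
Qed.

Lemma measurable_word1 L n s : measurable [set x : config | word L n x = s].
Proof.
elim: L n s => [|L IH] n [|b s] /=.
- by rewrite (_ : mkset _ = setT)//; apply/seteqP; split.
- by rewrite (_ : mkset _ = set0)//; apply/seteqP; split.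
- by rewrite (_ : mkset _ = set0)//; apply/seteqP; split.
rewrite (_ : mkset _ = (if b then [set x : config | x n] else ~` [set x : config | x n])
    `&` [set x : config | word L (n - 1) x = s]).
  apply: measurableI => //.
  by case: b; [|apply: measurableC]; exact: measurable_coord.
apply/seteqP; split=> x /=.
  by case=> <- <-; split=> //; case E : (x n) => //=; rewrite E.
by case: b => -[/= h ->]; congr (_ :: _); [|apply/negbTE/negP].
Qed.

Lemma measurable_word L n (E : set (seq bool)) :
  measurable [set x : config | E (word L n x)].
Proof.
rewrite (_ : mkset _ =
    \bigcup_s [set x : config | word L n x = s /\ E s]).
  apply: countable_bigcupT_measurable => [|s]; first exact: countableP.
  have [Es|Es] := pselect (E s).
    rewrite (_ : mkset _ = [set x : config | word L n x = s]).
      exact: measurable_word1.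
    by apply/seteqP; split=> x /= => [[]|].
  by rewrite (_ : mkset _ = set0)//; apply/seteqP; split=> x //= [].
apply/seteqP; split=> x /=; first by move=> h; exists (word L n x).
by case=> s _ [<-].
Qed.

Lemma window_load_word L n x : window_load L n x =
  foldr (fun b w => if b then w.+1 else w.-1) 0%N (word L n x).
Proof. by elim: L n => //= L IH n; rewrite IH. Qed.

Lemma measurable_load_ge n v : measurable [set x : config | load_ge n v x].
Proof.
rewrite (_ : mkset _ = \bigcup_L [set x : config | (v <= window_load L n x)%N]).
  apply: bigcup_measurable => L _.
  under eq_set do rewrite window_load_word.
  exact: (measurable_word L n [set s | (v <= foldr _ _ s)%N]).
by apply/seteqP; split=> x /=; [case=> L; exists L|case=> L _; exists L].
Qed.

Lemma measurable_finite_carrier n : measurable [set x : config | finite_carrier n x].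
Proof.
rewrite (_ : mkset _ = \bigcup_v ~` [set x : config | load_ge n v x]).
  by apply: bigcup_measurable => v _; apply: measurableC; exact: measurable_load_ge.
by apply/seteqP; split=> x /=; [case=> L; exists L|case=> L _; exists L].
Qed.

Lemma measurable_carrier n v : measurable [set x : config | carrier n x = v].
Proof.
have [v0|v0] := eqVneq v 0%N.
  (* The value 0 also collects the infinite carriers, by the default of [xget]. *)
  rewrite (_ : mkset _ = ~` [set x : config | finite_carrier n x] `|`
      ~` [set x : config | load_ge n 1 x]).
    by apply: measurableU; apply: measurableC;
      [exact: measurable_finite_carrier|exact: measurable_load_ge].
  apply/seteqP; split=> x /=; rewrite v0.
    move=> E; have [f|f] := pselect (finite_carrier n x); [right|by left].
    by rewrite (carrierP _ f) E.
  case=> [f|h].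
    apply/xgetPN => w /= [_ h]; apply: f; by exists w.+1.
  have f : finite_carrier n x by exists 1%N.
  by apply/eqP; rewrite -leqn0 leqNgt; apply/negP => /(carrierP _ f).
rewrite (_ : mkset _ = [set x : config | load_ge n v x] `\` [set x : config | load_ge n v.+1 x]).
  by apply: measurableD; exact: measurable_load_ge.
apply/seteqP; split=> x /=.
  move=> E; have f : finite_carrier n x.
    apply: contrapT => f; move/eqP: v0; apply; rewrite -E.
    apply/xgetPN => w /= [_ h]; apply: f; by exists w.+1.
  by rewrite !(carrierP _ f) E ltnn.
move=> [h1 h2]; have f : finite_carrier n x by exists v.+1.
by move: h1 h2; rewrite !(carrierP _ f) => ? /negP; lia.
Qed.

Lemma measurable_to_config d (T : measurableType d) (f : T -> config) :
  (forall n, measurable [set w | f w n]) -> measurable_fun setT f.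
Proof.
move=> h; apply: (@measurability _ _ T config setT f _ erefl).
move=> _ [_ [n _ [B _ <-]] <-]; rewrite !setTI.
rewrite (_ : _ @^-1` _ = ([set w | f w n] `&` [set w | B true])
    `|` (~` [set w | f w n] `&` [set w | B false])).
  have mc (P : Prop) : measurable [set _ : T | P].
    have [p|p] := pselect P.
      by rewrite (_ : mkset _ = setT)//; apply/seteqP; split.
    by rewrite (_ : mkset _ = set0)//; apply/seteqP; split.
  by apply: measurableU; apply: measurableI => //; apply: measurableC.
apply/seteqP; split=> w /=; case: (f w n) => //.
- by left.
- by right.
- by case=> -[].
- by case=> -[].
Qed.

Lemma measurable_bbs : measurable_fun setT (bbs : config -> config).
Proof.
apply: measurable_to_config => n.
rewrite (_ : mkset _ = ~` [set x : config | x n] `&` [set x : config | load_ge (n - 1) 1 x]).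
  apply: measurableI; last exact: measurable_load_ge.
  by apply: measurableC; exact: measurable_coord.
apply/seteqP; split=> x /=.
  by case/andP => /negP ? /asboolP.
by case=> /negP h1 h2; apply/andP; split=> //; apply/asboolP.
Qed.

Lemma measurable_pitman (R : realType) :
  measurable_fun setT (pitman R : config -> config).
Proof.
apply: measurable_to_config => n.
rewrite (_ : mkset _ = ([set x : config | finite_carrier 0 x]
      `&` (bbs : config -> config) @^-1` [set x : config | x n])
    `|` (~` [set x : config | finite_carrier 0 x] `&` ~` [set x : config | x n])).
  apply: measurableU; apply: measurableI.
  - exact: measurable_finite_carrier.
  - rewrite -[X in measurable X]setTI; apply: measurable_bbs => //.
    exact: measurable_coord.
  - by apply: measurableC; exact: measurable_finite_carrier.
  - by apply: measurableC; exact: measurable_coord.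
apply/seteqP; split=> x /=; rewrite pitmanE; case: asboolP => f.
- by left.
- by move/negP; right.
- by case=> -[].
- by case=> -[//] _ /negP.
Qed.

End Measurability.

(** * Events depending on the past *)

Definition past_set (n : int) (C : set config) : Prop :=
  measurable C /\ forall x y, past_eq n x y -> C x -> C y.

Section PastSets.
Implicit Types (n m : int) (C D : set config).

Lemma past_setT n : past_set n setT.
Proof. by split. Qed.

Lemma past_setI n C D : past_set n C -> past_set n D -> past_set n (C `&` D).
Proof.
move=> [mC hC] [mD hD]; split; first exact: measurableI.
by move=> x y e [Cx Dx]; split; [exact: hC Cx|exact: hD Dx].
Qed.

Lemma past_setW n m C : m <= n -> past_set m C -> past_set n C.
Proof.
move=> mn [mC hC]; split=> // x y e; apply: hC; exact: past_eqW e.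
Qed.

Lemma past_setC n C : past_set n C -> past_set n (~` C).
Proof.
move=> [mC hC]; split; first exact: measurableC.
by move=> x y e nC Cy; apply/nC/(hC y x) => // k hk; rewrite e.
Qed.

Lemma past_set_word L n (E : set (seq bool)) :
  past_set n [set x : config | E (word L n x)].
Proof.
split; first exact: measurable_word.
by move=> x y e /=; rewrite (past_eq_word _ e).
Qed.

Lemma past_set_word1 L n s : past_set n [set x : config | word L n x = s].
Proof. exact: (past_set_word L n (fun t => t = s)). Qed.

Lemma past_set_load_ge n v : past_set n [set x : config | load_ge n v x].
Proof.
split; first exact: measurable_load_ge.
by move=> x y e /=; rewrite (past_eq_load_ge _ e).
Qed.

Lemma past_set_carrier n v : past_set n [set x : config | carrier n x = v].
Proof.
split; first exact: measurable_carrier.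
by move=> x y e /=; rewrite (past_eq_carrier e).
Qed.

Lemma past_set_coord n : past_set n [set x : config | x n].
Proof.
split; first exact: measurable_coord.
by move=> x y e /=; rewrite e.
Qed.

Lemma past_set_coordE n b : past_set n [set x : config | x n = b].
Proof.
case: b; first exact: past_set_coord.
rewrite (_ : mkset _ = ~` [set x : config | x n]).
  by apply: past_setC; exact: past_set_coord.
by apply/seteqP; split=> x /=; case: (x n).
Qed.

Lemma measurable_bbs_preimage C : measurable C -> measurable (bbs @^-1` C).
Proof.
move=> mC; rewrite -[X in measurable X]setTI; exact: measurable_bbs.
Qed.

Lemma past_set_bbs n C : past_set n C -> past_set n (bbs @^-1` C).
Proof.
move=> [mC hC]; split; first exact: measurable_bbs_preimage.
by move=> x y e; apply: hC; exact: past_eq_bbs.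
Qed.

End PastSets.

(** The exceptional event when laws are compared on the words satisfying [good] only. It asks for
    failure at all large [L], because the coordinate [m] is visible only in a good word longer than
    [n - m]: on the complement every coordinate up to [n] can be read. *)
Definition never_good (good : seq bool -> Prop) (n : int) : set config :=
  [set x : config | exists L0, forall L, (L0 <= L)%N -> ~ good (word L n x)].

Lemma never_good_true n : never_good (fun=> True) n = set0.
Proof. by apply/seteqP; split=> // x [L /(_ L (leqnn _))] /(_ I). Qed.

Lemma never_good_nil n : never_good (fun s => s <> [::]) n = set0.
Proof. by apply/seteqP; split=> // x [L /(_ L.+1 (leqnSn _))] /=; apply. Qed.

(** * Laws determined by words of the past *)

Section Uniqueness.
Variable R : realType.

Lemma take_word L L' n x : (L <= L')%N -> take L (word L' n x) = word L n x.
Proof.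
by elim: L L' n => [|L IH] [|L'] n //= h; rewrite IH.
Qed.

Lemma measurable_never_good good n : measurable (never_good good n).
Proof.
rewrite (_ : never_good good n =
   \bigcup_L0 \bigcap_L [set x : config | (L0 <= L)%N -> ~ good (word L n x)]).
  apply: bigcup_measurable => L0 _; apply: bigcapT_measurable => L.
  exact: (measurable_word L n [set s | (L0 <= L)%N -> ~ good s]).
apply/seteqP; split=> x /=; first by case=> L0 h; exists L0 => // L _; exact: h.
by case=> L0 _ h; exists L0 => L; exact: h.
Qed.

(* The events fixing a word which satisfies [good] form a pi-system together
   with the measurable subsets of the null event [never_good good n]. *)
Lemma past_measure_unique good n (m1 m2 : {measure set config -> \bar R}) :
  (forall s, good s -> m1 [set x : config | word (size s) n x = s]
                     = m2 [set x : config | word (size s) n x = s]) ->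
  (m1 setT < +oo)%E ->
  m1 (never_good good n) = 0%E -> m2 (never_good good n) = 0%E ->
  forall C, past_set n C -> m1 C = m2 C.
Proof.
move=> m12 m1oo m1N m2N C [mC hC].
have mN := measurable_never_good good n.
pose G : set (set config) := [set A : set config | (exists2 s, good s & A = [set x : config | word (size s) n x = s])
  \/ (measurable A /\ A `<=` never_good good n)].
have Gm : G `<=` measurable.
  move=> A [[s _ ->]|[]//]; exact: measurable_word1.
have G0 : G set0 by right; split; [exact: measurable0|exact: sub0set].
(* A countable cover by sets of [G], as uniqueness of measures demands: index 0 is the exceptional
   event, the other indices decode words. *)
pose g (k : nat) : set config := if k is k'.+1 then
  (if (unpickle k' : option (seq bool)) is Some s then
    [set x : config | good s /\ word (size s) n x = s] else set0)
  else never_good good n.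
have Gg k : G (g k).
  case: k => [|k]; rewrite /g; first by right; split.
  case: (unpickle k : option (seq bool)) => [s|]; last exact: G0.
  have [gs|gs] := pselect (good s).
    left; exists s => //; apply/seteqP; split=> x /=; by [case|].
  by rewrite (_ : mkset _ = set0)//; apply/seteqP; split=> x //= [].
have gcover : \bigcup_k g k = setT.
  apply/seteqP; split=> // x _.
  have [h|h] := pselect (never_good good n x); first by exists 0%N.
  have [L gL] : exists L, good (word L n x).
    apply: contrapT => nL; apply: h; exists 0%N => L _ gL; apply: nL; by exists L.
  exists (pickle (word L n x)).+1 => //; rewrite /g pickleK /= size_word.
  by [].
have GI : setI_closed G.
  move=> A B [[s gs ->]|[mA hA]]; last first.
    move=> GB; right; split; first by apply: measurableI => //; exact: Gm.
    by move=> x [/hA].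
  case=> [[t gt ->]|[mB hB]]; last first.
    right; split; last by move=> x [_ /hB].
    by apply: measurableI => //; exact: measurable_word1.
  (* Both words start at [n]: either the shorter is a prefix of the longer and the events are
     nested, or they are disjoint. *)
  wlog st : s t gs gt / (size s <= size t)%N.
    move=> H; have [|/ltnW] := leqP (size s) (size t); first exact: H.
    by rewrite setIC; exact: H.
  have [E|E] := eqVneq (take (size s) t) s.
    left; exists t => //; apply/seteqP; split=> x /=; first by case.
    move=> h; split=> //; by rewrite -(take_word _ _ st) h.
  rewrite (_ : _ `&` _ = set0)//; apply/seteqP; split=> x //= -[h1 h2].
  by move/eqP: E; apply; rewrite -h2 take_word.
have mG : <<s G >> `<=` measurable.
  by apply: smallest_sub => //; exact: sigma_algebra_measurable.
have := @g_sigma_algebra_measure_unique _ R config G Gm g Gg gcover m1 m2 GI.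
apply.
- move=> A [[s gs ->]|[mA hA]]; first exact: m12.
  by rewrite (subset_measure0 mA mN hA m1N) (subset_measure0 mA mN hA m2N).
- move=> k; apply: le_lt_trans m1oo; apply: le_measure => //; rewrite inE//.
  exact: Gm.
(* Erasing the coordinates beyond [n] does not change membership in [C]. So [C] belongs to the
   sigma-algebra of [G] as soon as [trunc] is measurable for it, that is, as soon as each coordinate
   up to [n] is. *)
pose trunc (x : config) : config := fun m => if m <= n then x m else false.
have CE : C = trunc @^-1` C.
  have e x : past_eq n x (trunc x) by move=> m mn; rewrite /trunc mn.
  apply/seteqP; split=> x /=; first exact: hC.
  by apply: hC => m mn; rewrite (e x).
have : measurable_fun setT (trunc : g_sigma_algebraType G -> config).
  apply: measurable_to_config => m; rewrite /trunc.
  have [mn|mn] := boolP (m <= n); last first.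
    by rewrite (_ : mkset _ = set0)//; apply/seteqP; split.
  pose k := `|n - m|%N.
  rewrite (_ : mkset _ = (\bigcup_(s : seq bool)
      [set x : g_sigma_algebraType G | [/\ good s, (k < size s)%N, nth false s k
         & word (size s) n x = s]])
      `|` ([set x : config | x m] `&` never_good good n)).
    apply: measurableU.
      apply: countable_bigcupT_measurable => [|s]; first exact: countableP.
      have [h|h] := pselect ([/\ good s, (k < size s)%N & nth false s k]); last first.
        rewrite (_ : mkset _ = set0)//.
        by apply/seteqP; split=> x //= -[h1 h2 h3 h4]; case: h.
      case: h => h1 h2 h3.
      rewrite (_ : mkset _ = [set x : config | word (size s) n x = s]).
        apply: sub_sigma_algebra; left; by exists s.
      by apply/seteqP; split=> x //= -[].
    apply: sub_sigma_algebra; right; split; last by move=> x [].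
    by apply: measurableI => //; exact: measurable_coord.
  apply/seteqP; split=> x /=.
    move=> xm; have [h|h] := pselect (never_good good n x); first by right.
    left; have [L kL gL] : exists2 L, (k < L)%N & good (word L n x).
      apply: contrapT => nL; apply: h; exists k.+1 => L hL gL.
      by apply: nL; exists L.
    exists (word L n x) => //; rewrite size_word; split=> //.
    by rewrite nth_word// (_ : n - k%:Z = m)// /k; lia.
  case=> [[s _ [_ ks + E]]|[]//].
  by rewrite -E nth_word// (_ : n - k%:Z = m)// /k; lia.
by move=> /(_ measurableT _ mC); rewrite setTI -CE.
Qed.

Section TraceMeasure.
Context d (T : measurableType d) (P : {measure set T -> \bar R}).
Context (g : T -> config) (mg : measurable_fun setT g) (A : set T).
Hypothesis mA : measurable A.

Definition trace_measure (C : set config) :=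
  let _ := (mg, mA) in P (g @^-1` C `&` A).

Let mgC C : measurable C -> measurable (g @^-1` C).
Proof. by move=> mC; rewrite -[X in measurable X]setTI; exact: mg. Qed.

Let tr0 : trace_measure set0 = 0%E.
Proof. by rewrite /trace_measure preimage_set0 set0I measure0. Qed.

Let tr_ge0 C : (0 <= trace_measure C)%E.
Proof. exact: measure_ge0. Qed.

Let tr_additive : semi_sigma_additive trace_measure.
Proof.
move=> F mF tF mUF; rewrite /trace_measure preimage_bigcup setI_bigcupl.
have mFA i : measurable (g @^-1` F i `&` A) by apply: measurableI => //; exact: mgC.
apply: measure_semi_sigma_additive => //; last exact: bigcupT_measurable.
apply/trivIsetP => i j _ _ ij; rewrite setIACA -preimage_setI.
by move/trivIsetP : tF => /(_ i j I I ij) ->; rewrite preimage_set0 set0I.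
Qed.

HB.instance Definition _ := isMeasure.Build _ _ _ trace_measure
  tr0 tr_ge0 tr_additive.

End TraceMeasure.

End Uniqueness.

(** * Real-valued probabilities and null events *)

Definition pr d (T : measurableType d) (R : realType) (P : probability T R)
  (A : set T) : R := fine (P A).

Section Pr.
Context d (T : measurableType d) (R : realType) (P : probability T R).
Implicit Types A B : set T.

Lemma prE A : measurable A -> P A = (pr P A)%:E.
Proof. by move=> mA; rewrite fineK//; exact: fin_num_measure. Qed.

Lemma pr_ge0 A : 0 <= pr P A.
Proof. by apply: fine_ge0; exact: measure_ge0. Qed.

Lemma prT : pr P setT = 1.
Proof. by rewrite /pr probability_setT. Qed.

Lemma pr0 : pr P set0 = 0.
Proof. by rewrite /pr measure0. Qed.

Lemma prC A : measurable A -> pr P (~` A) = 1 - pr P A.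
Proof.
move=> mA; rewrite /pr probability_setC// prE//.
Qed.

Lemma le_pr A B : measurable A -> measurable B -> A `<=` B -> pr P A <= pr P B.
Proof.
move=> mA mB AB; rewrite -lee_fin -!prE//.
by apply: le_measure => //; rewrite inE.
Qed.

Lemma pr_le1 A : measurable A -> pr P A <= 1.
Proof. by move=> mA; rewrite -prT; apply: le_pr. Qed.

Lemma prU A B : measurable A -> measurable B -> A `&` B = set0 ->
  pr P (A `|` B) = pr P A + pr P B.
Proof.
move=> mA mB AB; rewrite /pr measureU// fineD//; exact: fin_num_measure.
Qed.

Lemma pr_split A B : measurable A -> measurable B ->
  pr P A = pr P (A `&` B) + pr P (A `&` ~` B).
Proof.
move=> mA mB; have mC := measurableC mB.
rewrite -prU; [|exact: measurableI|exact: measurableI|].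
  by rewrite -setIUr setUv setIT.
by rewrite setIACA setICr setI0.
Qed.

Lemma pr_sum (I : finType) (F : I -> set T) :
  (forall i, measurable (F i)) -> (forall i j, i != j -> F i `&` F j = set0) ->
  pr P (\bigcup_i F i) = \sum_i pr P (F i).
Proof.
move=> mF tF.
have -> : \bigcup_i F i = \big[setU/set0]_(i : I) F i.
  rewrite -bigcup_seq; apply: eq_bigcupl; split=> i //= _.
  by rewrite mem_index_enum.
rewrite -(big_enum _ _ predT) -[RHS](big_enum _ _ predT) /=.
elim: (enum I) (enum_uniq I) => [|i s IH] /=; first by rewrite !big_nil pr0.
move=> /andP[si us]; rewrite !big_cons prU ?IH//.
  by apply: bigsetU_measurable.
rewrite -bigcup_seq; apply/seteqP; split=> w //= -[Fi [j /= js Fj]].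
have ij : i != j by apply: contraNneq si => ->.
have : (F i `&` F j) w by [].
by rewrite tF.
Qed.

Lemma pr_null A B : measurable A -> measurable B -> pr P B = 0 -> A `<=` B ->
  pr P A = 0.
Proof.
by move=> mA mB B0 AB; apply/eqP; rewrite eq_le pr_ge0 -B0 le_pr.
Qed.

Lemma pr_nullU A B : measurable A -> measurable B -> pr P A = 0 -> pr P B = 0 ->
  pr P (A `|` B) = 0.
Proof.
move=> mA mB A0 B0; have mAB := measurableU _ _ mA mB.
rewrite (pr_split mAB mA) [X in X + _](pr_null _ mA A0) ?add0r.
- apply: (pr_null _ mB B0) => [|x [[|//] ?]//].
  by apply: measurableI => //; exact: measurableC.
- exact: measurableI.
- by move=> x [].
Qed.

Lemma pr_ae_eq A B N : measurable A -> measurable B -> measurable N ->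
  pr P N = 0 -> (forall w, ~ N w -> A w <-> B w) -> pr P A = pr P B.
Proof.
move=> mA mB mN N0 h.
rewrite (pr_split mA mN) (pr_split mB mN).
have -> : A `&` ~` N = B `&` ~` N.
  by apply/seteqP; split=> w /= [Aw Nw]; split=> //; apply/h.
congr (_ + _); transitivity (0 : R).
  by apply: (@pr_null _ N) => //; exact: measurableI.
by apply/esym/(@pr_null _ N) => //; exact: measurableI.
Qed.

Lemma pr_cvg (F : (set T)^nat) : (forall i, measurable (F i)) ->
  nondecreasing_seq F -> pr P (F n) @[n --> \oo] --> pr P (\bigcup_n F n).
Proof.
move=> mF ndF.
have mU : measurable (\bigcup_n F n) by exact: bigcupT_measurable.
have h := @nondecreasing_cvg_mu _ T R P F mF mU ndF.
apply: fine_cvg; rewrite /pr fineK; last exact: fin_num_measure.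
exact: h.
Qed.

End Pr.

(** The form in which conditional laws are handled: proportionality to the factor [c] for all past
    events replaces a conditional probability and avoids division. Both sides are finite measures in
    [C], so good words decide. *)
Lemma past_pr_unique (R : realType) d1 (T1 : measurableType d1)
    d2 (T2 : measurableType d2) (P1 : probability T1 R) (P2 : probability T2 R)
    (g1 : T1 -> config) (g2 : T2 -> config) (A : set T1) (B : set T2) (c : R)
    (good : seq bool -> Prop) (n : int) :
  measurable_fun setT g1 -> measurable_fun setT g2 ->
  measurable A -> measurable B -> 0 <= c ->
  (forall s, good s ->
    pr P1 (g1 @^-1` [set x : config | word (size s) n x = s] `&` A)
    = c * pr P2 (g2 @^-1` [set x : config | word (size s) n x = s] `&` B)) ->
  pr P1 (g1 @^-1` never_good good n `&` A) = 0 ->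
  pr P2 (g2 @^-1` never_good good n `&` B) = 0 ->
  forall C, past_set n C ->
    pr P1 (g1 @^-1` C `&` A) = c * pr P2 (g2 @^-1` C `&` B).
Proof.
move=> mg1 mg2 mA mB c0 h N1 N2 C pC.
have mG1 D : measurable D -> measurable (g1 @^-1` D `&` A).
  by move=> mD; apply: measurableI => //; rewrite -[X in measurable X]setTI; exact: mg1.
have mG2 D : measurable D -> measurable (g2 @^-1` D `&` B).
  by move=> mD; apply: measurableI => //; rewrite -[X in measurable X]setTI; exact: mg2.
pose m1 : {measure set config -> \bar R} := trace_measure P1 mg1 mA.
pose m2 : {measure set config -> \bar R} := mscale (NngNum c0) (trace_measure P2 mg2 mB).
have mN := measurable_never_good good n.
have E1 D : measurable D -> m1 D = (pr P1 (g1 @^-1` D `&` A))%:E.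
  by move=> mD; rewrite -prE//; exact: mG1.
have E2 D : measurable D -> m2 D = (c * pr P2 (g2 @^-1` D `&` B))%:E.
  by move=> mD; rewrite EFinM -prE//; exact: mG2.
have := @past_measure_unique R good n m1 m2.
rewrite !E1// !E2// N1 N2 mulr0 ltry => /(_ _ erefl erefl erefl) H.
have mC := pC.1.
suff : m1 C = m2 C by rewrite E1// E2// => -[].
apply: H => // s gs; rewrite E1 ?E2 ?h//; exact: measurable_word1.
Qed.

(** Past events with varying [n] form a generating pi-system, since two of them are past events for
    the larger index; Dynkin's theorem does the rest. *)
Lemma past_measurable_unique (D : set (set config)) :
  D setT ->
  (forall S, measurable S -> D S -> D (~` S)) ->
  (forall F : (set config)^nat, (forall n, measurable (F n)) ->
    trivIset [set: nat] F -> (forall n, D (F n)) -> D (\bigcup_k F k)) ->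
  (forall n C, past_set n C -> D C) ->
  forall A, measurable A -> D A.
Proof.
move=> DT DC DU hD A mA.
pose G : set (set config) := [set C : set config | exists n, past_set n C].
have GE : @measurable _ config = <<s G >>.
  apply/seteqP; split; last first.
    apply: smallest_sub; first exact: sigma_algebra_measurable.
    by move=> C [n []].
  have : measurable_fun setT (id : g_sigma_algebraType G -> config).
    apply: measurable_to_config => n.
    by apply: sub_sigma_algebra; exists n; exact: past_set_coord.
  by move=> h B mB; have := h measurableT B mB; rewrite setTI.
have := @dynkin_induction _ config G D GE; apply => //.
- move=> B C [n pB] [m pC]; exists (Num.max n m).
  by apply: past_setI; [apply: past_setW pB|apply: past_setW pC]; lia.
- by move=> C [n pC]; exact: hD pC.
- by rewrite -GE.
Qed.

Lemma measurable_unique (R : realType) (m1 m2 : {measure set config -> \bar R}) :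
  (m1 setT < +oo)%E ->
  (forall n C, past_set n C -> m1 C = m2 C) ->
  forall A, measurable A -> m1 A = m2 A.
Proof.
move=> m1oo m12 A mA.
have mT : m1 setT = m2 setT by apply: (m12 0); exact: past_setT.
apply: (past_measurable_unique (D := fun A => m1 A = m2 A)) => //.
- move=> S mS h; have m2oo : (m2 setT < +oo)%E by rewrite -mT.
  rewrite -!setTD (measureD measurableT mS m1oo) (measureD measurableT mS m2oo).
  by rewrite !setTI; congr (_ - _)%E; [exact: mT|exact: h].
- move=> F mF tF h; rewrite !measure_semi_bigcup//; try exact: bigcupT_measurable.
  by apply: eq_eseriesr => i _.
Qed.

Lemma measurable_pr_unique (R : realType) d1 (T1 : measurableType d1)
    d2 (T2 : measurableType d2) (P1 : probability T1 R) (P2 : probability T2 R)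
    (g1 : T1 -> config) (g2 : T2 -> config) (A : set T1) (B : set T2) (c : R) :
  measurable_fun setT g1 -> measurable_fun setT g2 ->
  measurable A -> measurable B -> 0 <= c ->
  (forall n C, past_set n C ->
    pr P1 (g1 @^-1` C `&` A) = c * pr P2 (g2 @^-1` C `&` B)) ->
  forall C, measurable C ->
    pr P1 (g1 @^-1` C `&` A) = c * pr P2 (g2 @^-1` C `&` B).
Proof.
move=> mg1 mg2 mA mB c0 h C mC.
have mG1 D : measurable D -> measurable (g1 @^-1` D `&` A).
  by move=> mD; apply: measurableI => //; rewrite -[X in measurable X]setTI; exact: mg1.
have mG2 D : measurable D -> measurable (g2 @^-1` D `&` B).
  by move=> mD; apply: measurableI => //; rewrite -[X in measurable X]setTI; exact: mg2.
pose m1 : {measure set config -> \bar R} := trace_measure P1 mg1 mA.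
pose m2 : {measure set config -> \bar R} := mscale (NngNum c0) (trace_measure P2 mg2 mB).
have E1 D : measurable D -> m1 D = (pr P1 (g1 @^-1` D `&` A))%:E.
  by move=> mD; rewrite -prE//; exact: mG1.
have E2 D : measurable D -> m2 D = (c * pr P2 (g2 @^-1` D `&` B))%:E.
  by move=> mD; rewrite EFinM -prE//; exact: mG2.
suff : m1 C = m2 C by rewrite E1// E2// => -[].
apply: measurable_unique => //; first by rewrite E1 ?ltry.
by move=> n D pD; rewrite E1 ?E2 ?(h n)//; exact: pD.1.
Qed.

Lemma drop_word k L n x : drop k (word (k + L) n x) = word L (n - k%:Z) x.
Proof.
elim: k n => [|k IH] n; first by rewrite drop0 subr0.
by rewrite addSn /= IH; congr word; lia.
Qed.

(** * Mixing from the conditional law of the carrier *)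

Definition trapped (R : realType) (T : Type) (f : T -> R) (lo hi : R) :=
  forall z, lo <= f z <= hi.

Section Mixing.
Context (R : realType) (P : probability config R).
(** For a Markov chain the state is the site itself, [phi u v] is [~~ u && (0 < v)] and [V0] is 1.
    For the conditioned configuration the state is the carrier capped at [K], and [phi u v] is [v]
    capped at [K]. The load law is given by its tails [Qb], matching the events [load_ge]. *)
Context (S : finType) (s : int -> config -> S) (phi : S -> nat -> S) (s0 : S).
Context (V0 : nat) (Qb : S -> nat -> R) (eps : R).
Hypothesis fin_ae : pr P (~` [set x : config | finite_carrier 0 x]) = 0.
Hypothesis past_s : forall n u, past_set n [set x : config | s n x = u].
Hypothesis s_inv : forall n x, finite_carrier n x ->
  s n x = phi (s n (bbs x)) (carrier n x).
Hypothesis phi0 : forall u, phi u 0 = s0.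
Hypothesis phi_trunc : forall u v, phi u (minn v V0) = phi u v.
Hypothesis eps_gt0 : 0 < eps.
Hypothesis Qb0 : forall u, Qb u 0 = 1.
Hypothesis Qb1 : forall u, Qb u 1 <= 1 - eps.
Hypothesis Qb_ge0 : forall u v, 0 <= Qb u v.
Hypothesis Qb_anti : forall u v, Qb u v.+1 <= Qb u v.
(* Given the past of [bbs x] up to [n], the law of the carrier load depends
   only on the state [s n (bbs x)]. *)
Hypothesis carrier_law : forall n u v C, past_set n C ->
  pr P (bbs @^-1` (C `&` [set x : config | s n x = u]) `&` [set x : config | load_ge n v x])
  = Qb u v * pr P (C `&` [set x : config | s n x = u]).

Section Window.
Variables (n : int) (L V : nat).
Hypothesis LV : (L <= V)%N.
Hypothesis V0V : (V0 <= V)%N.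
Hypothesis V_gt0 : (0 < V)%N.

Let Z : finType := (L.-tuple bool * S)%type.

Definition word_tuple (x : config) : L.-tuple bool :=
  Tuple (introT eqP (size_word L n x)).

Definition unbbs_tuple (v : nat) (t : L.-tuple bool) : L.-tuple bool :=
  Tuple (introT eqP (etrans (size_unbbs v t) (size_tuple t))).

Let Y (x : config) : Z := (word_tuple x, s n x).
Let next (z : Z) (v : nat) : Z := (unbbs_tuple v z.1, phi z.2 v).

Let Yset (z : Z) : set config := [set x | Y x = z].

Let past_Yset z : past_set n (Yset z).
Proof.
rewrite (_ : Yset z = [set x : config | word L n x = z.1]
    `&` [set x : config | s n x = z.2]).
  by apply: past_setI; [exact: past_set_word1|exact: past_s].
apply/seteqP; split=> x; rewrite /Yset /=; first by move=> <-.
by case: z => t u /= [wt <-]; congr (_, _); apply: val_inj.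
Qed.

Let fin : set config := [set x : config | finite_carrier n x].

Let mfin : measurable fin.
Proof. exact: measurable_finite_carrier. Qed.

Let fin0 : pr P (~` fin) = 0.
Proof.
rewrite -fin_ae; congr pr; rewrite /fin; apply/seteqP; split=> x /=.
  by rewrite (finite_carrierE n 0).
by rewrite (finite_carrierE n 0).
Qed.

Let load (v : 'I_V.+1) : set config := [set x | minn (carrier n x) V = v].

(** The law of the load capped at [V], the last value carrying the whole tail. The cap loses nothing
    because [V] is at least [L] and [V0] (see [next_trunc]), and [0 < V] keeps the empty load apart
    from the others. *)
Let q (u : S) (v : 'I_V.+1) : R :=
  if (v < V)%N then Qb u v - Qb u v.+1 else Qb u V.

Let mload v : measurable (load v).
Proof.
rewrite (_ : load v = \bigcup_(w in [set w | minn w V = v])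
    [set x : config | carrier n x = w]).
  by apply: bigcup_measurable => w _; exact: measurable_carrier.
apply/seteqP; split=> x /=; first by move=> h; exists (carrier n x).
by case=> w h E; rewrite /load /= E.
Qed.

Let load_law C z v : past_set n C ->
  pr P (bbs @^-1` (C `&` Yset z) `&` load v) = q z.2 v * pr P (C `&` Yset z).
Proof.
move=> pC; have pCY := past_setI pC (past_Yset z).
have E : C `&` Yset z = (C `&` Yset z) `&` [set x : config | s n x = z.2].
  by apply/esym/setIidl => x [_ <-].
have law w : pr P (bbs @^-1` (C `&` Yset z) `&` [set x : config | load_ge n w x])
    = Qb z.2 w * pr P (C `&` Yset z).
  by rewrite E; exact: carrier_law.
have mB : measurable (bbs @^-1` (C `&` Yset z)).
  by apply: measurable_bbs_preimage; case: pCY.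
have mW w := measurable_load_ge n w.
rewrite /q; case: ifPn => vV.
  rewrite mulrBl -!law.
  rewrite (@pr_split _ _ _ P (_ `&` [set x : config | load_ge n v x])
     [set x : config | load_ge n v.+1 x]) //; last exact: measurableI.
  have -> : bbs @^-1` (C `&` Yset z) `&` [set x : config | load_ge n v x]
      `&` [set x : config | load_ge n v.+1 x]
      = bbs @^-1` (C `&` Yset z) `&` [set x : config | load_ge n v.+1 x].
    apply/seteqP; split=> x /=; first by case=> -[? _] ?; split.
    by case=> ? h; do !split=> //; exact: load_geW h.
  rewrite addrAC subrr add0r.
  apply: (@pr_ae_eq _ _ _ P _ _ (~` fin)) => //.
  - exact: measurableI.
  - by apply: measurableI; [exact: measurableI|exact: measurableC].
  - exact: measurableC.
  move=> x /contrapT f /=; rewrite !(carrierP _ f) /load /=; split.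
    by case=> ? h; split; [split=> //; lia|apply/negP; lia].
  by case=> -[? h] /negP ?; split=> //; lia.
rewrite -law; apply: (@pr_ae_eq _ _ _ P _ _ (~` fin)) => //.
- exact: measurableI.
- exact: measurableI.
- exact: measurableC.
move=> x /contrapT f /=; rewrite !(carrierP _ f) /load /=.
have -> : v = V :> nat by have := ltn_ord v; lia.
by split=> -[? h]; split=> //; lia.
Qed.

Let next_trunc z v : next z (minn v V) = next z v.
Proof.
congr (_, _).
  by apply: val_inj => /=; rewrite unbbs_trunc ?size_tuple.
by rewrite -phi_trunc -[RHS]phi_trunc; congr phi; lia.
Qed.

Let Y_inv x : fin x -> Y x = next (Y (bbs x)) (carrier n x).
Proof.
by move=> f; congr (_, _); [apply: val_inj; exact: unbbsP|exact: s_inv].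
Qed.

Let E (C : set config) (f : Z -> R) : R := \sum_z f z * pr P (C `&` Yset z).
Let Q (f : Z -> R) (z : Z) : R := \sum_(v < V.+1) q z.2 v * f (next z v).

(** The event is cut according to the window and state of [bbs x] and the capped load; on each piece
    [Y x] is almost surely the constant [next z v]. *)
Let pr_Yset_bbs C y : past_set n C ->
  pr P (bbs @^-1` C `&` Yset y) =
  \sum_z \sum_(v < V.+1) (next z v == y)%:R * (q z.2 v * pr P (C `&` Yset z)).
Proof.
move=> pC; have mC := pC.1; have mY z := (past_Yset z).1.
have mbC := measurable_bbs_preimage mC.
rewrite pair_big /=.
pose F (zv : Z * 'I_V.+1) : set config :=
  (bbs @^-1` C `&` Yset y) `&` (bbs @^-1` Yset zv.1 `&` load zv.2).
have mF zv : measurable (F zv).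
  by apply: measurableI; apply: measurableI => //; exact: measurable_bbs_preimage.
rewrite (_ : _ `&` _ = \bigcup_zv F zv); last first.
  apply/seteqP; split=> [x h|x [zv _ []//]].
  have hv : (minn (carrier n x) V < V.+1)%N by lia.
  by exists (Y (bbs x), Ordinal hv).
rewrite pr_sum//; last first.
  move=> [z v] [z' v'] zv; apply/seteqP; split=> // x [[_ [/= h1 h2]] [_ [/= h3 h4]]].
  move/eqP: zv; apply; congr (_, _); first by rewrite -h1 h3.
  by apply: val_inj; rewrite /= -h2 -h4.
apply: eq_bigr => -[z v] _ /=.
rewrite -load_law//; case: eqP => [ey|ne].
  rewrite mul1r; apply: (@pr_ae_eq _ _ _ P _ _ (~` fin)) => //.
  - apply: measurableI => //; apply: measurable_bbs_preimage; exact: measurableI.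
  - exact: measurableC.
  move=> x /contrapT f; rewrite /F /load /Yset /=; split.
    by case=> -[? _] [? ?].
  by case=> -[? E1] E2; split=> //; split=> //; rewrite Y_inv// E1 -(next_trunc z (carrier n x)) E2 ey.
rewrite mul0r; apply: (@pr_null _ _ _ P _ (~` fin)) => //; first exact: measurableC.
move=> x [[_ E0] [E1 E2]] f; apply: ne.
by rewrite -E0 (Y_inv f) E1 -(next_trunc z (carrier n x)) E2.
Qed.

(** The Markov property in reversed time. As [C] is any past event, it may itself be a preimage
    under [bbs], which allows iteration. *)
Let E_bbs C f : past_set n C -> E (bbs @^-1` C) f = E C (Q f).
Proof.
move=> pC; rewrite /E /Q.
under eq_bigr do rewrite pr_Yset_bbs// mulr_sumr.
rewrite exchange_big /=; apply: eq_bigr => z _.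
rewrite mulr_suml; under eq_bigr do rewrite mulr_sumr.
rewrite exchange_big /=; apply: eq_bigr => v _.
rewrite (bigD1 (next z v))//= eqxx big1 => [|y /negbTE].
  by rewrite addr0 mul1r; ring.
by rewrite eq_sym => ->; rewrite mul0r mulr0.
Qed.

Let q_sum u : \sum_(v < V.+1) q u v = 1.
Proof.
rewrite big_ord_recr /= {2}/q ltnn.
under eq_bigr => v _ do rewrite /q /= ltn_ord.
rewrite -(big_mkord predT (fun v => Qb u v - Qb u v.+1)) /=.
rewrite (@telescope_sumr_eq _ 0 V (fun v => - Qb u v)) ?Qb0//; first by ring.
by move=> k _; ring.
Qed.

Let q_ge0 u v : 0 <= q u v.
Proof. by rewrite /q; case: ifP => // _; rewrite subr_ge0. Qed.

Let q_eps u : eps <= q u ord0.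
Proof. by rewrite /q /= V_gt0 Qb0; have := Qb1 u; lra. Qed.

Let z0 : Z := (nseq_tuple L false, s0).

(** [L] empty loads clear the window; the extra one sets the state to [s0] even when [L] is 0. *)
Let iter_next0 z : iter L.+1 (next^~ 0%N) z = z0.
Proof.
have Es k : (iter k.+1 (next^~ 0%N) z).2 = s0 by rewrite iterS /= phi0.
have Ew k : (iter k (next^~ 0%N) z).1 = iter k (unbbs 0) z.1 :> seq bool.
  by elim: k => //= k ->.
rewrite [LHS]surjective_pairing Es; congr (_, _); apply: val_inj.
have := iter_unbbs0 z.1; rewrite size_tuple /= Ew => ->.
by elim: (L) => //= k ->.
Qed.

(** The branch that takes the empty load at each of the [j] steps has weight at least [eps ^+ j]; on
    all other branches [f] is estimated by [lo]. *)
Let Q_lower f lo j z : (forall z, lo <= f z) ->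
  lo + eps ^+ j * (f (iter j (next^~ 0%N) z) - lo) <= iter j Q f z.
Proof.
move=> h; elim: j z => [|j IH] z; first by rewrite expr0 mul1r /=; lra.
rewrite [X in f X]iterSr (_ : iter j.+1 Q f z = \sum_(v < V.+1) q z.2 v * iter j Q f (next z v))//.
have lb v : lo <= iter j Q f (next z v).
  by apply: le_trans (IH _); rewrite lerDl mulr_ge0 ?exprn_ge0 ?subr_ge0// ltW.
rewrite [leRHS]big_ord_recl.
apply: (@le_trans _ _ (q z.2 ord0 * iter j Q f (next z 0%N)
     + (1 - q z.2 ord0) * lo)); last first.
  rewrite lerD2l -(q_sum z.2) big_ord_recl addrAC subrr add0r mulr_suml.
  by apply: ler_sum => v _; apply: ler_wpM2l; [exact: q_ge0|exact: lb].
have := ler_wpM2l (q_ge0 z.2 ord0) (IH (next z 0%N)).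
set w := f _; have hw : 0 <= w - lo by rewrite subr_ge0; exact: h.
have : eps * (eps ^+ j * (w - lo)) <= q z.2 ord0 * (eps ^+ j * (w - lo)).
  by rewrite ler_wpM2r// mulr_ge0// exprn_ge0// ltW.
rewrite exprS; lra.
Qed.

Let QN f j z : iter j Q (fun z => - f z) z = - iter j Q f z.
Proof.
elim: j z => //= j IH z; rewrite {1}/Q -sumrN; apply: eq_bigr => v _.
by rewrite IH mulrN.
Qed.

Let Q_contract f lo hi : trapped f lo hi ->
  exists lo' hi', hi' - lo' = (1 - eps ^+ L.+1) * (hi - lo) /\
    trapped (iter L.+1 Q f) lo' hi'.
Proof.
move=> h; pose c := f z0; pose d := eps ^+ L.+1.
(* Since every starting point shares the target [z0], both bounds move towards [c] by the fraction
   [d]. The upper one is [Q_lower] for [- f]. *)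
exists (lo + d * (c - lo)), (hi + d * (c - hi)); split; first by rewrite /d; ring.
move=> z; apply/andP; split.
  rewrite /c -(iter_next0 z); apply: Q_lower => y; by case/andP: (h y).
have := @Q_lower (fun z => - f z) (- hi) L.+1 z.
rewrite QN iter_next0 => H.
have : forall y, - hi <= - f y by move=> y; rewrite lerN2; case/andP: (h y).
by move=> /H; rewrite -/c -/d; lra.
Qed.

Let Q_trapped f lo hi j : trapped f lo hi -> trapped (iter j Q f) lo hi.
Proof.
move=> h; elim: j => //= j IH z; apply/andP; split.
  rewrite -[leLHS]mul1r -(q_sum z.2) mulr_suml; apply: ler_sum => v _.
  by apply: ler_wpM2l => //; case/andP: (IH (next z v)).
rewrite -[leRHS]mul1r -(q_sum z.2) mulr_suml; apply: ler_sum => v _.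
by apply: ler_wpM2l => //; case/andP: (IH (next z v)).
Qed.

Let Q_osc f lo hi k : trapped f lo hi ->
  exists lo' hi', hi' - lo' = (1 - eps ^+ L.+1) ^+ k * (hi - lo) /\
    trapped (iter (k * L.+1) Q f) lo' hi'.
Proof.
move=> h; elim: k => [|k [lo' [hi' [e h']]]].
  by exists lo, hi; rewrite expr0 mul1r.
have [lo2 [hi2 [e2 h2]]] := Q_contract h'.
exists lo2, hi2; split; first by rewrite e2 e mulrA -exprS.
by rewrite mulSn iterD.
Qed.

Let pr_Yset C : measurable C -> pr P C = \sum_z pr P (C `&` Yset z).
Proof.
move=> mC; rewrite -pr_sum.
- congr pr; apply/seteqP; split=> [x Cx|x [z _ []//]].
  by exists (Y x).
- by move=> z; apply: measurableI => //; case: (past_Yset z).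
- move=> z z' zz'; apply/seteqP; split=> // x [[_ h] [_ h']].
  by move/eqP: zz'; apply; rewrite -h -h'.
Qed.

Let E_trapped C f lo hi : measurable C -> trapped f lo hi ->
  lo * pr P C <= E C f <= hi * pr P C.
Proof.
move=> mC h; rewrite (pr_Yset mC) !mulr_sumr; apply/andP; split;
  by apply: ler_sum => z _; rewrite ler_wpM2r ?pr_ge0//; case/andP: (h z).
Qed.

Let past_iter C k : past_set n C -> past_set n (iter k (preimage bbs) C).
Proof. by move=> pC; elim: k => //= k IH; exact: past_set_bbs. Qed.

Let E_iter C f k : past_set n C ->
  E (iter k (preimage bbs) C) f = E C (iter k Q f).
Proof.
move=> pC; elim: k f => //= k IH f.
by rewrite E_bbs ?IH; [rewrite -iterSr iterS|exact: past_iter].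
Qed.

(** The case f = 1 of [E_bbs]: each law [q] has total mass 1. *)
Lemma past_invariant_window C : past_set n C -> pr P (bbs @^-1` C) = pr P C.
Proof.
move=> pC; have mC := pC.1.
rewrite (pr_Yset (measurable_bbs_preimage mC)) (pr_Yset mC).
transitivity (E (bbs @^-1` C) (fun=> 1)).
  by apply: eq_bigr => z _; rewrite mul1r.
rewrite E_bbs//; apply: eq_bigr => z _.
by rewrite /Q; under eq_bigr do rewrite mulr1; rewrite q_sum mul1r.
Qed.

Let E_word (B : set (seq bool)) C : measurable C ->
  pr P (C `&` [set x : config | B (word L n x)])
  = E C (fun z => if `[< B z.1 >] then 1 else 0).
Proof.
move=> mC; rewrite pr_Yset; last first.
  by apply: measurableI => //; exact: measurable_word.
apply: eq_bigr => z _; case: asboolP => Bz.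
  rewrite mul1r; congr pr; apply/seteqP; split=> x [].
    by case=> ? _ ?; split.
  by move=> Cx Yx; split=> //; split=> //=; move: Bz; rewrite -Yx.
rewrite mul0r (_ : _ `&` Yset z = set0) ?pr0//.
by apply/seteqP; split=> // x [[_ /= Bx] Yx]; apply: Bz; rewrite -Yx.
Qed.

(** For the indicator [f] of the word event the probability is [E C (iter k Q f)], and [iter k Q f]
    is nearly constant for large [k]. No stationary law is needed to name the constant: with the
    sure event for [C], the same expression is the probability of the word event for every [k]. *)
Lemma word_mixing_window (B : set (seq bool)) C : past_set n C ->
  pr P (iter k (preimage bbs) C `&` [set x : config | B (word L n x)]) @[k --> \oo]
  --> pr P C * pr P [set x : config | B (word L n x)].
Proof.
move=> pC; have mC := pC.1.
set f := fun z : Z => if `[< B z.1 >] then 1 else 0 : R.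
have f01 : trapped f 0 1 by move=> z; rewrite /f; case: asboolP => _; lra.
apply/cvgrPdist_le => e e0.
have d0 : 0 < eps ^+ L.+1 by rewrite exprn_gt0.
have d1 : eps ^+ L.+1 <= 1.
  rewrite exprn_ile1 ?(ltW eps_gt0)//.
  by have := Qb_ge0 s0 1; have := Qb1 s0; lra.
have : `|1 - eps ^+ L.+1| < 1 by rewrite ger0_norm ?subr_ge0// gtrBl.
move=> /cvg_expr/cvgrPdist_le/(_ e e0)[K _ HK].
exists (K * L.+1)%N => // k /= hk.
have [lo [hi [ehl h]]] := Q_osc K f01.
have hk' : trapped (iter k Q f) lo hi.
  by rewrite -(subnK hk) iterD; exact: Q_trapped.
have mk := (past_iter k pC).1.
rewrite E_word// E_iter//.
have -> : pr P [set x : config | B (word L n x)] = E setT (iter k Q f).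
  rewrite -E_iter; last exact: past_setT.
  have -> : iter k (preimage bbs) setT = setT :> set config by elim: (k) => //= ? ->.
  by rewrite -E_word// setTI.
have /andP[h1 h2] := E_trapped mC hk'.
have /andP[h3 h4] := E_trapped (measurableT : measurable [set: config]) hk'.
rewrite prT !mulr1 in h3 h4.
have c0 := pr_ge0 P C; have c1 := pr_le1 P mC.
have := HK K (leqnn _); rewrite /= sub0r normrN ger0_norm ?exprn_ge0 ?subr_ge0//.
move: ehl; rewrite subr0 mulr1 => <- hle.
apply: (@le_trans _ _ (hi - lo)) => //.
rewrite ler_norml; apply/andP; split.
  have := ler_wpM2l c0 h3; nra.
have := ler_wpM2l c0 h4; nra.
Qed.

End Window.

Lemma past_invariant n C : past_set n C -> pr P (bbs @^-1` C) = pr P C.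
Proof.
move=> pC.
by apply: (@past_invariant_window n 0 V0.+1) => //.
Qed.

Lemma word_mixing n L (B : set (seq bool)) C : past_set n C ->
  pr P (iter k (preimage bbs) C `&` [set x : config | B (word L n x)]) @[k --> \oo]
  --> pr P C * pr P [set x : config | B (word L n x)].
Proof. by move=> pC; apply: (@word_mixing_window n L (L + V0).+1) => //; lia. Qed.

End Mixing.

(** * From mixing to ergodicity of Pitman's transformation *)

Section FromMixing.
Context (R : realType) (P : probability config R).
Hypothesis fin_ae : pr P (~` [set x : config | finite_carrier 0 x]) = 0.
Hypothesis inv_past : forall n C, past_set n C -> pr P (bbs @^-1` C) = pr P C.
Hypothesis mix_past : forall n L (B : set (seq bool)) C, past_set n C ->
  pr P (iter k (preimage bbs) C `&` [set x : config | B (word L n x)]) @[k --> \oo]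
  --> pr P C * pr P [set x : config | B (word L n x)].

Let mB A k : measurable A -> measurable (iter k (preimage bbs) A : set config).
Proof. by move=> mA; elim: k => //= k; exact: measurable_bbs_preimage. Qed.

Lemma bbs_invariant A : measurable A -> pr P (bbs @^-1` A) = pr P A.
Proof.
move=> mA.
have H := @measurable_pr_unique R _ config _ config P P bbs id setT setT 1
  measurable_bbs (@measurable_id _ _ _) measurableT measurableT ler01.
rewrite -[LHS]/(pr P _) -(setIT (bbs @^-1` A)) (H _ A mA) ?setIT ?mul1r//.
move=> n C pC; rewrite !setIT mul1r preimage_id; exact: inv_past pC.
Qed.

Let iter_invariant A k : measurable A -> pr P (iter k (preimage bbs) A) = pr P A.
Proof. by move=> mA; elim: k => //= k IH; rewrite bbs_invariant//; exact: mB. Qed.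

Let iter_preimageE A k : iter k (preimage bbs) A = (iter k bbs) @^-1` A :> set config.
Proof.
elim: k => // k IH; rewrite iterS IH; apply/seteqP; by split=> x; rewrite /preimage /= -iterS iterSr.
Qed.

Let word_extend L n (B : set (seq bool)) n' : n <= n' ->
  exists L' (B' : set (seq bool)),
    [set x : config | B (word L n x)] = [set x : config | B' (word L' n' x)].
Proof.
move=> nn'; exists (`|n' - n| + L)%N, [set s | B (drop `|n' - n| s)].
have E : n' - `|n' - n|%N%:Z = n by lia.
by apply/seteqP; split=> x /=; rewrite drop_word E.
Qed.

Lemma bbs_mixing n L (B : set (seq bool)) A : measurable A ->
  pr P (iter k (preimage bbs) A `&` [set x : config | B (word L n x)]) @[k --> \oo]
  --> pr P A * pr P [set x : config | B (word L n x)].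
Proof.
set X := mkset _; have mX : measurable X by exact: measurable_word.
have mI S k : measurable S -> measurable (iter k (preimage bbs) S `&` X).
  by move=> mS; apply: measurableI => //; exact: mB.
apply: (past_measurable_unique (D := fun A =>
   pr P (iter k (preimage bbs) A `&` X) @[k --> \oo] --> pr P A * pr P X)).
- under eq_fun do rewrite iter_preimageE preimage_setT setTI.
  by rewrite prT mul1r; exact: cvg_cst.
- move=> S mS h.
  have -> : (fun k => pr P (iter k (preimage bbs) (~` S) `&` X)) =
      (fun k => pr P X - pr P (iter k (preimage bbs) S `&` X)).
    apply/funext => k.
    rewrite [pr P X](pr_split P mX (mB k mS)) [X `&` _]setIC addrAC subrr add0r.
    by rewrite setIC !iter_preimageE preimage_setC.
  by rewrite prC// mulrBl mul1r; apply: cvgB => //; exact: cvg_cst.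
- move=> F mF tF hF.
  pose G m := \bigcup_(i in `I_m) F i.
  have mG m : measurable (G m) by apply: fin_bigcup_measurable => //; exact: finite_II.
  have GS m : G m.+1 = G m `|` F m by rewrite /G IIS bigcup_setU bigcup_set1.
  have dG m : G m `&` F m = set0.
    apply/seteqP; split=> // x [[i /= im Fi] Fm].
    move/trivIsetP : tF => /(_ i m I I).
    have im' : i != m by rewrite neq_ltn im.
    by move=> /(_ im') E0; have : (F i `&` F m) x by []; rewrite E0.
  have hG m : pr P (iter k (preimage bbs) (G m) `&` X) @[k --> \oo] --> pr P (G m) * pr P X.
    elim: m => [|m IH].
      rewrite /G II0 bigcup_set0 pr0 mul0r.
      under eq_fun do rewrite iter_preimageE preimage_set0 set0I pr0.
      exact: cvg_cst.
    have -> : (fun k => pr P (iter k (preimage bbs) (G m.+1) `&` X)) =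
       (fun k => pr P (iter k (preimage bbs) (G m) `&` X) + pr P (iter k (preimage bbs) (F m) `&` X)).
      apply/funext => k; rewrite -prU; [|exact: mI|exact: mI|].
        by rewrite -setIUl !iter_preimageE -preimage_setU GS.
      by rewrite setIACA !iter_preimageE -preimage_setI dG preimage_set0 set0I.
    by rewrite GS prU// mulrDl; apply: cvgD.
  set U := \bigcup_k F k; have mU : measurable U by exact: bigcupT_measurable.
  have GU : \bigcup_m G m = U.
    apply/seteqP; split=> x; first by case=> m _ [i _ Fi]; exists i.
    by case=> i _ Fi; exists i.+1 => //; exists i => /=.
  have sGU m : G m `<=` U by move=> x [i _ Fi]; exists i.
  have cG : pr P (G m) @[m --> \oo] --> pr P U.
    rewrite -GU; apply: pr_cvg => // m m' mm'; apply/subsetPset => x [i /= im Fi].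
    by exists i => //=; exact: leq_trans mm'.
  (* The limits in [k] and [m] are exchanged by an estimate uniform in [k]: by invariance, the
     preimages of the remainder [U] minus [G m] all keep its small probability. *)
  apply/cvgrPdist_le => e e0.
  have e3 : 0 < e / 3 by lra.
  move/cvgrPdist_le : cG => /(_ _ e3)[m _ /(_ m (leqnn _)) /= hm].
  move/cvgrPdist_le : (hG m) => /(_ _ e3)[K _ HK].
  exists K => // k hk.
  have := HK k hk; rewrite /=.
  have h1 : pr P U = pr P (G m) + pr P (U `&` ~` G m).
    by rewrite (pr_split P mU (mG m)) (setIidr (@sGU m)).
  have mUk := mB k mU; have mGk := mB k (mG m).
  have mD := measurableI _ _ mU (measurableC (mG m)).
  have h2 : pr P (iter k (preimage bbs) U `&` X) <=
      pr P (iter k (preimage bbs) (G m) `&` X) + pr P (U `&` ~` G m).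
    rewrite (pr_split P (mI _ k mU) mGk) -(iter_invariant k mD).
    apply: lerD; apply: le_pr.
    - exact: measurableI (mI _ k mU) mGk.
    - exact: mI.
    - by move=> x [[_ ?] ?].
    - by apply: measurableI (mI _ k mU) _; exact: measurableC.
    - exact: mB.
    - by move=> x []; rewrite !iter_preimageE => -[].
  have h3 : pr P (iter k (preimage bbs) (G m) `&` X) <= pr P (iter k (preimage bbs) U `&` X).
    apply: le_pr; [exact: mI|exact: mI|].
    by move=> x []; rewrite !iter_preimageE => /= /sGU.
  have X0 := pr_ge0 P X; have X1 := pr_le1 P mX.
  have r0 := pr_ge0 P (U `&` ~` G m).
  move: hm; rewrite h1 addrAC subrr add0r ger0_norm// => hm.
  have h4 : 0 <= pr P (U `&` ~` G m) * pr P X by rewrite mulr_ge0.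
  have h5 : pr P (U `&` ~` G m) * pr P X <= pr P (U `&` ~` G m) by rewrite ler_piMr.
  rewrite !ler_norml => /andP[h6 h7]; apply/andP; rewrite mulrDl; split; lra.
(* The past event and the word may end at different sites. Both are referred to the larger one, the
   word becoming the left part of a longer word. *)
move=> m C pC; pose n' := Num.max n m.
have [|L' [B' E]] := @word_extend L n B n'; first by rewrite /n'; lia.
rewrite /X E; apply: mix_past; apply: past_setW pC; rewrite /n'; lia.
Qed.

(** For an invariant [A] the mixing sequence is constant, so [A] is independent of every word event,
    hence of every event, hence of itself: its probability equals its own square. *)
Lemma bbs_ergodic A : measurable A ->
  pr P ([set x | A (bbs x) /\ ~ A x] `|` [set x | ~ A (bbs x) /\ A x]) = 0 ->
  pr P A = 0 \/ pr P A = 1.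
Proof.
set N := _ `|` _ => mA N0.
have mN : measurable N.
  have mb := measurable_bbs_preimage mA.
  rewrite (_ : N = ((bbs @^-1` A) `&` ~` A) `|` (~` (bbs @^-1` A) `&` A)).
    by apply: measurableU; apply: measurableI => //; exact: measurableC.
  by apply/seteqP; split.
have E n L (B : set (seq bool)) :
    pr P (A `&` [set x : config | B (word L n x)]) = pr P A * pr P [set x : config | B (word L n x)].
  have mX : measurable [set x : config | B (word L n x)] by exact: measurable_word.
  have := @bbs_mixing n L B A mA.
  have -> : (fun k => pr P (iter k (preimage bbs) A `&` [set x : config | B (word L n x)]))
     = (fun=> pr P (A `&` [set x : config | B (word L n x)])).
    apply/funext => k; elim: k => // k <-.
    apply: (@pr_ae_eq _ _ _ P _ _ (iter k (preimage bbs) N)).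
    - by apply: measurableI => //; exact: mB k.+1 mA.
    - by apply: measurableI => //; exact: mB.
    - exact: mB.
    - by rewrite iter_invariant.
    move=> x; rewrite !iter_preimageE /= => nN.
    suff : A (bbs (iter k bbs x)) <-> A (iter k bbs x) by tauto.
    by split=> h; apply: contrapT => h'; apply: nN; [left|right].
  by move=> /(cvg_unique _ (@cvg_cst _ _ _ _ _)) ->.
have EA : pr P A = pr P A * pr P A.
  have := @measurable_pr_unique R _ config _ config P P id id A setT (pr P A).
  move=> /(_ (@measurable_id _ _ _) (@measurable_id _ _ _) mA measurableT (pr_ge0 _ _)).
  move=> /(_ _ A mA); rewrite !preimage_id setIid setIT; apply=> n C pC.
  have := @past_pr_unique R _ config _ config P P id id A setT (pr P A) (fun=> True) n.
  apply=> //; try exact: measurable_id; try exact: pr_ge0.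
  - by move=> s _; rewrite !preimage_id setIT setIC; exact: (E n (size s) (fun t => t = s)).
  - by rewrite never_good_true preimage_set0 set0I pr0.
  - by rewrite never_good_true preimage_set0 set0I pr0.
have : pr P A * (1 - pr P A) = 0 by rewrite mulrBr mulr1 -EA subrr.
by move/eqP; rewrite mulf_eq0 => /orP[/eqP|/eqP]; [left|right; lra].
Qed.

Let pitman_bbs x : finite_carrier 0 x -> pitman R x = bbs x.
Proof. by move=> f; apply/funext => n; rewrite pitmanE asboolT. Qed.

Let mfin := measurable_finite_carrier 0.

Lemma pitman_ergodic :
  {ae P, forall x, pitman_defined R x} /\ ergodic P (pitman R).
Proof.
have nfin : P (~` [set x : config | finite_carrier 0 x]) = 0%E.
  by rewrite prE ?fin_ae//; exact: measurableC.
split.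
  exists (~` [set x : config | finite_carrier 0 x]); split=> //.
    exact: measurableC.
  by move=> x /= nd f; apply: nd; apply/pitman_definedE.
have mp A : measurable A -> measurable (pitman R @^-1` A).
  by move=> mA; rewrite -[X in measurable X]setTI; exact: measurable_pitman.
split; [split|].
- exact: measurable_pitman.
- move=> A mA; rewrite prE ?prE//; last exact: mp.
  rewrite -(bbs_invariant mA); congr _%:E.
  apply: (@pr_ae_eq _ _ _ P _ _ (~` [set x : config | finite_carrier 0 x])) => //.
  + exact: mp.
  + exact: measurable_bbs_preimage.
  + exact: measurableC.
  by move=> x /contrapT f; rewrite /= pitman_bbs.
move=> A mA [N [mN N0 hN]].
rewrite prE//; suff [->|->] : pr P A = 0 \/ pr P A = 1 by [left|right].
have mb := measurable_bbs_preimage mA.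
apply: bbs_ergodic => //.
apply: (@pr_null _ _ _ P _ (N `|` ~` [set x : config | finite_carrier 0 x])).
- rewrite (_ : _ `|` _ = ((bbs @^-1` A) `&` ~` A) `|` (~` (bbs @^-1` A) `&` A)).
    by apply: measurableU; apply: measurableI => //; exact: measurableC.
  by apply/seteqP; split.
- by apply: measurableU => //; exact: measurableC.
- by apply: pr_nullU => //; [exact: measurableC|rewrite /pr N0].
move=> x h; have [f|f] := pselect (finite_carrier 0 x); [left|by right].
by apply: hN => /=; rewrite pitman_bbs//; move: h => /=; tauto.
Qed.

End FromMixing.

Lemma carrier_law_ergodic (R : realType) (P : probability config R)
    (S : finType) (s : int -> config -> S) (phi : S -> nat -> S) (s0 : S)
    (V0 : nat) (Qb : S -> nat -> R) (eps : R) :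
  pr P (~` [set x : config | finite_carrier 0 x]) = 0 ->
  (forall n u, past_set n [set x : config | s n x = u]) ->
  (forall n x, finite_carrier n x -> s n x = phi (s n (bbs x)) (carrier n x)) ->
  (forall u, phi u 0 = s0) ->
  (forall u v, phi u (minn v V0) = phi u v) ->
  0 < eps ->
  (forall u, Qb u 0 = 1) ->
  (forall u, Qb u 1 <= 1 - eps) ->
  (forall u v, 0 <= Qb u v) ->
  (forall u v, Qb u v.+1 <= Qb u v) ->
  (forall n u v C, past_set n C ->
    pr P (bbs @^-1` (C `&` [set x : config | s n x = u]) `&` [set x : config | load_ge n v x])
    = Qb u v * pr P (C `&` [set x : config | s n x = u])) ->
  {ae P, forall x, pitman_defined R x} /\ ergodic P (pitman R).
Proof.
move=> h1 h2 h3 h4 h5 h6 h7 h8 h9 h10 h11; apply: pitman_ergodic => //.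
- by move=> n C pC; exact: (past_invariant h1 h2 h3 h5 h6 h7 h11 pC).
- move=> n L B C pC.
  exact: (@word_mixing _ _ _ _ _ _ _ _ _ h1 h2 h3 h4 h5 h6 h7 h8 h9 h10 h11 n L B C pC).
Qed.

(** * Markov chains *)

Definition shift (m : int) (x : config) : config := fun k => x (k + m).

Lemma measurable_shift m : measurable_fun setT (shift m).
Proof. by apply: measurable_to_config => n; exact: measurable_coord. Qed.

Lemma word_shift L n m x : word L n (shift m x) = word L (n + m) x.
Proof. by elim: L n => //= L IH n; rewrite IH /shift; congr (_ :: word _ _ _); lia. Qed.

Lemma window_load_shift L n m x : window_load L n (shift m x) = window_load L (n + m) x.
Proof. by rewrite !window_load_word word_shift. Qed.

Lemma load_ge_shift n m v x : load_ge n v (shift m x) = load_ge (n + m) v x.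
Proof. by rewrite /load_ge; apply/propext; split=> -[L h]; exists L; move: h; rewrite window_load_shift. Qed.

Lemma shift_invariant (R : realType) (P : probability config R) :
  (forall n m s, pr P [set x : config | word (size s) n x = s]
               = pr P [set x : config | word (size s) m x = s]) ->
  forall m C, measurable C -> pr P (shift m @^-1` C) = pr P C.
Proof.
move=> H m C mC.
have H1 := @measurable_pr_unique R _ config _ config P P (shift m) id setT setT 1
  (measurable_shift m) (@measurable_id _ _ _) measurableT measurableT ler01.
rewrite -[LHS]/(pr P _) -(setIT (shift m @^-1` C)) (H1 _ C mC) ?setIT ?mul1r// => n D pD.
have := @past_pr_unique R _ config _ config P P (shift m) id setT setT 1 (fun=> True) n.
apply=> //; try exact: measurable_id; try exact: measurable_shift.
- move=> s _; rewrite !setIT mul1r (_ : _ @^-1` _ = [set x : config | word (size s) (n + m) x = s]).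
    exact: H.
  by apply/seteqP; split=> x /=; rewrite word_shift.
- by rewrite never_good_true preimage_set0 set0I pr0.
- by rewrite never_good_true preimage_set0 set0I pr0.
Qed.

Lemma measurable_coordE n b : measurable [set x : config | x n = b].
Proof. by case: (past_set_coordE n b). Qed.

Ltac meas := repeat first
  [ exact: measurable_load_ge | exact: measurable_word1 | exact: measurable_coordE
  | exact: measurable_coord | exact: measurable_carrier
  | exact: measurable_finite_carrier | exact: measurableT
  | apply: measurableI | apply: measurableC | apply: measurableU
  | apply: measurable_bbs_preimage ].

(** [bbs_inv] freed from finiteness: at a vacant site a load of at least 1 stems from a load of at
    least 2 one site to the left, and then [bbs x n] is true. *)
Lemma bbs_coord n x : x n = ~~ bbs x n && `[< load_ge n 1 x >].
Proof.
rewrite /bbs; case xn : (x n) => /=.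
  by apply/esym/asboolP; rewrite load_ge_up//; exact: load_ge0.
case: asboolP => //= h; apply/esym/asboolP; rewrite load_ge_down ?xn//.
by move=> /(@load_geW _ 1 2 _ isT).
Qed.

Lemma le_geometric_le0 (R : realType) (x c r : R) : 0 <= r < 1 ->
  (forall v, x <= c * r ^+ v) -> x <= 0.
Proof.
move=> /andP[r0 r1] h.
have : c * r ^+ v @[v --> \oo] --> c * 0.
  by apply: cvgM; [exact: cvg_cst|apply: cvg_expr; rewrite ger0_norm].
by rewrite mulr0 => /cvgr_to_ge; apply; apply: nearW.
Qed.

Section MarkovChain.
Context (R : realType) (P : probability config R) (p : bool -> R).
Local Notation a := (p false).
Local Notation b := (p true).
Hypothesis a_ge0 : 0 <= a.
Hypothesis b_ge0 : 0 <= b.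
Hypothesis ab_lt1 : a + b < 1.
Hypothesis word_markov : forall n s c d,
  pr P [set x : config | word (size s).+2 n x = [:: c, d & s]]
  = bernoulli_pmf (p d) c * pr P [set x : config | word (size s).+1 (n - 1) x = d :: s].
Hypothesis word_stat : forall n m s,
  pr P [set x : config | word (size s) n x = s]
  = pr P [set x : config | word (size s) m x = s].

Let pmf_ge0 i j : 0 <= bernoulli_pmf (p i) j.
Proof. by have := a_ge0; have := b_ge0; have := ab_lt1 => h1 h2 h3; apply: bernoulli_pmf_ge0; apply/andP; case: i; split; lra. Qed.

Let markov (n : int) C i j : past_set (n - 1) C ->
  pr P (C `&` ([set x : config | x (n - 1) = i] `&` [set x : config | x n = j]))
  = bernoulli_pmf (p i) j * pr P (C `&` [set x : config | x (n - 1) = i]).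
Proof.
move=> pC.
have := @past_pr_unique R _ config _ config P P id id
  ([set x : config | x (n - 1) = i] `&` [set x : config | x n = j])
  [set x : config | x (n - 1) = i] (bernoulli_pmf (p i) j) (fun s => s <> [::]) (n - 1).
rewrite never_good_nil !preimage_set0 !set0I pr0 => H.
apply: (H _ _ _ _ _ _ erefl erefl C pC); try exact: measurable_id.
- by meas.
- by meas.
- exact: pmf_ge0.
case=> // d s _; rewrite !preimage_id /=.
have [<-|di] := eqVneq d i.
  transitivity (pr P [set x : config | word (size s).+2 n x = [:: j, d & s]]).
    congr pr; apply/seteqP; split=> x /=.
      by case=> -[-> ->] [_ ->].
    by case=> -> -> ->.
  rewrite word_markov; congr (_ * pr P _); apply/seteqP; split=> x /=.
    by case=> -> ->.
  by case.
rewrite [X in pr P X](_ : _ = set0) ?pr0; last first.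
  by apply/seteqP; split=> // x [/= [h _] [h' _]]; move/eqP: di; apply; rewrite -h h'.
rewrite [X in pr P X](_ : _ = set0) ?pr0 ?mulr0//.
by apply/seteqP; split=> // x [/= [h _] h']; move/eqP: di; apply; rewrite -h h'.
Qed.

Let pr_coord C (n : int) : measurable C ->
  pr P C = pr P (C `&` [set x : config | x n = true]) + pr P (C `&` [set x : config | x n = false]).
Proof.
move=> mC; rewrite (pr_split P mC (measurable_coordE n true)); congr (_ + pr P (_ `&` _)).
by apply/seteqP; split=> x /=; case: (x n).
Qed.

Let markov_sum (n : int) C j : past_set (n - 1) C ->
  pr P (C `&` [set x : config | x n = j])
  = bernoulli_pmf b j * pr P (C `&` [set x : config | x (n - 1) = true])
    + bernoulli_pmf a j * pr P (C `&` [set x : config | x (n - 1) = false]).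
Proof.
move=> pC; have mC := pC.1.
rewrite (pr_coord (n - 1)); last by apply: measurableI => //; meas.
by rewrite -!markov// -!setIA; congr (pr P (_ `&` _) + pr P (_ `&` _)); rewrite setIC.
Qed.

Let shiftE (m : int) C : measurable C -> pr P (shift m @^-1` C) = pr P C.
Proof. exact: shift_invariant. Qed.

Let pi1 := pr P [set x : config | x 0 = true].

Let pi1E n : pr P [set x : config | x n = true] = pi1.
Proof.
rewrite /pi1 -(@shiftE n _ (measurable_coordE 0 true)); congr pr.
by apply/seteqP; split=> x; rewrite /shift /= add0r.
Qed.

Let pi0E n : pr P [set x : config | x n = false] = 1 - pi1.
Proof.
rewrite -(pi1E n) -prC; last exact: measurable_coordE.
by congr pr; apply/seteqP; split=> x /=; case: (x n).
Qed.

Let pi1_eq : pi1 * (1 - b) = a * (1 - pi1).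
Proof.
have := markov_sum true (past_setT (0 - 1)); rewrite !setTI !pi1E !pi0E /bernoulli_pmf.
by move=> h; rewrite mulrBr mulr1 {1}h; ring.
Qed.

Let pi1_ge0 : 0 <= pi1. Proof. exact: pr_ge0. Qed.

(** The ratio which a vanishing flux imposes between loads at vacant and at occupied sites (see
    [flux]), and therefore also the ratio of the geometric tails. *)
Let r := b / (1 - a).

Let r_ge0 : 0 <= r.
Proof.
have := a_ge0; have := b_ge0; have := ab_lt1 => h1 h2 h3.
by rewrite /r divr_ge0//; lra.
Qed.

Let r_lt1 : r < 1.
Proof.
have := a_ge0; have := b_ge0; have := ab_lt1 => h1 h2 h3.
by rewrite /r ltr_pdivrMr; lra.
Qed.

Let rE : r * (1 - a) = b.
Proof.
have := a_ge0; have := b_ge0; have := ab_lt1 => h1 h2 h3.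
by rewrite /r divfK//; apply/eqP; lra.
Qed.

(** The right-hand sides are the fixed point of the recursion of the load, by [r * (1 - a) = b], and
    a carrier started empty stays below it. This supplies the decay at infinity that [flux] needs
    before exact values are known. *)
Let window_load_bound L n v :
  pr P ([set x : config | (v.+1 <= window_load L n x)%N] `&` [set x : config | x n = true])
    <= pi1 * r ^+ v /\
  pr P ([set x : config | (v.+1 <= window_load L n x)%N] `&` [set x : config | x n = false])
    <= pi1 * r ^+ v.+1.
Proof.
have past_window_load k m w : past_set m [set x : config | (w <= window_load k m x)%N].
  split; last by move=> x y e /=; rewrite (past_eq_window_load k e).
  under eq_set do rewrite window_load_word.
  exact: (measurable_word k m [set s | (w <= foldr _ _ s)%N]).
have := a_ge0; have := b_ge0; have := ab_lt1 => ha hb hab.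
have rv w : 0 <= pi1 * r ^+ w by rewrite mulr_ge0// exprn_ge0.
elim: L n v => [|L IH] n v.
  have E0 : [set x : config | (v.+1 <= window_load 0 n x)%N] = set0 by apply/seteqP; split.
  by rewrite E0 !set0I pr0.
split.
  rewrite (_ : _ `&` _ = [set x : config | (v <= window_load L (n - 1) x)%N]
      `&` [set x : config | x n = true]); last first.
    by apply/seteqP; split=> x /= [h xn]; move: h; rewrite xn.
  rewrite markov_sum//; case: v => [|v].
    rewrite (_ : mkset _ = setT) ?setTI; last by apply/seteqP; split.
    by rewrite pi1E pi0E expr0 mulr1 /bernoulli_pmf; move: pi1_eq; lra.
  have [h1 h2] := IH (n - 1) v; rewrite /bernoulli_pmf.
  apply: (@le_trans _ _ (b * (pi1 * r ^+ v) + a * (pi1 * r ^+ v.+1))).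
    by apply: lerD; apply: ler_wpM2l.
  by rewrite exprS -{1}rE; lra.
rewrite (_ : _ `&` _ = [set x : config | (v.+2 <= window_load L (n - 1) x)%N]
    `&` [set x : config | x n = false]); last first.
  by apply/seteqP; split=> x /= [h xn]; move: h; rewrite xn; split=> //; lia.
rewrite markov_sum//; have [h1 h2] := IH (n - 1) v.+1; rewrite /bernoulli_pmf.
apply: (@le_trans _ _ ((1 - b) * (pi1 * r ^+ v.+1) + (1 - a) * (pi1 * r ^+ v.+2))).
  by apply: lerD; apply: ler_wpM2l => //; lra.
by rewrite [r ^+ v.+2]exprS -{1}rE; lra.
Qed.

Let D n j v := pr P ([set x : config | load_ge n v x] `&` [set x : config | x n = j]).

Let D_bound n v : D n true v.+1 <= pi1 * r ^+ v /\ D n false v.+1 <= pi1 * r ^+ v.+1.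
Proof.
have H j : pr P ([set x : config | (v.+1 <= window_load L n x)%N] `&` [set x : config | x n = j])
    @[L --> \oo] --> D n j v.+1.
  rewrite /D (_ : [set x : config | load_ge n v.+1 x] `&` _ =
     \bigcup_L ([set x : config | (v.+1 <= window_load L n x)%N] `&` [set x : config | x n = j])).
    apply: pr_cvg => [L|].
      apply: measurableI; last exact: measurable_coordE.
      under eq_set do rewrite window_load_word.
      exact: (measurable_word L n [set s | (v.+1 <= foldr _ _ s)%N]).
    move=> L L' LL'; apply/subsetPset => x /= [h ?]; split=> //.
    by apply: leq_trans h _; exact: window_load_mono.
  apply/seteqP; split=> x /=; first by case=> -[L h] ?; exists L.
  by case=> L _ [h ?]; split=> //; exists L.
by split; apply: (cvgr_to_le (H _)); apply: nearW => L; case: (window_load_bound L n v).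
Qed.

Let D_stat n m j v : D n j v = D m j v.
Proof.
rewrite /D -(@shiftE (n - m) ([set x : config | load_ge m v x] `&` [set x : config | x m = j])).
  congr pr; apply/seteqP; split=> x /=; rewrite load_ge_shift /shift (_ : m + (n - m) = n)//; lia.
by meas.
Qed.

Let D_ge0 n j v : 0 <= D n j v. Proof. exact: pr_ge0. Qed.

Let D_0 n j : D n j 0 = pr P [set x : config | x n = j].
Proof.
congr pr; apply/seteqP; split=> x /=; first by case.
by move=> ?; split=> //; exact: load_ge0.
Qed.

Let D_true n v : D n true v.+1 = b * D n true v + a * D n false v.
Proof.
rewrite -(D_stat (n - 1) n true v) -(D_stat (n - 1) n false v) [LHS]/D.
rewrite (_ : _ `&` _ = [set x : config | load_ge (n - 1) v x] `&` [set x : config | x n = true]).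
  by rewrite markov_sum//; exact: past_set_load_ge.
by apply/seteqP; split=> x /= -[h xn]; split=> //; move: h; rewrite (@load_ge_up n).
Qed.

Let D_false n v : D n false v.+1 = (1 - b) * D n true v.+2 + (1 - a) * D n false v.+2.
Proof.
rewrite -(D_stat (n - 1) n true v.+2) -(D_stat (n - 1) n false v.+2) [LHS]/D.
rewrite (_ : _ `&` _ = [set x : config | load_ge (n - 1) v.+2 x] `&` [set x : config | x n = false]).
  by rewrite markov_sum//; exact: past_set_load_ge.
by apply/seteqP; split=> x /= -[h xn]; split=> //; move: h; rewrite (@load_ge_down n) ?xn.
Qed.

Let r01 : 0 <= r < 1. Proof. by rewrite r_ge0 r_lt1. Qed.

Let pi1_le1 : pi1 <= 1. Proof. by apply: pr_le1; exact: measurable_coordE. Qed.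

(* The probability flux through each level of the carrier vanishes at infinity
   and does not depend on the level. *)
Let flux n v : (1 - a) * D n false v.+1 = b * D n true v.+1.
Proof.
have := a_ge0; have := b_ge0; have := ab_lt1 => hab hb ha.
pose l v := (1 - a) * D n false v.+1 - b * D n true v.+1.
have lS w : l w.+1 = l w.
  by rewrite /l (D_true n w.+1); have := D_false n w; rewrite (D_true n w.+1); lra.
have lE w : l w = l 0%N by elim: w => // w <-; exact: lS.
have bound w : `|l 0%N| <= 2 * r ^+ w.
  rewrite -(lE w) /l.
  have [h1 h2] := D_bound n w.
  have h3 : pi1 * r ^+ w <= r ^+ w by rewrite ler_piMl// exprn_ge0.
  have h4 : pi1 * r ^+ w.+1 <= r ^+ w.
    apply: le_trans h3; rewrite ler_wpM2l// exprS ler_piMl ?exprn_ge0//; exact: ltW.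
  have d0 := D_ge0 n false w.+1; have d1 := D_ge0 n true w.+1.
  have h5 : (1 - a) * D n false w.+1 <= D n false w.+1 by rewrite ler_piMl//; lra.
  have h6 : b * D n true w.+1 <= D n true w.+1 by rewrite ler_piMl//; lra.
  have h7 : 0 <= (1 - a) * D n false w.+1 by rewrite mulr_ge0//; lra.
  have h8 : 0 <= b * D n true w.+1 by rewrite mulr_ge0//; lra.
  by rewrite ler_norml; apply/andP; split; lra.
have := le_geometric_le0 r01 bound; rewrite normr_le0 => /eqP.
by rewrite -(lE v) /l => /eqP; rewrite subr_eq0 => /eqP.
Qed.

Let D_falseE n v : D n false v.+1 = r * D n true v.+1.
Proof.
have := a_ge0; have := b_ge0; have := ab_lt1 => hab hb ha.
by rewrite /r mulrAC -flux mulrAC mulfV ?mul1r//; apply/eqP; lra.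
Qed.

Let D_trueE n v : D n true v.+1 = pi1 * r ^+ v.
Proof.
elim: v => [|v IH].
  by rewrite D_true !D_0 pi1E pi0E expr0; move: pi1_eq; lra.
rewrite D_true D_falseE IH exprS -{1}rE; ring.
Qed.

Lemma markov_chain_finite_carrier :
  pr P (~` [set x : config | finite_carrier 0 x]) = 0.
Proof.
apply/eqP; rewrite eq_le pr_ge0 andbT; apply: (@le_geometric_le0 _ _ (1 + r) r) => // v.
apply: (@le_trans _ _ (D 0 true v.+1 + D 0 false v.+1)).
  rewrite /D -pr_coord; last by meas.
  by apply: le_pr; [by meas|by meas|move=> x /= h; apply: contrapT => h'; apply: h; exists v.+1].
rewrite D_falseE D_trueE.
have -> : pi1 * r ^+ v + r * (pi1 * r ^+ v) = pi1 * ((1 + r) * r ^+ v) by ring.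
by rewrite ler_piMl// mulr_ge0 ?exprn_ge0// addr_ge0.
Qed.

(* The probability of a load at least [v] at [n], given that [bbs x n = c]. *)
Definition load_tail (c : bool) (v : nat) : R :=
  if c then r ^+ v else if v is w.+1 then a / (1 - b) * r ^+ w else 1.

Let markov_all n C j : past_set (n - 1) C -> forall i,
  (forall x, C x -> x (n - 1) = i) ->
  pr P (C `&` [set x : config | x n = j]) = bernoulli_pmf (p i) j * pr P C.
Proof.
move=> pC i hi.
have E : C `&` [set x : config | x (n - 1) = i] = C by apply/setIidl => x /hi.
by rewrite -{2}E -markov// setIA E.
Qed.

(** Induction on the word. The hidden site [x (n - 1)] is known from [d] and the load there: by
    [bbs_coord] it equals [~~ d] when that load is positive, and it is vacant when the load is 0. On
    each of these two events the Markov property of [x] applies. For [v = 0] the lemma says that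
    words of [bbs x] and of [x] have the same law. *)
Let bbs_word_load n s c v :
  pr P ([set x : config | word (size s).+1 n (bbs x) = c :: s] `&` [set x : config | load_ge n v x])
  = load_tail c v * pr P [set x : config | word (size s).+1 n x = c :: s].
Proof.
have := a_ge0; have := b_ge0; have := ab_lt1 => hab hb ha.
have a1 : 1 - a != 0 by apply/eqP; lra.
have b1 : 1 - b != 0 by apply/eqP; lra.
have piE : a * (1 - pi1) / (1 - b) = pi1 by rewrite -pi1_eq mulfK.
elim: s n c v => [|d s IH] n c v.
  have t w : pr P ([set x : config | word 1 n (bbs x) = [:: true]] `&` [set x : config | load_ge n w x])
      = pi1 * r ^+ w.
    case: w => [|w].
      rewrite (_ : _ `&` _ = [set x : config | load_ge (n - 1) 1 x] `&` [set x : config | x n = false]).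
        rewrite markov_sum; last exact: past_set_load_ge.
        rewrite -!/(D (n - 1) _ 1) D_falseE D_trueE /bernoulli_pmf expr0.
        by rewrite -{1}rE; move: rE; nra.
      apply/seteqP; split=> x /=; rewrite /bbs.
        by case=> -[/andP[/negbTE -> /asboolP]].
      by case=> h ->; rewrite asboolT//; split=> //; exact: load_ge0.
    rewrite (_ : _ `&` _ = [set x : config | load_ge n w.+1 x] `&` [set x : config | x n = false]).
      by rewrite -/(D n false w.+1) D_falseE D_trueE exprS; ring.
    apply/seteqP; split=> x /=; rewrite /bbs.
      by case=> -[/andP[/negbTE -> /asboolP]].
    case=> h xn; rewrite xn asboolT//; move: h; rewrite (@load_ge_down n) ?xn//.
    exact: load_geW.
  case: c.
    by rewrite t /= mulrC; congr (_ * _); rewrite -(pi1E n); congr pr;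
       apply/seteqP; split=> x /=; [move=> ->|case].
  have E1 : [set x : config | word 1 n x = [:: false]] = [set x : config | x n = false].
    by apply/seteqP; split=> x /=; [case|move=> ->].
  rewrite /= E1 pi0E; case: v => [|v] /=.
    have -> : [set x : config | [:: bbs x n] = [:: false]] `&` [set x : config | load_ge n 0 x]
       = ~` ([set x : config | word 1 n (bbs x) = [:: true]] `&` [set x : config | load_ge n 0 x]).
      apply/seteqP; split=> x /=; first by case=> -[->] _ [].
      case: (bbs x n) => h; last by split=> //; exact: load_ge0.
      by case: h; split=> //; exact: load_ge0.
    rewrite prC ?t ?expr0 ?mulr1 ?mul1r//; apply: measurableI; last by meas.
    exact: (measurable_bbs_preimage (measurable_word1 1 n [:: true])).
  rewrite (_ : _ `&` _ = [set x : config | load_ge n v.+1 x] `&` [set x : config | x n = true]).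
    by rewrite -/(D n true v.+1) D_trueE -{1}piE; ring.
  apply/seteqP; split=> x /=; rewrite (bbs_coord n x).
    case=> -[->] h; rewrite asboolT//; exact: load_geW h.
  by case=> h /andP[/negbTE -> _].
set C := [set x : config | word (size s).+1 (n - 1) (bbs x) = d :: s].
have pC : past_set (n - 1) C.
  exact: (past_set_bbs (past_set_word1 (size s).+1 (n - 1) (d :: s))).
have mC := pC.1.
set mu := pr P [set x : config | word (size s).+1 (n - 1) x = d :: s].
have A w : pr P (C `&` [set x : config | load_ge (n - 1) w x]) = load_tail d w * mu by exact: IH.
have pCW w : past_set (n - 1) (C `&` [set x : config | load_ge (n - 1) w x]).
  by apply: past_setI => //; exact: past_set_load_ge.
have Mk w j : pr P (C `&` [set x : config | load_ge (n - 1) w.+1 x] `&` [set x : config | x n = j])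
    = bernoulli_pmf (p (~~ d)) j * (load_tail d w.+1 * mu).
  rewrite -A; apply: markov_all => // x [Cx Wx].
  rewrite bbs_coord asboolT; last exact: load_geW Wx.
  by case: Cx => -> _; rewrite andbT.
have Mk0 j : pr P (C `&` ~` [set x : config | load_ge (n - 1) 1 x] `&` [set x : config | x n = j])
    = bernoulli_pmf a j * (mu - load_tail d 1 * mu).
  have -> : mu - load_tail d 1 * mu = pr P (C `&` ~` [set x : config | load_ge (n - 1) 1 x]).
    rewrite -A; have := A 0%N.
    have -> : C `&` [set x : config | load_ge (n - 1) 0 x] = C.
      by apply/setIidl => x _; exact: load_ge0.
    have -> : load_tail d 0 = 1 by rewrite /load_tail; case: (d).
    rewrite mul1r => <-.
    by rewrite (pr_split P mC (measurable_load_ge (n - 1) 1)) addrAC subrr add0r.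
  apply: (@markov_all _ _ _ _ false).
    by apply: past_setI => //; apply: past_setC; exact: past_set_load_ge.
  by move=> x [_ nW]; rewrite bbs_coord asboolF// andbF.
have true_law w : pr P ([set x : config | word (size s).+2 n (bbs x) = [:: true, d & s]]
    `&` [set x : config | load_ge n w x]) = bernoulli_pmf (p (~~ d)) false * (load_tail d w.+1 * mu).
  rewrite -Mk; congr pr; apply/seteqP; split=> x.
    case=> -[]; rewrite {1}/bbs => /andP[/negbTE xn /asboolP h1] h2 h2' h3.
    split=> //; split; first by rewrite /C /= h2 h2'.
    by move: h3; case: (w) => // w'; rewrite /= (@load_ge_down n) ?xn.
  case=> -[Cx Wx] xn; split.
    rewrite /= {1}/bbs xn asboolT/=; last exact: load_geW Wx.
    by rewrite -Cx.
  move: Wx; case: (w) => [|w'] Wx; first exact: load_ge0.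
  by rewrite /= (@load_ge_down n) ?xn.
have muE : pr P [set x : config | word (size s).+2 n x = [:: c, d & s]] =
    bernoulli_pmf (p d) c * mu by exact: word_markov.
rewrite [RHS]/= muE; case: c {muE}.
  rewrite true_law; case: (d); rewrite /load_tail /bernoulli_pmf /=.
    by rewrite exprS -rE; ring.
  by field; lra.
case: v => [|v].
  have -> : [set x : config | word (size s).+2 n (bbs x) = [:: false, d & s]]
      `&` [set x : config | load_ge n 0 x] =
      C `&` ~` ([set x : config | word (size s).+2 n (bbs x) = [:: true, d & s]]
         `&` [set x : config | load_ge n 0 x]).
    apply/seteqP; split=> x; rewrite /C /=.
      by case=> -[-> -> ->] _; split=> // -[].
    case=> -[-> ->]; case: (bbs x n) => h; last by split=> //; exact: load_ge0.
    by case: h; split=> //; exact: load_ge0.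
  have mT : measurable ([set x : config | word (size s).+2 n (bbs x) = [:: true, d & s]]
         `&` [set x : config | load_ge n 0 x]).
    apply: measurableI; last by meas.
    exact: (measurable_bbs_preimage (measurable_word1 (size s).+2 n [:: true, d & s])).
  have := true_law 0%N; have := pr_split P mC mT.
  rewrite (_ : C `&` (_ `&` _) = [set x : config | word (size s).+2 n (bbs x) = [:: true, d & s]]
         `&` [set x : config | load_ge n 0 x]); last first.
    by apply/setIidr => x [] /= [_]; rewrite /C /= => -> ->.
  have := A 0%N.
  have -> : C `&` [set x : config | load_ge (n - 1) 0 x] = C.
    by apply/setIidl => x _; exact: load_ge0.
  move=> eA eS eT; move: eS; rewrite eT eA; case: (d); rewrite /load_tail /bernoulli_pmf /=.
    by rewrite !expr1 => h; have := rE; nra.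
  have -> : (1 - b) * (a / (1 - b) * r ^+ 0 * mu) = a * mu by rewrite expr0; field; lra.
  lra.
(* A positive load at a vacancy of [bbs x] means that [x n] is a particle, so the load before it was
   at least [v]. *)
have -> : [set x : config | word (size s).+2 n (bbs x) = [:: false, d & s]]
      `&` [set x : config | load_ge n v.+1 x] =
   C `&` [set x : config | load_ge (n - 1) v x] `&` [set x : config | x n = true].
  apply/seteqP; split=> x.
    case=> -[h1 h2 h2'] h3.
    have xn : x n by rewrite bbs_coord h1 asboolT//; exact: load_geW h3.
    split=> //; split; first by rewrite /C /= h2 h2'.
    by move: h3; rewrite /= (@load_ge_up n).
  case=> -[Cx Wx] xn; split; last by rewrite /= (@load_ge_up n).
  by rewrite /= {1}/bbs xn /= -Cx.
case: v => [|v].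
  have -> : C `&` [set x : config | load_ge (n - 1) 0 x] = C.
    by apply/setIidl => x _; exact: load_ge0.
  (* The load before the particle is arbitrary here, and a positive and an empty load leave
     different values of [x (n - 1)], hence different transition probabilities. *)
  rewrite (pr_split P _ (measurable_load_ge (n - 1) 1)); last by apply: measurableI => //; meas.
  rewrite setIAC Mk setIAC Mk0; case: (d); rewrite /load_tail /bernoulli_pmf /=.
    by rewrite expr0 expr1; field; lra.
  by rewrite expr0; field; lra.
rewrite Mk; case: (d); rewrite /load_tail /bernoulli_pmf /=.
  by field; lra.
by rewrite exprS -{1}rE; set k := a / (1 - b); ring.
Qed.

Lemma markov_chain_load n u v C : past_set n C ->
  pr P (bbs @^-1` (C `&` [set x : config | x n = u]) `&` [set x : config | load_ge n v x])
  = load_tail u v * pr P (C `&` [set x : config | x n = u]).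
Proof.
have := a_ge0; have := b_ge0; have := ab_lt1 => hab hb ha pC.
have := @past_pr_unique R _ config _ config P P bbs id
  (bbs @^-1` [set x : config | x n = u] `&` [set x : config | load_ge n v x])
  [set x : config | x n = u] (load_tail u v) (fun s => s <> [::]) n.
rewrite never_good_nil !preimage_set0 !set0I pr0 preimage_setI -setIA => H.
apply: (H _ _ _ _ _ _ erefl erefl C pC).
- exact: measurable_bbs.
- exact: measurable_id.
- apply: measurableI; last by meas.
  exact: (measurable_bbs_preimage (measurable_coordE n u)).
- by meas.
- rewrite /load_tail; case: (u); first exact: exprn_ge0.
  by case: (v) => // w; rewrite mulr_ge0 ?exprn_ge0 ?divr_ge0//; lra.
case=> // c s _.
have [<-|cu] := eqVneq c u.
  have E1 : [set x : config | word (size s).+1 n x = c :: s] `&` [set x : config | x n = c]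
      = [set x : config | word (size s).+1 n x = c :: s].
    by apply/setIidl => x [].
  by rewrite setIA -preimage_setI E1; exact: bbs_word_load.
rewrite [X in pr P X](_ : _ = set0) ?pr0; last first.
  by apply/seteqP; split=> // x [/= [h _] [h' _]]; move/eqP: cu; apply; rewrite -h h'.
rewrite [X in pr P X](_ : _ = set0) ?pr0 ?mulr0//.
by apply/seteqP; split=> // x [/= [h _] h']; move/eqP: cu; apply; rewrite -h h'.
Qed.

Lemma markov_chain_pitman :
  {ae P, forall x, pitman_defined R x} /\ ergodic P (pitman R).
Proof.
have := a_ge0; have := b_ge0; have := ab_lt1 => hab hb ha.
have ab0 : 0 <= a / (1 - b) by rewrite divr_ge0//; lra.
have ab1 : a / (1 - b) <= 1 by rewrite ler_pdivrMr; lra.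
pose phi (u : bool) (v : nat) := ~~ u && (0 < v)%N.
(* The values of [load_tail] at 1 are [b / (1 - a)] and [a / (1 - b)]. Both are at most [a + b]:
   after clearing denominators the differences are [a * (1 - a - b)] and [b * (1 - a - b)]. *)
pose eps := 1 - a - b.
have fin0 := markov_chain_finite_carrier.
have past_s n u : past_set n [set x : config | x n = u] by exact: past_set_coordE.
have s_inv n x : finite_carrier n x -> x n = phi (bbs x n) (carrier n x) by exact: bbs_inv.
have phi0 u : phi u 0 = false by rewrite /phi andbF.
have phi1 u v : phi u (minn v 1) = phi u v by rewrite /phi leq_min andbT.
have eps0 : 0 < eps by rewrite /eps; lra.
have Q0 u : load_tail u 0 = 1 by case: u.
have Q1 u : load_tail u 1 <= 1 - eps.
  rewrite /load_tail /eps; case: u.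
    by rewrite expr1 /r ler_pdivrMr; nra.
  by rewrite expr0 mulr1 ler_pdivrMr; nra.
have Qge0 u v : 0 <= load_tail u v.
  case: u => /=; first exact: exprn_ge0.
  by case: v => // w; rewrite mulr_ge0// exprn_ge0.
have Qanti u v : load_tail u v.+1 <= load_tail u v.
  case: u => /=; first by rewrite exprS ler_piMl ?exprn_ge0// ltW.
  case: v => [|w]; first by rewrite expr0 mulr1.
  by rewrite ler_wpM2l// exprS ler_piMl ?exprn_ge0// ltW.
apply: (@carrier_law_ergodic R P bool (fun n x => x n) phi false 1 load_tail eps) => //.
by move=> *; exact: markov_chain_load.
Qed.

End MarkovChain.

(** * Configurations with a bounded carrier *)

Definition zero_tail (m : nat) (s : seq bool) : Prop :=
  exists t, s = t ++ nseq m false.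

Definition run (u : nat) (s : seq bool) : nat :=
  foldr (fun b w => if b then w.+1 else w.-1) u s.

Lemma run_nseq_false u m : run u (nseq m false) = (u - m)%N.
Proof. by elim: m => [|m IH] /=; [lia|rewrite IH; lia]. Qed.

Lemma run_cat u s t : run u (s ++ t) = run (run u t) s.
Proof. by rewrite /run foldr_cat. Qed.

Lemma run_mono u v s : (u <= v)%N -> (run u s <= run v s)%N.
Proof. by move=> uv; elim: s => //= b s; case: b; lia. Qed.

Lemma carrier_run L n x : finite_carrier n x ->
  carrier n x = run (carrier (n - L%:Z) x) (word L n x).
Proof.
elim: L n => [|L IH] n f; first by rewrite subr0.
rewrite carrierE//= (_ : n - L.+1%:Z = n - 1 - L%:Z); last lia.
by rewrite -IH//; exact: (finite_carrierB1 n x).1 f.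
Qed.

Lemma carrier_zero_tail K n s x : finite_carrier n x ->
  (forall m, carrier m x <= K)%N ->
  word (size s + K) n x = s ++ nseq K false -> carrier n x = run 0 s.
Proof.
move=> f h E; rewrite (carrier_run (size s + K) f) E run_cat run_nseq_false.
by have := h (n - (size s + K)%N%:Z); rewrite -subn_eq0 => /eqP ->.
Qed.

(** By [carrier_inv] a particle of [bbs x] moves one unit from the load of [x] to that of [bbs x]. A
    vacancy can raise the sum only when the load of [bbs x] is 0, and there the bound on the carrier
    of [x] suffices. *)
Lemma window_load_bbs K L n x : finite_carrier n x -> (forall m, carrier m x <= K)%N ->
  (window_load L n (bbs x) + carrier n x <= K)%N.
Proof.
move=> f h; elim: L n f => [|L IH] n f; first exact: h.
have f1 := (finite_carrierB1 n x).1 f.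
have := IH _ f1; have := h n; rewrite /= (carrier_inv f).
move: (window_load L (n - 1) (bbs x)) (carrier n x) => w w'.
by case: (bbs x n) => /=; lia.
Qed.

Lemma bounded_bbs K x : finite_carrier 0 x -> (forall m, carrier m x <= K)%N ->
  finite_carrier 0 (bbs x) /\ (forall m, carrier m (bbs x) <= K)%N.
Proof.
move=> f h.
have H m : ~ load_ge m K.+1 (bbs x).
  move=> [L]; have fm := (finite_carrierE m 0 x).2 f.
  by have := window_load_bbs L fm h; lia.
split; first by exists K.+1.
move=> m; have fm : finite_carrier m (bbs x) by exists K.+1.
by rewrite leqNgt; apply/negP => /(carrierP _ fm); exact: H.
Qed.

Lemma word_add L L' n x : word (L + L') n x = word L n x ++ word L' (n - L%:Z) x.
Proof.
elim: L n => [|L IH] n; first by rewrite subr0.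
by rewrite addSn /= IH; congr (_ :: _ ++ word _ _ _); lia.
Qed.

(** In a block of [K + K] vacancies the left half empties the carrier, so [bbs] leaves the right
    half vacant. This is why blocks of double length are required of [x]. *)
Lemma never_good_bbs K n x : finite_carrier 0 x -> (forall m, carrier m x <= K)%N ->
  never_good (zero_tail K) n (bbs x) -> never_good (zero_tail (K + K)) n x.
Proof.
move=> f h [L0 hL0]; exists (L0 + K)%N => L hL [t E].
have sz := congr1 size E; rewrite size_word size_cat size_nseq in sz.
apply: (hL0 (L - K)%N); first lia.
exists (word (size t) n (bbs x)).
have -> : (L - K = size t + K)%N by lia.
rewrite word_add; congr (_ ++ _).
have := E; rewrite (_ : L = size t + (K + K))%N; last lia.
rewrite word_add; set m := n - (size t)%:Z.
move/eqP; rewrite eqseq_cat ?size_word// => /andP[_ /eqP].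
rewrite word_add nseqD => /eqP; rewrite eqseq_cat ?size_word ?size_nseq// => /andP[/eqP E1 /eqP E2].
have c0 : carrier (m - K%:Z) x = 0%N.
  have := @carrier_zero_tail K (m - K%:Z) [::] x; rewrite add0n /=; apply=> //.
  exact: (finite_carrierE _ 0 x).2.
have {}E1 i : (i < K)%N -> x (m - i%:Z) = false.
  by move=> iK; rewrite -(@nth_word K)// E1 nth_nseq iK.
have cz i : (i <= K)%N -> carrier (m - K%:Z + i%:Z) x = 0%N.
  elim: i => [|i IH] iK; first by rewrite addr0.
  rewrite carrierE; last exact: (finite_carrierE _ 0 x).2.
  rewrite (_ : m - K%:Z + i.+1%:Z - 1 = m - K%:Z + i%:Z); last lia.
  rewrite IH; last lia.
  by rewrite (_ : m - K%:Z + i.+1%:Z = m - (K - i.+1)%N%:Z) ?E1//; lia.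
apply: (@eq_from_nth _ false); rewrite size_word ?size_nseq// => i iK.
rewrite nth_word// nth_nseq iK bbsE; last exact: (finite_carrierE _ 0 x).2.
rewrite (_ : m - i%:Z - 1 = m - K%:Z + (K - i.+1)%N%:Z); last lia.
by rewrite cz ?andbF//; lia.
Qed.

Lemma leq_pred_addS u v m : (v < m)%N -> (u.-1 + v.+1 <= m)%N = (u + v <= m)%N.
Proof. by case: u => [|u] vm; lia. Qed.

Section ConditionedChain.
Context (R : realType) (P : probability config R) (p lam kappa : R) (K : nat).
Context (h : nat -> R) (N : set config).
Hypothesis p01 : 0 < p < 1.
Hypothesis lam_gt0 : 0 < lam.
Hypothesis h_gt0 : forall u, (u <= K)%N -> 0 < h u.
Hypothesis h_out : forall u, (K < u)%N -> h u = 0.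
Hypothesis h_rec : forall u, (u <= K)%N -> lam * h u = p * h u.+1 + (1 - p) * h u.-1.
Hypothesis mN : measurable N.
Hypothesis N0 : pr P N = 0.
Hypothesis boundedN : forall x, ~ N x ->
  finite_carrier 0 x /\ (forall n, carrier n x <= K)%N.

Definition doob_step (u : nat) (j : bool) : R :=
  (if j then p * h u.+1 else (1 - p) * h u.-1) / (lam * h u).

Hypothesis carrier_markov : forall n C u j, past_set (n - 1) C -> (u <= K)%N ->
  pr P (C `&` [set x : config | carrier (n - 1) x = u] `&` [set x : config | x n = j])
  = doob_step u j * pr P (C `&` [set x : config | carrier (n - 1) x = u]).
Local Notation c := (p / (1 - p)).
Hypothesis carrier_stat : forall n u,
  pr P [set x : config | carrier n x = u] = kappa * c ^+ u * h u ^+ 2.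
Hypothesis blocks : forall n, pr P (never_good (zero_tail (K + K)) n) = 0.

Let finN n x : ~ N x -> finite_carrier n x.
Proof. by move=> /boundedN[f _]; apply/(finite_carrierE n 0). Qed.

Let Kpos : 0 < h 0. Proof. exact: h_gt0. Qed.

Let part (j : nat) : R := \sum_(v < j) c ^+ v * h v.

Let partS j : part j.+1 = part j + c ^+ j * h j.
Proof. by rewrite /part big_ord_recr. Qed.

Let part_gt0 j : 0 < part j.+1.
Proof.
have /andP[p0 p1] := p01; have c0 : 0 < c by rewrite divr_gt0// subr_gt0.
have hge u : 0 <= h u by case: (leqP u K) => [/h_gt0/ltW//|/h_out ->].
elim: j => [|j IH]; first by rewrite /part big_ord1 expr0 mul1r.
by rewrite partS ltr_wpDr// mulr_ge0// exprn_ge0// ltW.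
Qed.

(** Summation of [h_rec] against [c ^+ v]: the relation [(1 - p) * c = p] turns the neighbour terms
    into shifted partial sums. *)
Let part_rec j : (j <= K)%N ->
  lam * part j.+1 = (1 - p) * part j.+2 + p * part j.
Proof.
have /andP[p0 p1] := p01.
have pE : (1 - p) * c = p by field; lra.
move: pE; rewrite /part; set k := c => pE.
elim: j => [_|j IH jK].
  have := h_rec (leq0n K); have := congr1 (fun z => z * h 1) pE.
  rewrite !big_ord_recl !big_ord0 /= expr0 expr1; lra.
have := IH (ltnW jK); rewrite !(big_ord_recr j.+2) !(big_ord_recr j.+1) !(big_ord_recr j) /=.
have e1 := congr1 (fun z => k ^+ j.+1 * z) (h_rec jK).
have e2 := congr1 (fun z => z * (k ^+ j.+1 * h j.+2)) pE.
have e3 := congr1 (fun z => z * (k ^+ j * h j)) pE.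
move: e1 e2 e3; rewrite /= [k ^+ j.+2]exprS [k ^+ j.+1]exprS.
move: (\sum_(v < j) _) (k ^+ j) (h j) (h j.+1) (h j.+2) => S X h1 h2 h3; lra.
Qed.

(** In the variable [u = K - j] the recursion of [part] is that of [h], with the same boundary
    condition at 0 because [h] vanishes at [K.+1]; so the two solutions are proportional. This
    identity normalises [q]. *)
Let h_part u : (u <= K)%N -> h u * part K.+1 = h 0 * part (K - u).+1.
Proof.
have /andP[p0 p1] := p01.
have E2 : part K.+2 = part K.+1 by rewrite partS h_out// mulr0 addr0.
suff H : (u <= K)%N -> h u * part K.+1 = h 0 * part (K - u).+1 /\
    ((u < K)%N -> h u.+1 * part K.+1 = h 0 * part (K - u.+1).+1) by move=> /H[].
have cancel a b : p * a = p * b -> a = b by apply: mulfI; apply/eqP; lra.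
elim: u => [_|u IH uK].
  rewrite subn0; split=> // K0; apply: cancel.
  rewrite (_ : (K - 1).+1 = K); last lia.
  have := congr1 (fun z => z * part K.+1) (h_rec (leq0n K)).
  have := congr1 (fun z => h 0 * z) (part_rec (leqnn K)).
  by rewrite E2 /=; lra.
have [e1 /(_ uK) e2] := IH (ltnW uK); split=> // uK'; apply: cancel.
have e3 := @part_rec (K - u.+1) (leq_subr _ _).
rewrite (_ : (K - u.+1).+2 = (K - u).+1) in e3; last lia.
rewrite [X in _ + p * part X](_ : (K - u.+1)%N = (K - u.+2).+1) in e3; last lia.
have := congr1 (fun z => z * part K.+1) (h_rec uK).
have := congr1 (fun z => h 0 * z) e3.
have := congr1 (fun z => lam * z) e2.
have := congr1 (fun z => (1 - p) * z) e1.
by rewrite /=; lra.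
Qed.

(* The law of the load [v] given the load [u] of the carrier of [bbs x]: that
   carrier and the time reversal of the original one stay below [K] together
   exactly when [u + v <= K]. *)
Let q (u v : nat) : R :=
  if (u + v <= K)%N then h 0 * (c ^+ v * h v) / (h u * part K.+1) else 0.

Let q_sum u : (u <= K)%N -> \sum_(v < K.+1) q u v = 1.
Proof.
move=> uK.
rewrite -(big_mkord predT (fun v => q u v)) (@big_cat_nat _ _ _ (K - u).+1)//=; last lia.
rewrite [X in _ + X]big_nat_cond [X in _ + X]big1 ?addr0; last first.
  move=> v /andP[/andP[h1 h2] _]; rewrite /q; case: leqP => //; lia.
rewrite big_mkord (eq_bigr (fun v : 'I_ _ => h 0 / (h u * part K.+1) * (c ^+ v * h v))).
  rewrite -mulr_sumr -/(part (K - u).+1) mulrAC -h_part// mulfV//.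
  by rewrite mulf_neq0 ?gt_eqF// h_gt0.
by move=> v _; rewrite /q (_ : (u + v <= K)%N); [ring|have := ltn_ord v; lia].
Qed.

Let X := (1 - p) / lam.

Let ae A B : measurable A -> measurable B -> (forall x, ~ N x -> A x <-> B x) ->
  pr P A = pr P B.
Proof. by move=> mA mB; exact: (pr_ae_eq mA mB mN N0). Qed.

(** The inverse local rule turns data on the right of site [n] into data on its left and the site
    itself, where [carrier_markov] applies. *)
Let step_law C n j v : past_set (n - 1) C ->
  pr P (C `&` ([set x : config | bbs x n = j] `&` [set x : config | carrier n x = v]))
  = pr P (C `&` [set x : config | carrier (n - 1) x = if j then v.+1 else v.-1]
      `&` [set x : config | x n = ~~ j && (0 < v)%N]).
Proof.
move=> [mC _]; have mb := measurable_bbs_preimage (measurable_coordE n j).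
apply: ae.
- apply: measurableI => //; apply: measurableI; [exact: mb|by meas].
- by apply: measurableI; [apply: measurableI => //|]; meas.
move=> x /(finN n) f /=; split.
  case=> Cx [<- <-]; split; last exact: bbs_inv.
  by split=> //; exact: carrier_inv.
case=> -[Cx h1] h2; split=> //.
have : bbs x n = j /\ carrier n x = v; last by [].
rewrite carrierE// bbsE// h2 h1.
by clear; case: j => //; case: v => //.
Qed.

Let carrier_big n v : (K < v)%N -> pr P [set x : config | carrier n x = v] = 0.
Proof.
move=> Kv; apply: (pr_null _ mN N0); first by meas.
move=> x /= h1; apply: contrapT => /boundedN[_ /(_ n)]; lia.
Qed.

Let zero_word n (m : nat) := [set x : config | word m n x = nseq m false].

(** Where [bbs x] is vacant, the load falls by one per site to the left until it is 0, and [v <= m]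
    makes this happen within the window. So a single path contributes: an idle empty carrier, then
    [v] particles. The factors [h] telescope; each site gives [X], and each particle in addition
    [c]. *)
Let bbs_zero_word m n v : (v <= m)%N -> (v <= K)%N ->
  pr P (bbs @^-1` zero_word n m `&` [set x : config | carrier n x = v])
  = kappa * h 0 * h v * X ^+ m * c ^+ v.
Proof.
have /andP[p0 p1] := p01; have l0 := lam_gt0.
have mz k i : past_set i (bbs @^-1` zero_word i k).
  by apply: past_set_bbs; exact: past_set_word1.
elim: m n v => [|m IH] n v.
  rewrite leqn0 => /eqP -> _.
  rewrite (_ : _ `&` _ = [set x : config | carrier n x = 0%N]).
    by rewrite carrier_stat !expr0; ring.
  by apply/seteqP; split=> x //= [].
move=> vm vK.
have -> : bbs @^-1` zero_word n m.+1 `&` [set x : config | carrier n x = v] =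
   bbs @^-1` zero_word (n - 1) m `&`
     ([set x : config | bbs x n = false] `&` [set x : config | carrier n x = v]).
  apply/seteqP; split=> x; rewrite /zero_word /=.
    by case=> -[-> ->] ->.
  by case=> -> [-> ->].
rewrite step_law// carrier_markov//; last lia.
rewrite IH; [|lia|lia].
have h0 := Kpos; have l0' : lam != 0 by lra.
have h00 : h 0 != 0 by lra.
have pp : 1 - p != 0 by lra.
case: v vm vK => [|v] vm vK /=.
  rewrite /doob_step /= exprS expr0; set Y := X ^+ m; rewrite /X.
  by field; rewrite ?l0' ?h00.
have hv : h v != 0 by rewrite gt_eqF// h_gt0// ltnW.
rewrite /doob_step /= !exprS; set Y := X ^+ m; set Y' := _ ^+ v; rewrite /X.
by field; rewrite ?l0' ?hv ?pp.
Qed.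

Let zero_word_carrier m n u : (u <= K)%N ->
  pr P ([set x : config | carrier (n - m%:Z) x = u] `&` zero_word n m)
  = kappa * c ^+ u * h u * h (u - m) * X ^+ m.
Proof.
have l0 := lam_gt0.
move=> uK; elim: m n => [|m IH] n.
  rewrite (_ : _ `&` _ = [set x : config | carrier n x = u]).
    by rewrite carrier_stat subn0 expr0; ring.
  by rewrite subr0; apply/seteqP; split=> x //= [].
set C := [set x : config | carrier (n - 1 - m%:Z) x = u] `&` zero_word (n - 1) m.
have pC : past_set (n - 1) C.
  apply: past_setI; last exact: past_set_word1.
  by apply: (@past_setW _ (n - 1 - m%:Z)); [lia|exact: past_set_carrier].
have run_C x : ~ N x -> C x -> carrier (n - 1) x = (u - m)%N.
  move=> /(finN (n - 1)) f [/= h1 h2].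
  by rewrite (carrier_run m f) h1 h2 run_nseq_false.
have CE : pr P (C `&` [set x : config | carrier (n - 1) x = (u - m)%N]) = pr P C.
  apply: ae; [by apply: measurableI; [exact: pC.1|meas]|exact: pC.1|].
  by move=> x Nx; split=> [[]//|Cx]; split=> //; exact: run_C.
have um : (u - m <= K)%N by lia.
have := @carrier_markov n C (u - m) false pC um.
rewrite CE /C IH => E.
transitivity (pr P (C `&` [set x : config | carrier (n - 1) x = (u - m)%N]
   `&` [set x : config | x n = false])).
  apply: ae.
  - by apply: measurableI; [meas|exact: measurable_word1].
  - by apply: measurableI; [apply: measurableI; [exact: pC.1|]|]; meas.
  move=> x Nx; rewrite /C /zero_word /= (_ : n - m.+1%:Z = n - 1 - m%:Z); last lia.
  split; last by case=> -[[-> ->] _] ->.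
  case=> h1 [h2 h3]; split=> //; split=> //; apply: run_C => //.
rewrite E /doob_step /= (_ : (u - m).-1 = (u - m.+1)%N); last lia.
have hum : h (u - m) != 0 by rewrite gt_eqF// h_gt0.
rewrite exprS; set Y := X ^+ m; set Y' := _ ^+ u; rewrite /X.
by field; rewrite ?hum; lra.
Qed.

Let partition A (n : int) : measurable A ->
  pr P A = \sum_(u < K.+1) pr P (A `&` [set x : config | carrier n x = u]).
Proof.
move=> mA; rewrite -pr_sum.
- apply: ae => //.
    apply: countable_bigcupT_measurable => [|u]; first exact: countableP.
    by apply: measurableI => //; meas.
  move=> x Nx; split; last by case=> u _ [].
  have [_ /(_ n)] := boundedN Nx; rewrite -ltnS => hK Ax.
  by exists (Ordinal hK).
- by move=> u; apply: measurableI => //; meas.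
- move=> u v uv; apply/seteqP; split=> // x [[_ /= h1] [_ /= h2]].
  by move/eqP: uv; apply; apply: val_inj; rewrite /= -h1 -h2.
Qed.

(** [K] vacancies empty every load up to [K], so [h (u - K)] is [h 0] whatever the initial load, and
    summing over that load gives [part K.+1]. *)
Let zero_word_pr n : pr P (zero_word n K) = kappa * h 0 * X ^+ K * part K.+1.
Proof.
rewrite (partition (n - K%:Z)); last exact: measurable_word1.
rewrite /part mulr_sumr; apply: eq_bigr => u _.
have uK := ltn_ord u; rewrite setIC zero_word_carrier//.
by rewrite (_ : (u - K)%N = 0%N); [ring|lia].
Qed.

(** Invariance in local form, for the passage of one site by both carriers: the load law [q] on the
    left followed by a step of [x] equals a step of [bbs x] followed by the load law on the
    right. *)
Let q_step u v b : (u <= K)%N -> ((if b then v.+1 else v.-1) <= K)%N ->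
  doob_step (if b then v.+1 else v.-1) (~~ b && (0 < v)%N)
    * q u (if b then v.+1 else v.-1)
  = q (if b then u.+1 else u.-1) v * doob_step u b.
Proof.
have /andP[p0 p1] := p01; have l0 := lam_gt0 => uK vK.
have l0' : lam != 0 by lra.
have pp : 1 - p != 0 by lra.
have h0 := Kpos; have h00 : h 0 != 0 by lra.
have Z0 : part K.+1 != 0 by rewrite gt_eqF.
have hu : h u != 0 by rewrite gt_eqF// h_gt0.
case: b vK => /= vK.
  rewrite /q addSn addnS; case: ifP => uvK; last by rewrite mulr0 mul0r.
  have hv : h v.+1 != 0 by rewrite gt_eqF// h_gt0.
  have hu1 : h u.+1 != 0.
    by rewrite gt_eqF// h_gt0// (leq_ltn_trans (leq_addr v u)).
  rewrite /doob_step /= exprS; set Y := _ ^+ v.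
  by field; rewrite ?l0' ?hv ?pp ?hu ?hu1 ?Z0.
have u1K := leq_trans (leq_pred u) uK.
have hu1 : h u.-1 != 0 by rewrite gt_eqF// h_gt0.
case: v vK => [|v] /= vK.
  rewrite /q !addn0 uK u1K.
  by rewrite /doob_step /= expr0; field; rewrite ?l0' ?h00 ?hu ?hu1 ?Z0.
have hv : h v != 0 by rewrite gt_eqF// h_gt0.
(* If the new load [v.+1] exceeds [K], both sides vanish: the left by [h v.+1 = 0], the right by the
   support of [q]. *)
have [Kv|vK1] := leqP K v.
  by rewrite {1}/doob_step h_out// mulr0 mul0r mul0r /q addnS ltnNge (leq_trans Kv (leq_addl _ _)) mul0r.
rewrite /q leq_pred_addS//.
case: ifP => uvK; last by rewrite mulr0 mul0r.
rewrite /doob_step /= exprS; set Y := _ ^+ v.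
by field; rewrite ?l0' ?hv ?pp ?hu ?hu1 ?Z0.
Qed.

(* A block of [K] zeros empties any carrier bounded by [K], so on these events
   the carrier of [bbs x] is known and the two laws can be compared. *)
Let tail_word (n : int) (s : seq bool) : set config :=
  [set x | word (size s + K) n x = s ++ nseq K false].

Let past_tail_word n s : past_set n (tail_word n s).
Proof. exact: past_set_word1. Qed.

Let q_out u v : (K < v)%N -> q u v = 0.
Proof. by move=> Kv; rewrite /q ifF//; lia. Qed.

Let tail_word_run n s x : ~ N x -> tail_word n s x -> carrier n x = run 0 s.
Proof.
move=> Nx E; have [_ bd] := boundedN Nx.
exact: carrier_zero_tail (finN n Nx) bd E.
Qed.

Let tail_word_carrier n s :
  pr P (tail_word n s `&` [set x : config | carrier n x = run 0 s]) = pr P (tail_word n s).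
Proof.
have mT := (past_tail_word n s).1.
apply: ae => //; first by apply: measurableI => //; meas.
by move=> x Nx; split=> [[]//|h1]; split=> //; exact: tail_word_run.
Qed.

(** On the bare block the load law is the quotient of [bbs_zero_word] by [zero_word_pr], which is
    [q 0]; each further site costs one [q_step]. If a load passes [K], both sides are 0. *)
Let bbs_tail_word n s v :
  pr P (bbs @^-1` tail_word n s `&` [set x : config | carrier n x = v])
  = q (run 0 s) v * pr P (tail_word n s).
Proof.
have mb i t : measurable (bbs @^-1` tail_word i t).
  exact: (measurable_bbs_preimage (past_tail_word i t).1).
have [Kv|vK] := ltnP K v.
  rewrite q_out// mul0r; apply: pr_null (carrier_big n Kv) _; first 2 [by meas].
  - by apply: measurableI; [exact: mb|meas].
  - by move=> x [].
elim: s n v vK => [|b s IH] n v vK.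
  rewrite -[tail_word n [::]]/(zero_word n K) bbs_zero_word//.
  rewrite zero_word_pr /q /= add0n vK.
  have h00 : h 0 != 0 by have := Kpos => h0; lra.
  have Z0 : part K.+1 != 0 by rewrite gt_eqF.
  by set Y := _ ^+ v; set Y' := _ ^+ K; field; rewrite ?h00 ?Z0.
have wordE i x : tail_word i (b :: s) x <-> x i = b /\ tail_word (i - 1) s x.
  by rewrite /tail_word /=; split=> [[-> ->]//|[-> ->]].
have -> : bbs @^-1` tail_word n (b :: s) `&` [set x : config | carrier n x = v]
   = bbs @^-1` tail_word (n - 1) s
     `&` ([set x : config | bbs x n = b] `&` [set x : config | carrier n x = v]).
  apply/seteqP; split=> x; first by case=> /wordE [h1 h2] h3; split.
  by case=> h1 [h2 h3]; split=> //; apply/wordE.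
rewrite step_law; last exact: past_set_bbs.
have [uK|Ku] := leqP (run 0 s) K; last first.
  have T0 : pr P (tail_word (n - 1) s) = 0.
    rewrite -(tail_word_carrier (n - 1) s); apply: pr_null (carrier_big (n - 1) Ku) _.
    - by apply: measurableI; [exact: (past_tail_word _ _).1|meas].
    - by meas.
    - by move=> x [].
  rewrite (_ : pr P (tail_word n (b :: s)) = 0) ?mulr0; last first.
    apply: pr_null T0 _; [exact: (past_tail_word _ _).1|exact: (past_tail_word _ _).1|].
    by move=> x /wordE [].
  have [w'K|Kw'] := leqP (if b then v.+1 else v.-1) K.
    by rewrite carrier_markov ?IH ?T0 ?mulr0//; exact: past_set_bbs.
  apply: pr_null (carrier_big (n - 1) Kw') _.
  - by apply: measurableI; [apply: measurableI; [exact: mb|]|]; meas.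
  - by meas.
  - by move=> x [[]].
have TE : pr P (tail_word n (b :: s)) = doob_step (run 0 s) b * pr P (tail_word (n - 1) s).
  rewrite -(tail_word_carrier (n - 1) s) -carrier_markov//.
  have mT := (past_tail_word (n - 1) s).1.
  apply: ae.
  - exact: (past_tail_word _ _).1.
  - by apply: measurableI; [apply: measurableI => //|]; meas.
  move=> x Nx; rewrite wordE; split; last by case=> -[].
  by case=> h1 h2; split=> //; split=> //; exact: tail_word_run.
rewrite TE mulrA; have [w'K|Kw'] := leqP (if b then v.+1 else v.-1) K.
  rewrite carrier_markov; [|exact: past_set_bbs|by []].
  by rewrite IH// mulrA q_step//; case: (b).
rewrite (pr_null _ _ (carrier_big (n - 1) Kw')).
- rewrite /= /q ifF ?mul0r//; case: (b) Kw'; lia.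
- by apply: measurableI; [apply: measurableI; [exact: mb|]|]; meas.
- by meas.
- by move=> x [[]].
Qed.

Let never_good_K n : pr P (never_good (zero_tail K) n) = 0.
Proof.
apply: pr_null (blocks n) _; try exact: measurable_never_good.
move=> x [L0 H]; exists L0 => L hL [t E]; apply: (H L hL).
by exists (t ++ nseq K false); rewrite E nseqD catA.
Qed.

Let h_ge0 u : 0 <= h u.
Proof. by case: (leqP u K) => [/h_gt0/ltW|/h_out ->]. Qed.

Let c_ge0 : 0 <= c.
Proof. by have /andP[p0 p1] := p01; rewrite divr_ge0 ?subr_ge0// ltW. Qed.

Let q_ge0 u v : 0 <= q u v.
Proof.
rewrite /q; case: ifP => // _.
rewrite divr_ge0 ?mulr_ge0 ?exprn_ge0 ?h_ge0 ?c_ge0//.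
exact: ltW (part_gt0 K).
Qed.

(** Words ending in [K] vacancies suffice because almost surely both [x] and [bbs x] have such words
    of arbitrary length; for [bbs x] this comes from the blocks of length [K + K] in [x]. *)
Let carrier_eq_law n C u v : past_set n C ->
  pr P (bbs @^-1` (C `&` [set x : config | carrier n x = u]) `&` [set x : config | carrier n x = v])
  = q u v * pr P (C `&` [set x : config | carrier n x = u]).
Proof.
move=> pC.
have mbu : measurable (bbs @^-1` [set x : config | carrier n x = u]).
  exact: (measurable_bbs_preimage (measurable_carrier n u)).
have mA : measurable (bbs @^-1` [set x : config | carrier n x = u]
    `&` [set x : config | carrier n x = v]) by apply: measurableI => //; meas.
have H := @past_pr_unique R _ config _ config P P bbs id _
  [set x : config | carrier n x = u] (q u v) (zero_tail K) n
  measurable_bbs (@measurable_id _ _ _) mA (measurable_carrier n u) (q_ge0 u v).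
rewrite preimage_setI -setIA; apply: H pC.
- move=> _ [t ->]; rewrite size_cat size_nseq -/(tail_word n t) preimage_id.
  have mT := (past_tail_word n t).1; have mbT := measurable_bbs_preimage mT.
  have run_bbs x : ~ N x -> tail_word n t (bbs x) -> carrier n (bbs x) = run 0 t.
    move=> /boundedN[f bd] E; have [f' bd'] := bounded_bbs f bd.
    by apply: carrier_zero_tail bd' E; apply/(finite_carrierE n 0).
  have [E|E] := eqVneq (run 0 t) u.
    rewrite -E tail_word_carrier -bbs_tail_word; apply: ae.
    + by apply: measurableI; [exact: mbT|rewrite E; exact: mA].
    + by apply: measurableI; [exact: mbT|meas].
    by move=> x Nx; split=> [[h1 []]//|[h1 h2]]; split=> //; split=> //; exact: run_bbs.
  rewrite (pr_null _ mN N0); first rewrite (pr_null _ mN N0) ?mulr0//.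
  + by apply: measurableI => //; meas.
  + move=> x [h1 /= h2]; apply: contrapT => Nx; move/eqP: E; apply.
    by rewrite -h2; apply/esym; exact: tail_word_run.
  + by apply: measurableI; [exact: mbT|exact: mA].
  + move=> x [h1 [/= h2 _]]; apply: contrapT => Nx; move/eqP: E; apply.
    by rewrite -h2; apply/esym; exact: run_bbs.
- have NN : pr P (N `|` never_good (zero_tail (K + K)) n) = 0.
    by apply: pr_nullU (blocks n) => //; exact: measurable_never_good.
  apply: pr_null NN _.
  + apply: measurableI => //.
    exact: (measurable_bbs_preimage (measurable_never_good _ _)).
  + by apply: measurableU => //; exact: measurable_never_good.
  + move=> x [h1 _]; have [Nx|Nx] := pselect (N x); [by left|right].
    by have [f bd] := boundedN Nx; exact: never_good_bbs h1.
- apply: pr_null (never_good_K n) _.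
  + by apply: measurableI; [exact: measurable_never_good|meas].
  + exact: measurable_never_good.
  + by move=> x [].
Qed.

Let state (n : int) (x : config) : 'I_K.+1 := inord (minn (carrier n x) K).

Let stateE n x (u : 'I_K.+1) : ~ N x -> state n x = u <-> carrier n x = u.
Proof.
move=> /boundedN[_ /(_ n) h1]; rewrite /state (minn_idPl h1); split=> [<-|->].
  by rewrite inordK.
exact: inord_val.
Qed.

Let past_state n u : past_set n [set x : config | state n x = u].
Proof.
split; last by move=> x y e; rewrite /state /= (past_eq_carrier e).
rewrite (_ : mkset _ = \bigcup_(w : nat) [set x : config | inord (minn w K) = u /\ carrier n x = w]).
  apply: bigcupT_measurable => w.
  have [E|E] := pselect (inord (minn w K) = u).
    rewrite (_ : mkset _ = [set x : config | carrier n x = w]); first by meas.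
    by apply/seteqP; split=> x /= => [[]|].
  by rewrite (_ : mkset _ = set0)//; apply/seteqP; split=> x //= [].
apply/seteqP; split=> x /=; first by move=> h1; exists (carrier n x).
by case=> w _ [h1 h2]; rewrite /state h2.
Qed.

Let tail (u : 'I_K.+1) (v : nat) : R := \sum_(w < K.+1 | (v <= w)%N) q u w.

Let state_law n u v C : past_set n C ->
  pr P (bbs @^-1` (C `&` [set x : config | state n x = u]) `&` [set x : config | load_ge n v x])
  = tail u v * pr P (C `&` [set x : config | state n x = u]).
Proof.
move=> pC; have pS := past_setI pC (past_state n u).
have pS' := past_setI pC (past_set_carrier n u).
have mb := measurable_bbs_preimage pS.1.
have mb' := measurable_bbs_preimage pS'.1.
have -> : pr P (C `&` [set x : config | state n x = u])
    = pr P (C `&` [set x : config | carrier n x = u]).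
  apply: ae; [exact: pS.1|exact: pS'.1|move=> x Nx].
  by split=> -[h1 /(stateE n u Nx) h2].
rewrite /tail mulr_suml (partition n); last by apply: measurableI; [exact: mb|meas].
rewrite [RHS]big_mkcond; apply: eq_bigr => w _; case: ifP => vw.
  rewrite -carrier_eq_law//; apply: ae.
  - by apply: measurableI; [apply: measurableI; [exact: mb|]|]; meas.
  - by apply: measurableI; [exact: mb'|meas].
  move=> x Nx; have [f bd] := boundedN Nx; have [f' bd'] := bounded_bbs f bd.
  have S' : state n (bbs x) = u <-> carrier n (bbs x) = u.
    rewrite /state (minn_idPl (bd' n)); split=> [<-|->]; first by rewrite inordK// ltnS.
    exact: inord_val.
  split=> /=; first by case=> -[[h1 /S' h2] _] h3.
  case=> -[h1 /S' h2] h3; do !split=> //.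
  by apply/(carrierP _ (finN n Nx)); rewrite h3.
apply: (pr_null _ mN N0).
- by apply: measurableI; [apply: measurableI; [exact: mb|]|]; meas.
move=> x [[_ /= h1] /= h2]; apply: contrapT => Nx.
by move: h1; rewrite (carrierP _ (finN n Nx)) h2 vw.
Qed.

Lemma conditioned_chain_pitman :
  {ae P, forall x, pitman_defined R x} /\ ergodic P (pitman R).
Proof.
pose phi (u : 'I_K.+1) (v : nat) : 'I_K.+1 := inord (minn v K).
pose M := \sum_(u < K.+1) h u.
(* [q u 0] is [h 0 * h 0 / (h u * part K.+1)], and [h u] is at most the sum [M]. *)
pose eps := h 0 * h 0 / (M * part K.+1).
have h0 := Kpos; have Z0 := part_gt0 K.
have hM u : (u <= K)%N -> h u <= M.
  move=> uK; have uK' : (u < K.+1)%N by [].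
  rewrite /M (bigD1 (Ordinal uK'))//= lerDl; apply: sumr_ge0 => i _; exact: h_ge0.
have M0 : 0 < M by apply: lt_le_trans h0 _; exact: hM.
have tail0 u : tail u 0 = 1.
  exact: q_sum (ltnSE (ltn_ord u)).
apply: (@carrier_law_ergodic R P 'I_K.+1 state phi (inord 0) K tail eps) => //.
- apply: (pr_null _ mN N0); first by meas.
  by move=> x /= nf; apply: contrapT => /boundedN[].
- by move=> u; rewrite /phi min0n.
- by move=> u v; rewrite /phi -minnA minnn.
- by rewrite /eps divr_gt0// mulr_gt0.
- move=> u; rewrite -(tail0 u) /tail [X in _ <= X - _](bigD1 ord0)//=.
  rewrite [X in _ <= _ + X - _](eq_bigl (fun w : 'I_K.+1 => (1 <= w)%N)); last first.
    by move=> w; rewrite lt0n.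
  have : eps <= q u 0; last by lra.
  have uK := ltnSE (ltn_ord u).
  rewrite /q addn0 uK expr0 mul1r /eps; apply: ler_wpM2l; first by rewrite mulr_ge0// ltW.
  rewrite lef_pV2 ?posrE ?mulr_gt0 ?h_gt0//; apply: ler_wpM2r; first exact: ltW.
  exact: hM.
- by move=> u v; apply: sumr_ge0.
- move=> u v; rewrite /tail [leLHS]big_mkcond [leRHS]big_mkcond.
  apply: ler_sum => w _; case: ifP => h1; case: ifP => h2 //.
  by rewrite (ltnW h1) in h2.
Qed.

End ConditionedChain.

(** * The conditioned configuration *)

Lemma pr_null_countable d (T : measurableType d) (R : realType) (P : probability T R)
    (I : countType) (F : I -> set T) :
  (forall i, measurable (F i)) -> (forall i, pr P (F i) = 0) ->
  measurable (\bigcup_i F i) /\ pr P (\bigcup_i F i) = 0.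
Proof.
move=> mF F0; have mU : measurable (\bigcup_i F i).
  by apply: countable_bigcupT_measurable => //; exact: countableP.
split=> //; pose G k := if unpickle k is Some i then F i else set0.
have mG k : measurable (G k) by rewrite /G; case: unpickle.
have -> : \bigcup_i F i = \bigcup_k G k.
  apply/seteqP; split=> x; first by case=> i _ Fi; exists (pickle i) => //; rewrite /G pickleK.
  by case=> k _; rewrite /G; case: unpickle => // i Fi; exists i.
have G0 k : P (G k) = 0%E.
  by rewrite prE// /G; case: unpickle => [i|]; rewrite ?F0// pr0.
have mG' : measurable (\bigcup_k G k) by exact: bigcupT_measurable.
have /negligibleP : P.-negligible (\bigcup_k G k).
  by apply: negligible_bigcup => k; apply/negligibleP => //; exact: G0.
by move=> /(_ mG') E; rewrite /pr -[RHS]/(fine 0%E); congr fine; exact: E.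
Qed.

(** * The eigenvector as a function of the load *)

Section WalkMatrix.
Context (R : realType) (p : R) (K : nat) (lam : R) (h : 'cV[R]_K.+1).
Hypothesis eig : walk_mx p K *m h = lam *: h.

(** The value 0 beyond [K] absorbs the truncation of the walk, and [u.-1] covers the loop at 0, so
    the eigenvector equation becomes one recursion for all loads up to [K]. *)
Definition vec_nat (u : nat) : R := if (u < K.+1)%N then h (inord u) ord0 else 0.

Lemma walkE x y : walk p x y = p * (y == x.+1)%:R + (1 - p) * (y == x.-1)%:R.
Proof.
rewrite /walk; have [->|yx] := eqVneq y x.+1.
  by rewrite (_ : (x.+1 == x.-1) = false) ?mulr1 ?mulr0 ?addr0//; lia.
rewrite mulr0 add0r (_ : (x == y.+1) || (x == 0%N) && (y == 0%N) = (y == x.-1)).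
  by case: eqP => _; rewrite ?mulr1 ?mulr0.
by move/eqP: yx; lia.
Qed.

Lemma vec_natE (x : 'I_K.+1) : vec_nat x = h x ord0.
Proof. by rewrite /vec_nat ltn_ord inord_val. Qed.

Let sum_delta m : \sum_(y < K.+1) (y == m :> nat)%:R * vec_nat y = vec_nat m.
Proof.
rewrite {2}/vec_nat; case: ifP => mK.
  rewrite (bigD1 (Ordinal mK))//= eqxx mul1r big1 ?addr0.
    by rewrite /vec_nat mK.
  move=> y; rewrite -val_eqE /= => /negbTE ->; by rewrite mul0r.
rewrite big1// => y _; rewrite (_ : (y == m :> nat) = false) ?mul0r//.
by apply/eqP => ym; rewrite -ym ltn_ord in mK.
Qed.

Lemma vec_nat_rec u : (u <= K)%N ->
  lam * vec_nat u = p * vec_nat u.+1 + (1 - p) * vec_nat u.-1.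
Proof.
move=> uK; have uK' : (u < K.+1)%N by [].
have := congr1 (fun M : 'cV[R]_K.+1 => M (Ordinal uK') ord0) eig.
rewrite !mxE -vec_natE /= => <-.
rewrite -(sum_delta u.+1) -(sum_delta u.-1) !mulr_sumr -big_split /=.
by apply: eq_bigr => y _; rewrite mxE walkE -vec_natE /=; ring.
Qed.

End WalkMatrix.

(** * The stationary chain as the carrier of the configuration *)

Section Conditioned.
Context (R : realType) d (Omega : measurableType d) (Prob : probability Omega R).
Context (eta : {mfun Omega >-> config}) (p : R) (K : nat) (lam : R).
Context (h : 'cV[R]_K.+1) (W : int -> Omega -> 'I_K.+1).
Hypothesis p01 : 0 < p < 1.
Hypothesis lam_gt0 : 0 < lam.
Hypothesis h_gt0 : forall x, 0 < h x ord0.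
Hypothesis eig : walk_mx p K *m h = lam *: h.
Hypothesis W_chain : stationary_markov_chain Prob (doob_transform p lam h) W.
Hypothesis etaE : forall n w, eta w n = (W n w == (W (n - 1) w).+1 :> nat).

Local Notation hn := (vec_nat h).
Local Notation Q := (doob_step p lam hn).

Let hn_gt0 u : (u <= K)%N -> 0 < hn u.
Proof. by move=> uK; rewrite /vec_nat ltnS uK h_gt0. Qed.

Let hn_out u : (K < u)%N -> hn u = 0.
Proof. by move=> Ku; rewrite /vec_nat ltnS leqNgt Ku. Qed.

Let mW n s : measurable (W n @^-1` [set s]).
Proof. by case: W_chain. Qed.

Let mWn n u : measurable [set w | W n w = u :> nat].
Proof.
rewrite (_ : mkset _ = \bigcup_s [set w | W n w = s /\ s = u :> nat]).
  apply: countable_bigcupT_measurable => [|s]; first exact: countableP.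
  have [su|su] := pselect (s = u :> nat).
    rewrite (_ : mkset _ = W n @^-1` [set s])//.
    by apply/seteqP; split=> w /= => [[]|].
  by rewrite (_ : mkset _ = set0)//; apply/seteqP; split=> w //= [].
apply/seteqP; split=> w /=; first by move=> h1; exists (W n w).
by case=> s _ [->].
Qed.

Let mtraj m n s : measurable (trajectory W m n s).
Proof.
elim: n => [|n IH].
  rewrite (_ : trajectory _ _ _ _ = W (m + 0%:Z) @^-1` [set s 0%N])//.
  apply/seteqP; split=> w /=; first exact.
  by move=> h1 [|i].
rewrite (_ : trajectory _ _ _ _ = trajectory W m n s `&` W (m + n.+1%:Z) @^-1` [set s n.+1]).
  exact: measurableI.
apply/seteqP; split=> w /=.
  by move=> h1; split=> [i iN|]; apply: h1 => //; exact: leqW.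
case=> h1 h2 i; rewrite leq_eqVlt => /orP[/eqP ->//|]; exact: h1.
Qed.

Let traj_step m n s : pr Prob (trajectory W m n.+1 s)
  = pr Prob (trajectory W m n s) * doob_transform p lam h (s n) (s n.+1).
Proof.
by case: W_chain => _ H _; rewrite /pr H prE//= /pr.
Qed.

Let traj_stat m k n s : pr Prob (trajectory W m n s) = pr Prob (trajectory W k n s).
Proof. by case: W_chain => _ _ H; rewrite /pr (H m k). Qed.

Let traj_ext m n s t : (forall i, (i <= n)%N -> s i = t i) ->
  trajectory W m n s = trajectory W m n t.
Proof.
by move=> st; apply/seteqP; split=> w h1 i iN; rewrite h1 ?st.
Qed.

Let doobE (x y : 'I_K.+1) (j : bool) : y = (if j then x.+1 else x.-1) :> nat ->
  doob_transform p lam h x y = Q x j.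
Proof.
move=> yE; rewrite /doob_transform /doob_step mxE walkE -!vec_natE yE; congr (_ / _).
case: j {yE}; first by rewrite eqxx (_ : (x.+1 == x.-1 :> nat) = false) ?mulr1 ?mulr0 ?addr0//; lia.
by rewrite eqxx (_ : (x.-1 == x.+1 :> nat) = false) ?mulr1 ?mulr0 ?add0r//; lia.
Qed.

(* The event that the chain makes a forbidden jump. *)
Let NA : set Omega := \bigcup_(k : int * 'I_K.+1 * 'I_K.+1)
  [set w | [/\ W (k.1.1 - 1) w = k.1.2, W k.1.1 w = k.2,
    k.2 <> k.1.2.+1 :> nat & k.2 <> k.1.2.-1 :> nat]].

Let NA_null : measurable NA /\ pr Prob NA = 0.
Proof.
suff H (k : int * 'I_K.+1 * 'I_K.+1) : measurable [set w | [/\ W (k.1.1 - 1) w = k.1.2,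
      W k.1.1 w = k.2, k.2 <> k.1.2.+1 :> nat & k.2 <> k.1.2.-1 :> nat]] /\
    pr Prob [set w | [/\ W (k.1.1 - 1) w = k.1.2, W k.1.1 w = k.2,
      k.2 <> k.1.2.+1 :> nat & k.2 <> k.1.2.-1 :> nat]] = 0.
  by apply: pr_null_countable => k; case: (H k).
case: k => -[n x] y /=.
have [h1|h1] := pselect (y <> x.+1 :> nat /\ y <> x.-1 :> nat); last first.
  rewrite (_ : mkset _ = set0) ?pr0//.
  by apply/seteqP; split=> // w [_ _ h2 h3]; case: h1.
case: h1 => h1 h2; pose s i := if i is 0%N then x else y.
have -> : [set w | [/\ W (n - 1) w = x, W n w = y, y <> x.+1 :> nat & y <> x.-1 :> nat]]
   = trajectory W (n - 1) 1 s.
  apply/seteqP; split=> w /=.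
    by case=> e1 e2 _ _ [|[|//]] _; rewrite ?addr0 ?subrK.
  by move=> H; split=> //; [have := H 0%N isT|have := H 1%N isT]; rewrite ?addr0 ?subrK.
split=> //; rewrite traj_step /s /doob_transform mxE walkE.
move/eqP/negbTE : h1 => ->; move/eqP/negbTE : h2 => ->.
by rewrite !mulr0 addr0 !mul0r mulr0.
Qed.

Let W_step n w : ~ NA w -> W n w = (if eta w n then (W (n - 1) w).+1 else (W (n - 1) w).-1) :> nat.
Proof.
move=> nA; rewrite etaE; case: eqP => // h1; apply: contrapT => h2.
by apply: nA; exists (n, W (n - 1) w, W n w).
Qed.

Let W_run L n w : ~ NA w -> W n w = run (W (n - L%:Z) w) (word L n (eta w)) :> nat.
Proof.
move=> nA; elim: L n => [|L IH] n; first by rewrite subr0.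
rewrite (W_step n nA) /= (IH (n - 1)) (_ : n - L.+1%:Z = n - 1 - L%:Z)//; lia.
Qed.

Let ae A B : measurable A -> measurable B -> (forall w, ~ NA w -> A w <-> B w) ->
  pr Prob A = pr Prob B.
Proof. by move=> mA mB; exact: (pr_ae_eq mA mB NA_null.1 NA_null.2). Qed.

Let meta C : measurable C -> measurable (eta @^-1` C).
Proof. by move=> mC; rewrite -[X in measurable X]setTI; exact: measurable_funP. Qed.

(** The load at the left end and the word together determine the trajectory of [W], so word
    probabilities are sums of trajectory probabilities over that load. *)
Let path_word n (u : nat) (y : seq bool) : set Omega :=
  [set w | W (n - (size y)%:Z) w = u :> nat] `&` eta @^-1` [set x | word (size y) n x = y].

Let mpath n u y : measurable (path_word n u y).
Proof. by apply: measurableI => //; apply: meta; exact: measurable_word1. Qed.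

Let ok u y := forall k, (run u (drop k y) <= K)%N.

Let tr u y (i : nat) : 'I_K.+1 := inord (run u (drop (size y - i) y)).

Let path_traj n u y w : ok u y -> ~ NA w ->
  path_word n u y w <-> trajectory W (n - (size y)%:Z) (size y) (tr u y) w.
Proof.
move=> oky nA; split.
  case=> /= h1 h2 i iy; apply: val_inj; rewrite /tr /= inordK ?ltnS//.
  set m := n - _ + _; rewrite (W_run i m nA) (_ : m - i%:Z = n - (size y)%:Z); last first.
    by rewrite /m addrK.
  rewrite h1 -{2}h2 {2}(_ : size y = size y - i + i)%N; last by rewrite subnK.
  by rewrite drop_word (_ : n - (size y - i)%N%:Z = m)// /m; lia.
move=> H; have HW j : (j <= size y)%N -> W (n - j%:Z) w = run u (drop j y) :> nat.
  move=> jy; have := H (size y - j)%N (leq_subr _ _).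
  rewrite (_ : n - _ + _ = n - j%:Z); last lia.
  by move=> ->; rewrite /tr subKn// inordK ?ltnS.
split=> /=; first by rewrite HW// drop_size.
apply: (@eq_from_nth _ false); rewrite size_word// => i iy.
rewrite nth_word// etaE (HW i (ltnW iy)) (_ : n - i%:Z - 1 = n - i.+1%:Z); last lia.
rewrite HW// (drop_nth false iy) /=; case: (nth _ _ _); first by rewrite eqxx.
by apply/eqP; lia.
Qed.

Let path_not_ok n u y : ~ ok u y -> pr Prob (path_word n u y) = 0.
Proof.
move=> nok; apply: (pr_null (mpath n u y) NA_null.1 NA_null.2) => w [/= h1 h2].
apply: contrapT => nA; apply: nok => k.
have [ky|yk] := leqP k (size y); last first.
  by rewrite drop_oversize ?(ltnW yk)//= -h1 -ltnS.
rewrite -h2 {1}(_ : size y = k + (size y - k))%N; last by rewrite subnKC.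
rewrite drop_word -h1 (_ : n - (size y)%:Z = n - k%:Z - (size y - k)%N%:Z); last lia.
by rewrite -W_run// -ltnS.
Qed.

Let path_cons n u b y :
  pr Prob (path_word n u (b :: y)) = pr Prob (path_word (n - 1) u y) * Q (run u y) b.
Proof.
have [okb|nok] := pselect (ok u (b :: y)); last first.
  (* The word lifts the load above [K]. If this happens only at the new site, the load before it is
     [K] and the factor [Q] vanishes with [hn K.+1]. *)
  rewrite path_not_ok//; have [oky|noky] := pselect (ok u y); last first.
    by rewrite path_not_ok// mul0r.
  have rK : (K < run u (b :: y))%N.
    rewrite ltnNge; apply/negP => rK; apply: nok => -[|k]; first by rewrite drop0.
    exact: oky.
  have := oky 0%N; rewrite drop0 => ryK.
  case: b {nok} rK => /= rK; last by lia.
  by rewrite /doob_step hn_out// mulr0 mul0r mulr0.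
have oky : ok u y by move=> k; exact: (okb k.+1).
rewrite (@ae _ (trajectory W (n - (size (b :: y))%:Z) (size (b :: y)) (tr u (b :: y))))//; last first.
  by move=> w nA; exact: path_traj.
rewrite (@ae (path_word (n - 1) u y) (trajectory W (n - 1 - (size y)%:Z) (size y) (tr u y)))//; last first.
  by move=> w nA; exact: path_traj.
have E i : (i <= size y)%N -> tr u (b :: y) i = tr u y i.
  by move=> iy; rewrite /tr /= subSn.
rewrite /= traj_step (traj_ext _ E) E// (_ : n - (size y).+1%:Z = n - 1 - (size y)%:Z); last lia.
congr (_ * _); rewrite /tr subnn drop0 subnn drop0.
have rK := oky 0%N; have rK' := okb 0%N; rewrite !drop0 in rK rK'.
rewrite (@doobE _ _ b) inordK ?ltnS//.
by rewrite inordK ?ltnS//; case: (b).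
Qed.

Let partW A (m : int) : measurable A ->
  pr Prob A = \sum_(v < K.+1) pr Prob (A `&` [set w | W m w = v :> nat]).
Proof.
move=> mA; rewrite -pr_sum.
- congr pr; apply/seteqP; split=> [w Aw|w [v _ []//]].
  by exists (W m w).
- by move=> v; apply: measurableI.
- move=> u v uv; apply/seteqP; split=> // w [[_ /= h1] [_ /= h2]].
  by move/eqP: uv; apply; apply: val_inj; rewrite /= -h1 -h2.
Qed.

Let word_pr n y : pr Prob (eta @^-1` [set x : config | word (size y) n x = y])
  = \sum_(v < K.+1) pr Prob (path_word n v y).
Proof.
rewrite (partW (n - (size y)%:Z)); last by apply: meta; exact: measurable_word1.
by apply: eq_bigr => v _; rewrite setIC.
Qed.

Let W_stat n m (v : 'I_K.+1) :
  pr Prob [set w | W n w = v :> nat] = pr Prob [set w | W m w = v :> nat].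
Proof.
have E k : [set w | W k w = v :> nat] = trajectory W k 0 (fun=> v).
  apply/seteqP; split=> w /=; first by move=> h1 [|i] // _; rewrite addr0; exact: val_inj.
  by move=> H; rewrite -(H 0%N isT) addr0.
by rewrite !E (traj_stat _ m).
Qed.

Let path_stat n m (v : 'I_K.+1) y : pr Prob (path_word n v y) = pr Prob (path_word m v y).
Proof.
elim: y n m => [|b y IH] n m; last by rewrite !path_cons (IH _ (m - 1)).
have E k : path_word k v [::] = [set w | W k w = v :> nat].
  by apply/seteqP; split=> w; rewrite /path_word /= subr0; first case.
by rewrite !E; exact: W_stat.
Qed.

Let word_stat n m y : pr Prob (eta @^-1` [set x : config | word (size y) n x = y])
  = pr Prob (eta @^-1` [set x : config | word (size y) m x = y]).
Proof. by rewrite !word_pr; apply: eq_bigr => v _; exact: path_stat. Qed.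

Let markovW n C u j : past_set (n - 1) C -> (u <= K)%N ->
  pr Prob (eta @^-1` C `&` ([set w | W (n - 1) w = u :> nat] `&` eta @^-1` [set x : config | x n = j]))
  = Q u j * pr Prob (eta @^-1` C `&` [set w | W (n - 1) w = u :> nat]).
Proof.
have /andP[p0 p1] := p01; have l0 := lam_gt0 => pC uK.
have hge v : 0 <= hn v by case: (leqP v K) => [/hn_gt0/ltW|/hn_out ->].
have Q0 : 0 <= Q u j.
  have lh : 0 <= lam * hn u by rewrite mulr_ge0// ltW.
  by rewrite /doob_step divr_ge0//; case: (j); rewrite mulr_ge0// ?subr_ge0 ltW.
have mj : measurable (eta @^-1` [set x : config | x n = j]).
  by apply: meta; exact: measurable_coordE.
have mA := measurableI _ _ (mWn (n - 1) u) mj.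
have me : measurable_fun setT eta by exact: measurable_funP.
have H := @past_pr_unique R _ Omega _ Omega Prob Prob eta eta _ _ (Q u j)
  (fun=> True) (n - 1) me me mA (mWn (n - 1) u) Q0.
apply: H pC.
- move=> y _; set V := eta @^-1` [set x : config | word (size y) (n - 1) x = y].
  have mV : measurable V by exact: (meta (measurable_word1 (size y) (n - 1) y)).
  set m := n - 1 - (size y)%:Z.
  rewrite (partW m (measurableI _ _ mV mA)) (partW m (measurableI _ _ mV (mWn (n - 1) u))).
  rewrite mulr_sumr; apply: eq_bigr => v _.
  have [E|E] := eqVneq (run v y) u.
    rewrite (@ae _ (path_word n v (j :: y))).
    + rewrite path_cons E mulrC; congr (_ * _); apply: ae => //.
        by apply: measurableI => //; exact: measurableI.
      move=> w nA; rewrite /path_word /=; split; last by case=> -[? _] ?.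
      by case=> h1 h2; split=> //; split=> //=; rewrite (W_run (size y) _ nA) h2 h1.
    + by apply: measurableI => //; exact: measurableI.
    + by [].
    move=> w nA; rewrite /path_word /= (_ : n - (size y).+1%:Z = m); last by rewrite /m; lia.
    split; first by case=> -[h1 [h2 h3]] h4; rewrite h1 h3.
    case=> h1 [h2 h3]; split=> //; split=> //; split=> //.
    by rewrite (W_run (size y) _ nA) h3 h1.
  have nul w : V w -> W (n - 1) w = u :> nat -> W m w = v :> nat -> NA w.
    move=> h1 h2 h3; apply: contrapT => nA; move/eqP: E; apply.
    by rewrite -h2 (W_run (size y) _ nA) h1 -/m h3.
  rewrite !(pr_null _ NA_null.1 NA_null.2) ?mulr0//.
  + by apply: measurableI => //; exact: measurableI.
  + by move=> w [[? ?] ?]; exact: nul.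
  + by apply: measurableI => //; exact: measurableI.
  + by move=> w [[? [? ?]] ?]; exact: nul.
- by rewrite never_good_true preimage_set0 set0I pr0.
- by rewrite never_good_true preimage_set0 set0I pr0.
Qed.

Let w (u : nat) : R := pr Prob [set w | W 0 w = u :> nat].

Let w_out u : (K < u)%N -> w u = 0.
Proof.
move=> Ku; rewrite /w (_ : mkset _ = set0) ?pr0//.
by apply/seteqP; split=> // x /= E; have := ltn_ord (W 0 x); lia.
Qed.

Let wE n u : pr Prob [set w | W n w = u :> nat] = w u.
Proof.
have [uK|Ku] := leqP u K.
  have uK' : (u < K.+1)%N by [].
  exact: (W_stat n 0 (Ordinal uK')).
rewrite w_out// (_ : mkset _ = set0) ?pr0//.
by apply/seteqP; split=> // x /= E; have := ltn_ord (W n x); lia.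
Qed.

Let w_jump n u j :
  pr Prob ([set w | W (n - 1) w = u :> nat] `&` eta @^-1` [set x : config | x n = j])
  = Q u j * w u.
Proof.
have mj : measurable (eta @^-1` [set x : config | x n = j]).
  by apply: meta; exact: measurable_coordE.
have [uK|Ku] := leqP u K.
  by have := markovW j (past_setT (n - 1)) uK; rewrite preimage_setT !setTI wE.
rewrite w_out// mulr0; apply: (pr_null _ (mWn (n - 1) u)).
- exact: measurableI.
- by rewrite wE w_out.
- by move=> x [].
Qed.

Let w_split u : w u = Q u true * w u + Q u false * w u.
Proof.
rewrite -!(w_jump 0) -{1}(wE (0 - 1)).
have mj := meta (measurable_coordE 0 true).
rewrite (pr_split Prob (mWn (0 - 1) u) mj); congr (_ + pr Prob (_ `&` _)).
by apply/seteqP; split=> x /=; case: (eta x 0).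
Qed.

Let w_in u : w u = (if u is v.+1 then Q v true * w v else Q 0 false * w 0)
  + Q u.+1 false * w u.+1.
Proof.
have mI v j : measurable ([set w | W (0 - 1) w = v :> nat] `&` eta @^-1` [set x : config | x 0 = j]).
  by apply: measurableI => //; exact: (meta (measurable_coordE 0 j)).
have -> : (if u is v.+1 then Q v true * w v else Q 0 false * w 0)
    = (if u is v.+1 then Q v true else Q 0 false) * w u.-1 by case: (u).
have -> : (if u is v.+1 then Q v true else Q 0 false) = Q u.-1 (0 < u)%N by case: (u).
rewrite -!(w_jump 0) -prU//; last first.
  by apply/seteqP; split=> // x [[/= h1 _] [/= h2 _]]; lia.
apply: ae => //; first exact: measurableU.
move=> x /(@W_step 0) S; rewrite /= S.
case E : (eta x 0); case: (u) => [|v] /=; split.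
- by [].
- by case=> -[].
- by case=> <-; left.
- by case=> -[// ->].
- by case W0 : (nat_of_ord (W (0 - 1) x)) => [|[|//]] _; [left|right].
- by case=> -[->].
- by case W0 : (nat_of_ord (W (0 - 1) x)) => [//|z] /= ->; right.
- by case=> -[// ->].
Qed.

(** Detailed balance of a stationary birth and death chain: [w_split] counts the mass leaving a
    level, [w_in] the mass arriving, and the edges are balanced one after the other from 0
    upwards. *)
Let flux u : Q u.+1 false * w u.+1 = Q u true * w u.
Proof.
elim: u => [|u IH].
  have := w_in 0; have := w_split 0 => /= e1 e2.
  by apply: (@addrI _ (Q 0 false * w 0)); rewrite -e2 {1}e1 addrC.
have := w_in u.+1; have := w_split u.+1 => /= e1 e2.
apply: (@addrI _ (Q u true * w u)); rewrite -e2 {1}e1 IH addrC.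
by [].
Qed.

Local Notation c := (p / (1 - p)).
Let kappa := w 0 / hn 0 ^+ 2.

(** The walk is reversible for the weights [c ^+ u], and the transform by [hn] multiplies a
    reversible measure by the square of [hn]; [flux] determines the solution from [w 0]. *)
Let w_formula u : w u = kappa * c ^+ u * hn u ^+ 2.
Proof.
have /andP[p0 p1] := p01; have l0 := lam_gt0.
have pp : 1 - p != 0 by lra.
have l0' : lam != 0 by lra.
have h00 : hn 0 != 0 by rewrite gt_eqF// hn_gt0.
have [uK|Ku] := leqP u K; last by rewrite w_out// hn_out// expr0n mulr0.
elim: u uK => [_|u IH uK]; first by rewrite /kappa expr0 mulr1 divfK// expf_neq0.
have hu : hn u != 0 by rewrite gt_eqF// hn_gt0// ltnW.
have hu1 : hn u.+1 != 0 by rewrite gt_eqF// hn_gt0.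
have := flux u; rewrite (IH (ltnW uK)) /doob_step /= => E.
have {}E := congr1 (fun z => z * (lam * hn u.+1 / ((1 - p) * hn u))) E.
transitivity ((1 - p) * hn u / (lam * hn u.+1) * w u.+1 * (lam * hn u.+1 / ((1 - p) * hn u))).
  by set z := w u.+1; field; rewrite ?hu ?hu1 ?l0' ?pp.
rewrite E /= [c ^+ u.+1]exprS; set Y := c ^+ u; set k := kappa.
by field; rewrite ?hu ?hu1 ?l0' ?pp.
Qed.

Let P : probability config R := distribution Prob eta.

Let prPE A : pr P A = pr Prob (eta @^-1` A).
Proof. by []. Qed.

Let shiftP m C : measurable C -> pr P (shift m @^-1` C) = pr P C.
Proof. by apply: shift_invariant => k l s; rewrite !prPE; exact: word_stat. Qed.

(** From every load a vacancy follows with positive probability [Q u false], so appending vacancies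
    cannot make a past event null. *)
Let zeros_null k n C : past_set n C ->
  pr P (C `&` [set x : config | word k (n + k%:Z) x = nseq k false]) = 0 -> pr P C = 0.
Proof.
have /andP[p0 p1] := p01.
elim: k n C => [|k IH] n C pC.
  by rewrite (_ : mkset _ = setT) ?setIT//; apply/seteqP; split.
move=> E; apply: (IH n C pC); set C' := C `&` _.
have pC' : past_set (n + k.+1%:Z - 1) C'.
  apply: past_setI; first by apply: past_setW pC; lia.
  by rewrite (_ : n + k.+1%:Z - 1 = n + k%:Z); [exact: past_set_word1|lia].
have mC' := meta pC'.1.
rewrite prPE (partW (n + k.+1%:Z - 1) mC') big1// => u _.
have uK : (u <= K)%N by rewrite -ltnS.
have mu := markovW false pC' uK.
have Qu : Q u false != 0.
  rewrite gt_eqF// /doob_step divr_gt0// mulr_gt0// ?hn_gt0//; last by lia.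
  by rewrite subr_gt0.
apply/eqP; rewrite -(mulrI_eq0 _ (mulfI Qu)) -mu; apply/eqP.
have mz : measurable (C `&` [set x : config | word k.+1 (n + k.+1%:Z) x = nseq k.+1 false]).
  by apply: measurableI; [exact: pC.1|exact: measurable_word1].
rewrite prPE in E; apply: (pr_null _ (meta mz) E).
  by apply: measurableI => //; apply: measurableI => //; exact: (meta (measurable_coordE _ _)).
move=> x [[h1 h2] [_ h3]]; split=> //=; move: h2 h3 => /= h2 ->.
by congr (_ :: _); rewrite -h2; congr word; lia.
Qed.

Let m2 := (K + K)%N.

Let no_block n : set config := [set x | forall L, ~ zero_tail m2 (word L n x)].

Let past_no_block n : past_set n (no_block n).
Proof.
split; last by move=> x y e H L; rewrite -(past_eq_word _ e); exact: H.
rewrite (_ : no_block n = \bigcap_L [set x : config | ~ zero_tail m2 (word L n x)]).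
  apply: bigcapT_measurable => L.
  exact: (measurable_word L n [set s | ~ zero_tail m2 s]).
by apply/seteqP; split=> x /= h1 L; [move=> _|]; exact: h1.
Qed.

Let zero_tail_cat s t : zero_tail m2 t -> zero_tail m2 (s ++ t).
Proof. by case=> t' ->; exists (s ++ t'); rewrite catA. Qed.

Let no_block_shift n m : pr P (no_block n) = pr P (no_block m).
Proof.
rewrite -(@shiftP (n - m) _ (past_no_block m).1); congr pr.
have E L x : word L m (shift (n - m) x) = word L n x.
  by rewrite word_shift; congr word; lia.
by apply/seteqP; split=> x /= H L; have := H L; rewrite E.
Qed.

(** By stationarity, moving the right end by [m2] sites preserves the probability, although the new
    event also excludes a vacant block on the added sites. So [no_block n] followed by that block is
    null, and [zeros_null] applies. *)
Let no_block_null n : pr P (no_block n) = 0.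
Proof.
apply: (@zeros_null m2 _ _ (past_no_block n)).
set Z := [set x : config | word _ _ x = _].
have mZ : measurable Z by exact: measurable_word1.
have mB := (past_no_block n).1.
have := pr_split P mB mZ.
have : pr P (no_block (n + m2%:Z)) <= pr P (no_block n `&` ~` Z).
  apply: le_pr; first exact: (past_no_block _).1.
    by apply: measurableI => //; exact: measurableC.
  move=> x H; split=> [L|E].
    have := H (m2 + L)%N; rewrite word_add => h1 h2; apply: h1.
    by apply: zero_tail_cat; rewrite (_ : n + _ - _ = n)//; lia.
  by apply: (H m2); exists [::].
rewrite (no_block_shift _ n); have := pr_ge0 P (no_block n `&` Z).
by move=> h1 h2 h3; apply/eqP; rewrite eq_le h1 andbT; lra.
Qed.

Let blocks n : pr P (never_good (zero_tail m2) n) = 0.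
Proof.
have [mU U0] := pr_null_countable (P := P) (fun L0 : nat => (past_no_block (n - L0%:Z)).1)
  (fun L0 : nat => no_block_null (n - L0%:Z)).
apply: pr_null mU U0 _; first exact: measurable_never_good.
move=> x [L0 H]; exists L0 => // L h1.
apply: (H (L0 + L)%N (leq_addr _ _)).
by rewrite word_add; exact: zero_tail_cat.
Qed.

Let NO : set Omega := NA `|` eta @^-1` never_good (zero_tail m2) 0.

Let NO_null : measurable NO /\ pr Prob NO = 0.
Proof.
have mN : measurable (eta @^-1` never_good (zero_tail m2) 0).
  by apply: meta; exact: measurable_never_good.
split; first by apply: measurableU => //; exact: NA_null.1.
by apply: pr_nullU => //; [exact: NA_null.1|exact: NA_null.2|exact: (blocks 0)].
Qed.

(** Far to the left a block of vacancies empties [W]. From its right end on, [W] agrees with a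
    carrier started there empty, and no carrier started empty elsewhere exceeds [W]. *)
Let W_carrier n x : ~ NO x -> finite_carrier n (eta x) /\ carrier n (eta x) = W n x :> nat.
Proof.
move=> nN; have nA : ~ NA x by move=> h1; apply: nN; left.
have [L [hL [t E]]] : exists L, (`|n| + m2 <= L)%N /\ zero_tail m2 (word L 0 (eta x)).
  apply: contrapT => H; apply: nN; right; exists (`|n| + m2)%N => L hL hz.
  by apply: H; exists L.
have sz := congr1 size E; rewrite size_word size_cat size_nseq in sz.
pose m : int := - (size t)%:Z.
have W0 : W m x = 0%N :> nat.
  rewrite (W_run m2 m nA).
  have -> : word m2 m (eta x) = nseq m2 false.
    have := congr1 (drop (size t)) E; rewrite drop_size_cat// sz drop_word => <-.
    by congr word; rewrite /m; lia.
  by rewrite run_nseq_false; have := ltn_ord (W (m - m2%:Z) x); rewrite /m2; lia.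
have mn : m <= n by rewrite /m; lia.
have H v : load_ge n v (eta x) <-> (v <= W n x)%N.
  split=> [[k]|vW].
    rewrite window_load_word -/(run 0 _) => /leq_trans; apply.
    by rewrite (W_run k n nA); exact: run_mono.
  exists `|n - m|%N; rewrite window_load_word -/(run 0 _).
  have := W_run `|n - m|%N n nA.
  by rewrite (_ : n - `|n - m|%N%:Z = m) ?W0 => [<-//|]; lia.
split; last exact: carrier_unique.
by exists (W n x).+1; rewrite H ltnn.
Qed.

(** [NO] lives in [Omega], whereas the general argument needs an exceptional event among
    configurations. Countable operations make its measurability evident. *)
Let NC : set config := ~` ([set x : config | finite_carrier 0 x] `&`
  ~` \bigcup_(n : int) ~` \bigcup_(v : 'I_K.+1) [set x : config | carrier n x = v]).

Let mNC : measurable NC.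
Proof.
apply: measurableC; apply: measurableI; first by meas.
apply: measurableC; apply: countable_bigcupT_measurable => [|n]; first exact: countableP.
apply: measurableC; apply: countable_bigcupT_measurable => [|v]; first exact: countableP.
by meas.
Qed.

Let NC0 : pr P NC = 0.
Proof.
rewrite prPE; apply: (pr_null _ NO_null.1 NO_null.2); first exact: meta.
move=> x /= nC; apply: contrapT => nO; apply: nC; split; first exact: (W_carrier 0 nO).1.
case=> n _; apply; exists (W n x) => //; exact: (W_carrier n nO).2.
Qed.

Let boundedNC x : ~ NC x -> finite_carrier 0 x /\ (forall n, carrier n x <= K)%N.
Proof.
move=> /contrapT[f H]; split=> // n; rewrite leqNgt; apply/negP => Kn; apply: H.
by exists n => // -[v _ /= E]; have := ltn_ord v; lia.
Qed.

Let carrierW C n u : measurable C ->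
  pr P (C `&` [set x : config | carrier n x = u])
  = pr Prob (eta @^-1` C `&` [set x | W n x = u :> nat]).
Proof.
move=> mC; rewrite prPE; apply: (pr_ae_eq _ _ NO_null.1 NO_null.2).
- by apply: meta; apply: measurableI => //; meas.
- by apply: measurableI => //; exact: meta.
by move=> x /(W_carrier n)[_ E] /=; rewrite E.
Qed.

Lemma conditioned_pitman :
  {ae P, forall x, pitman_defined R x} /\ ergodic P (pitman R).
Proof.
apply: (@conditioned_chain_pitman R P p lam kappa K hn NC) => //.
- by move=> u uK; exact: vec_nat_rec.
- move=> n C u j pC uK; have mC := pC.1.
  rewrite carrierW// -markovW//.
  rewrite -setIA [X in pr P (_ `&` X)]setIC setIA carrierW; last first.
    by apply: measurableI => //; meas.
  by rewrite preimage_setI -setIA; congr (pr Prob (_ `&` _)); rewrite setIC.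
- move=> n u; rewrite -[mkset _]setTI carrierW// preimage_setT setTI wE.
  exact: w_formula.
Qed.

End Conditioned.

(** * The three examples *)

Section Examples.
Context (R : realType) d (Omega : measurableType d) (Prob : probability Omega R).
Context (eta : {mfun Omega >-> config}).
Let X n w := eta w n.

Let word_event n s : set Omega := eta @^-1` [set x : config | word (size s) n x = s].

Let word_trajectory n b s : word_event n (b :: s) =
  trajectory X (n - (size s)%:Z) (size s) (fun i => nth false (b :: s) (size s - i)).
Proof.
apply/seteqP; split=> w; rewrite /word_event /trajectory /X.
  move=> /= E i iL; rewrite -E -/(word (size s).+1 n (eta w)) nth_word; last lia.
  by congr (eta w _); lia.
move=> /= H; apply: (@eq_from_nth _ false); rewrite -/(word (size s).+1 n (eta w)) size_word// => i iL.
rewrite nth_word//; have := H (size s - i)%N (leq_subr _ _).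
rewrite subKn//; by move=> <-; congr (eta w _); lia.
Qed.

Let mevent n s : measurable (word_event n s).
Proof.
rewrite -[X in measurable X]setTI; apply: measurable_funP => //.
exact: measurable_word1.
Qed.

Lemma markov_example (p : bool -> R) :
  0 <= p false -> 0 <= p true -> p false + p true < 1 ->
  stationary_markov_chain Prob (fun i j => bernoulli_pmf (p i) j) X ->
  {ae distribution Prob eta, forall x, pitman_defined R x} /\
  ergodic (distribution Prob eta) (pitman R).
Proof.
move=> a0 b0 ab [mX step stat].
have traj_ext m n s t : (forall i, (i <= n)%N -> s i = t i) ->
    trajectory X m n s = trajectory X m n t.
  by move=> st; apply/seteqP; split=> w h1 i iN; rewrite h1 ?st.
apply: (@markov_chain_pitman R (distribution Prob eta) p) => //.
- move=> n s c e.
  rewrite -[LHS]/(pr Prob (word_event n [:: c, e & s])).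
  rewrite -[X in _ * X]/(pr Prob (word_event (n - 1) (e :: s))).
  (* Words run leftwards, trajectories rightwards. Both words end at the same left site, so one
     reversed indexing serves both. *)
  pose f i := nth false [:: c, e & s] ((size s).+1 - i).
  have E1 : word_event n [:: c, e & s] = trajectory X (n - (size s).+1%:Z) (size s).+1 f.
    exact: word_trajectory.
  have E2 : word_event (n - 1) (e :: s) = trajectory X (n - (size s).+1%:Z) (size s) f.
    rewrite word_trajectory (_ : n - 1 - (size s)%:Z = n - (size s).+1%:Z); last lia.
    by apply: traj_ext => i iL; rewrite /f subSn.
  have := step (n - (size s).+1%:Z) (size s) f; rewrite -E1 -E2 => S.
  rewrite /pr S (prE Prob (mevent _ _)) -EFinM /= mulrC /f subnn subSn ?leqnn// subnn.
  by [].
- move=> n m [|b s].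
    by congr pr; apply/seteqP; split.
  rewrite -[LHS]/(pr Prob (word_event n (b :: s))) -[RHS]/(pr Prob (word_event m (b :: s))).
  by rewrite !word_trajectory /pr (stat _ (m - (size s)%:Z)).
Qed.

Lemma bernoulli_example (p : R) : 0 <= p < 1 / 2 -> iid_bernoulli Prob p X ->
  {ae distribution Prob eta, forall x, pitman_defined R x} /\
  ergodic (distribution Prob eta) (pitman R).
Proof.
move=> /andP[p0 p2] [ind law].
have word_pr n s : pr Prob (word_event n s) = \prod_(b <- s) bernoulli_pmf p b.
  pose sites : seq int := [seq n - i%:Z | i <- iota 0 (size s)].
  pose J : {fset int} := [fset k in sites]%fset.
  pose B k : set bool := [set nth false s `|n - k|%N].
  have E : word_event n s = \bigcap_(k in [set` J]) X k @^-1` B k.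
    apply/seteqP; split=> w; rewrite /word_event /= => H.
      move=> k /=; rewrite !inE => /mapP[i]; rewrite mem_iota => /andP[_ iL] ->.
      rewrite /B /= /X (_ : `|n - (n - i%:Z)%R|%N = i); last lia.
      by rewrite -[in RHS]H nth_word.
    apply: (@eq_from_nth _ false); rewrite size_word// => i iL.
    rewrite nth_word//; have := H (n - i%:Z).
    rewrite /B /= /X (_ : `|n - (n - i%:Z)%R|%N = i); last lia.
    by apply; rewrite !inE; apply/mapP; exists i => //; rewrite mem_iota.
  rewrite /pr E ind; last by [].
  have -> : (\prod_(k <- J) Prob (X k @^-1` B k) =
      \prod_(k <- sites) Prob (X k @^-1` B k))%E.
    apply: perm_big; apply: uniq_perm; first exact: fset_uniq.
      by rewrite /sites map_inj_uniq ?iota_uniq// => i j; lia.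
    by move=> k; rewrite !inE.
  rewrite /sites big_map (big_nth false) /index_iota subn0.
  transitivity (fine (\prod_(i <- iota 0 (size s)) (bernoulli_pmf p (nth false s i))%:E)%E).
    congr fine; apply: eq_bigr => i _; rewrite law /B /bernoulli_prob.
    rewrite (_ : `|n - (n - i%:Z)%R|%N = i); last lia.
    by rewrite ifT ?fsbig_set1//; apply/andP; split=> //; lra.
  have -> : (\prod_(i <- iota 0 (size s)) (bernoulli_pmf p (nth false s i))%:E)%E
      = (\prod_(i <- iota 0 (size s)) bernoulli_pmf p (nth false s i))%:E.
    by elim: (iota _ _) => [|i t IH]; rewrite ?big_nil ?big_cons// IH EFinM.
  by [].
(* With equal transition probabilities the condition [a + b < 1] is [p < 1 / 2]. *)
apply: (@markov_chain_pitman R (distribution Prob eta) (fun=> p)) => //; first lra.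
- move=> n s c e.
  rewrite -[LHS]/(pr Prob (word_event n [:: c, e & s])).
  rewrite -[X in _ * X]/(pr Prob (word_event (n - 1) (e :: s))).
  by rewrite !word_pr !big_cons.
- move=> n m s.
  rewrite -[LHS]/(pr Prob (word_event n s)) -[RHS]/(pr Prob (word_event m s)).
  by rewrite !word_pr.
Qed.

End Examples.

Theorem corollary1p17 (R : realType) (d : measure_display)
    (Omega : measurableType d) (Prob : probability Omega R)
    (eta : {mfun Omega >-> config})
    (example :
      (exists p : R, 0 <= p < 1 / 2 /\
         iid_bernoulli Prob p (fun n w => eta w n)) \/
      (exists p : bool -> R,
         [/\ 0 < p false < 1, 0 <= p true < 1, p false + p true < 1 &
             stationary_markov_chain Prob (fun i j => bernoulli_pmf (p i) j)
               (fun n w => eta w n)]) \/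
      (exists (p : R) (K : nat), 0 < p < 1 /\
         conditioned_bernoulli p K Prob (fun n w => eta w n))) :
  {ae distribution Prob eta, forall x, pitman_defined R x} /\
  ergodic (distribution Prob eta) (pitman R).
Proof.
case: example => [[p [p01 iid]]|[[p [/andP[a0 _] /andP[b0 _] ab chain]]|[p [K [p01 cond]]]]].
- exact: bernoulli_example iid.
- by apply: markov_example chain => //; exact: ltW.
- case: cond => lam [h [W [[/andP[lam0 _] _] h0 eig chain etaE]]].
  exact: conditioned_pitman p01 lam0 h0 eig chain etaE.
Qed.
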